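(* Let $1<p,q<\infty$ with $\frac1p+\frac1q=1$. If $f\in L^p_{\mathcal H}(X,\nu)$ and $g\in L^q_{\mathcal H}(X,\nu)$, then $$\|f\otimes g\|_{1,sep,\nu\otimes_{\nu_\rho}\nu}\le\|f\|_p\,\|g\|_q$$ and $$\|f\otimes g\|_{1,sep,dec}\le\|f\|_{p,dec}\,\|g\|_{q,dec}.$$
   Context: Setting. $\mathcal H$ is a finite-dimensional or separable Hilbert space, $X$ is a locally compact Hausdorff space, and $\mathcal O(X)$ is the Borel $\sigma$-algebra of $X$. $\mathcal S(\mathcal H)$ is the set of positive trace-one operators in $\mathcal B(\mathcal H)$ (states). $\nu:\mathcal O(X)\to\mathcal B(\mathcal H)$ is a positive operator-valued measure (POVM): $\nu(E)\ge 0$ for all $E$, and $\nu$ is countably additive on disjoint Borel sets in the ultraweak topology ($A_n\to A$ ultraweakly iff $\operatorname{Tr}(sA_n)\to\operatorname{Tr}(sA)$ for all $s\in\mathcal S(\mathcal H)$). Fix a full-rank (trivial null space) $\rho\in\mathcal S(\mathcal H)$ and put $\nu_\rho(E)=\operatorname{Tr}(\rho\,\nu(E))$, a finite positive measure mutually absolutely continuous with $\nu$. For an orthonormal basis $\{e_i\}$ put $\nu_{ij}(E)=\langle\nu(E)e_j,e_i\rangle$ and $D:=\frac{d\nu}{d\nu_\rho}=\big[\frac{d\nu_{ij}}{d\nu_\rho}\big]_{i,j}$. It is assumed that $D(x)$ is a bounded operator for a.e. $x$; it is then positive a.e. ''Almost everywhere'' means with respect to $\nu$, equivalently $\nu_\rho$.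 A quantum random variable is a function $f:X\to\mathcal B(\mathcal H)$ such that $x\mapsto\operatorname{Tr}(sf(x))$ is Borel measurable for every $s\in\mathcal S(\mathcal H)$. $\mathcal L_{\mathcal H}(X,\nu)$ is the linear span of the positive quantum random variables. For $s\in\mathcal S(\mathcal H)$ set $f_s(x)=\operatorname{Tr}\big(sD(x)^{1/2}f(x)D(x)^{1/2}\big)$. For $f\in\mathcal L_{\mathcal H}(X,\nu)$ let $Pos_f$ be the set of $(f_1,f_2,f_3,f_4)\in\mathcal L_{\mathcal H}(X,\nu)^4$ with all $f_i\ge 0$ and $f=f_1-f_2+if_3-if_4$. For $1\le r<\infty$ define $$\|f\|_r=\inf_{Pos_f}\ \sup_{s\in\mathcal S(\mathcal H)}\Big(\int_X (f_1+f_2+f_3+f_4)_s^r\,d\nu_\rho\Big)^{1/r}\in[0,\infty],$$ $$\|f\|_{r,dec}=\inf\Big\{\max\{\|S_1\|_r,\|S_2\|_r\}: S_1,S_2\in\mathcal L_{\mathcal H}(X,\nu),\ S_1,S_2\ge0,\ \begin{bmatrix}S_1(x)&f(x)\\ f(x)^*&S_2(x)\end{bmatrix}\ge0\ \text{a.e.}\Big\}.$$ $L^r_{\mathcal H}(X,\nu)$ is $\{f\in\mathcal L_{\mathcal H}(X,\nu):\|f\|_r<\infty\}$ modulo $\{f:\|f\|_r=0\}$. The same definitions apply to any POVM on any such Hilbert space. Tensor products. $\nu\otimes_{\nu_\rho}\nu$ is the POVM on $\mathcal H\otimes\mathcal H$ given by $(\nu\otimes_{\nu_\rho}\nu)(E)=\int_E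 D\otimes D\,d\nu_\rho$ (entrywise/ultraweak integral), where it is assumed that $(\nu\otimes_{\nu_\rho}\nu)(X)\in\mathcal B(\mathcal H\otimes\mathcal H)$. $(f\otimes g)(x)=f(x)\otimes g(x)$. The separable states are $$\mathcal S(\mathcal H\otimes\mathcal H)_{sep}=\overline{\operatorname{conv}\{s_1\otimes s_2:s_1,s_2\in\mathcal S(\mathcal H)\}}\subset\mathcal S(\mathcal H\otimes\mathcal H).$$ For an operator-valued function $F$ into $\mathcal B(\mathcal H\otimes\mathcal H)$ and $s\in\mathcal S(\mathcal H\otimes\mathcal H)$, put $F_s(x)=\operatorname{Tr}\big(s(D(x)\otimes D(x))^{1/2}F(x)(D(x)\otimes D(x))^{1/2}\big)$, and $$\|F\|_{1,sep,\nu\otimes_{\nu_\rho}\nu}=\sup\{\|F_s\|_{L^1(X,\nu_\rho)}:s\in\mathcal S(\mathcal H\otimes\mathcal H)_{sep}\}.$$ Finally, $$\|f\otimes g\|_{1,sep,dec}=\inf\big\{\max\{\|S_1\|_{1,sep,\nu\otimes_{\nu_\rho}\nu},\|S_2\|_{1,sep,\nu\otimes_{\nu_\rho}\nu}\}\big\},$$ the infimum being over $S_1,S_2\in L^1_{\mathcal H\otimes\mathcal H}(X,\nu\otimes_{\nu_\rho}\nu)$ with $S_1,S_2\ge0$ and $\begin{bmatrix}S_1(x)&f(x)\otimes g(x)\\ (f(x)\otimes g(x))^*&S_2(x)\end{bmatrix}\ge0$ a.e.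
   Formalization: For infinite-dimensional H the second inequality is false as written (no admissible S_1,S_2 in L^1 may exist); there S_1,S_2 range over positive elements of the span with finite 1,sep norm. For finite-dimensional H it is also proved as written. *)

(* Defs.v *)
From HB Require Import structures.
From mathcomp Require Import all_boot all_order all_algebra.
From mathcomp Require Import sesquilinear complex.
From mathcomp Require Import all_classical all_reals all_analysis.

Set Implicit Arguments.
Unset Strict Implicit.
Unset Printing Implicit Defensive.

Import Order.TTheory GRing.Theory Num.Theory.
Import numFieldNormedType.Exports.

Local Open Scope classical_set_scope.
Local Open Scope ring_scope.

(* On [R[i]] the order [0 <= z] means that z is real and nonnegative. *)

(* Complex Hilbert spaces; [inner] is linear in its first argument. *)
Record hilbert (R : realType) := Hilbert {
  hvec :> lmodType R[i];
  inner : {dot hvec for (@Num.Def.conjC R[i])};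
  hnorm := fun u : hvec => Num.sqrt (complex.Re (inner u u));
  hilbert_complete : forall u : nat -> hvec,
    (forall eps : R, 0 < eps -> exists N : nat, forall m n : nat,
       (N <= m)%N -> (N <= n)%N -> hnorm (u m - u n) < eps) ->
    exists l : hvec, forall eps : R, 0 < eps -> exists N : nat,
      forall n : nat, (N <= n)%N -> hnorm (u n - l) < eps }.

Arguments inner {R h}.
Arguments hnorm {R h} u.

(* The Hilbert space H (x) H, characterised (up to a unitary) as a completion
   of the algebraic tensor product. *)
Record tensor_square (R : realType) (H : hilbert R) := TensorSquare {
  tvec :> hilbert R;
  tens : {bilinear H -> H -> tvec | *:%R & *:%R};
  inner_tens : forall a b c d : H,
    inner (h := tvec) (tens a b) (tens c d) = inner a c * inner b d;
  tens_dense : forall (z : tvec) (eps : R), 0 < eps ->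
    exists s : seq (H * H),
      hnorm (h := tvec) (z - \sum_(ab <- s) tens ab.1 ab.2) < eps }.

Section Operators.
Context (R : realType) (H : hilbert R).
Implicit Types (A B C D T : H -> H).

Definition bounded_op T : Prop :=
  linear T /\ exists M : R, forall u : H, hnorm (T u) <= M * hnorm u.

Definition positive_op T : Prop :=
  bounded_op T /\ forall u : H, 0 <= inner (T u) u.

Definition full_rank T : Prop := forall u : H, T u = 0 -> u = 0.

Definition adjoint T : H -> H :=
  xget (fun=> 0) [set T' : H -> H | bounded_op T' /\
    forall u v : H, inner (T u) v = inner u (T' v)].

Definition opsqrt T : H -> H :=
  xget (fun=> 0) [set B : H -> H | positive_op B /\ B \o B = T].

(* Positivity on H (+) H of the operator matrix [A B; C D]. *)
Definition block_ge0 A B C D : Prop := forall u v : H,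
  0 <= inner (A u + B v) u + inner (C u + D v) v.

Definition orthonormal_basis (I : countType) (e : I -> H) : Prop :=
  (forall i j : I, inner (e i) (e j) = (i == j)%:R) /\
  (forall u : H, (forall i : I, inner u (e i) = 0) -> u = 0).

End Operators.

Section TensorOperators.
Context (R : realType) (H : hilbert R) (K : tensor_square H).

Definition optens (A B : H -> H) : K -> K :=
  xget (fun=> 0) [set T : K -> K | bounded_op T /\
    forall a b : H, T (tens K a b) = tens K (A a) (B b)].

Definition basis_tens (I : countType) (e : I -> H) : I * I -> K :=
  fun ij => tens K (e ij.1) (e ij.2).

End TensorOperators.

Arguments optens {R H} K A B.
Arguments basis_tens {R H} K {I} e.
Arguments tens {R H} t : rename.

Section Trace.
Context (R : realType).

(* Unordered sum of an absolutely summable family. *)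
Definition rsum (I : countType) (u : I -> R) : R :=
  fine (\esum_(i in [set: I]) ((EFin \o u)^\+ i)%E) -
  fine (\esum_(i in [set: I]) ((EFin \o u)^\- i)%E).

Context (H : hilbert R) (I : countType) (e : I -> H).

(* Trace of a trace-class operator, computed in the orthonormal basis e. *)
Definition tr (T : H -> H) : R[i] :=
  (rsum (fun i => complex.Re (inner (T (e i)) (e i))) +i*
   rsum (fun i => complex.Im (inner (T (e i)) (e i))))%C.

Definition trace_norm (T : H -> H) : \bar R :=
  \esum_(i in [set: I])
    (complex.Re (inner (opsqrt (adjoint T \o T) (e i)) (e i)))%:E.

Definition state (s : H -> H) : Prop := positive_op s /\ tr s = 1.

Definition ultraweak_cvg (A : nat -> H -> H) (B : H -> H) : Prop :=
  forall s : H -> H, state s ->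
    (fun n => complex.Re (tr (s \o A n))) @ \oo --> complex.Re (tr (s \o B)) /\
    (fun n => complex.Im (tr (s \o A n))) @ \oo --> complex.Im (tr (s \o B)).

End Trace.

Section SeparableStates.
Context (R : realType) (H : hilbert R) (K : tensor_square H).
Context (I : countType) (e : I -> H).

Definition conv_product_states : set (K -> K) :=
  [set c | exists (n : nat) (w : 'I_n -> R) (s1 s2 : 'I_n -> H -> H),
    [/\ forall k, 0 <= w k, \sum_(k < n) w k = 1,
        forall k, state e (s1 k) /\ state e (s2 k) &
        c = fun z => \sum_(k < n) ((w k)%:C)%C *: optens K (s1 k) (s2 k) z]].

(* Closure in trace norm. *)
Definition sep_state : set (K -> K) :=
  [set s | state (basis_tens K e) s /\
    forall eps : R, 0 < eps -> exists2 c, conv_product_states c &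
      (trace_norm (basis_tens K e) (fun z => (s z - c z)%R) < eps%:E)%E].

End SeparableStates.

Arguments sep_state {R H} K {I} e.

Notation borelType X := (g_sigma_algebraType (@open X)).

Section QuantumRandomVariables.
Context (R : realType) (X : ptopologicalType).
Context (H : hilbert R) (I : countType) (e : I -> H).
Implicit Types (nu : set (borelType X) -> H -> H).
Implicit Types (mu : set (borelType X) -> \bar R).
Implicit Types (f D : borelType X -> H -> H) (r : R).

Definition povm nu : Prop :=
  (forall E, measurable E -> positive_op (nu E)) /\
  (forall F : nat -> set (borelType X),
     (forall n, measurable (F n)) -> trivIset setT F ->
     ultraweak_cvg e (fun n u => \sum_(k < n) nu (F k) u)
                     (nu (\bigcup_n F n))).

Definition povm_at (rho : H -> H) nu : set (borelType X) -> \bar R :=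
  fun E => (complex.Re (tr e (rho \o nu E)))%:E.

(* The matrix entry (i, j) of A is <A e_j, e_i>. *)
Definition entry (A : H -> H) (i j : I) : R[i] := inner (A (e j)) (e i).

(* d is the matrix of Radon-Nikodym derivatives of the entries of nu. *)
Definition entrywise_derivative nu mu (d : borelType X -> I -> I -> R[i]) : Prop :=
  forall i j : I,
    [/\ mu.-integrable setT (fun x => (complex.Re (d x i j))%:E),
        mu.-integrable setT (fun x => (complex.Im (d x i j))%:E) &
        forall E, measurable E ->
          (complex.Re (entry (nu E) i j))%:E =
            (\int[mu]_(x in E) (complex.Re (d x i j))%:E)%E /\
          (complex.Im (entry (nu E) i j))%:E =
            (\int[mu]_(x in E) (complex.Im (d x i j))%:E)%E].

Definition qrv f : Prop :=
  (forall x, bounded_op (f x)) /\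
  forall s : H -> H, state e s ->
    measurable_fun setT (fun x => complex.Re (tr e (s \o f x))) /\
    measurable_fun setT (fun x => complex.Im (tr e (s \o f x))).

Definition nonneg f : Prop := forall x, positive_op (f x).

Definition Lspan : set (borelType X -> H -> H) :=
  [set f | exists (n : nat) (c : 'I_n -> R[i])
             (g : 'I_n -> borelType X -> H -> H),
    (forall k, qrv (g k) /\ nonneg (g k)) /\
    forall x u, f x u = \sum_(k < n) c k *: g k x u].

Definition scalarization D f (s : H -> H) (x : borelType X) : R[i] :=
  tr e (s \o opsqrt (D x) \o f x \o opsqrt (D x)).

Definition Pos f f1 f2 f3 f4 : Prop :=
  [/\ Lspan f1 /\ nonneg f1, Lspan f2 /\ nonneg f2,
      Lspan f3 /\ nonneg f3, Lspan f4 /\ nonneg f4 &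
      forall x u,
        f x u = f1 x u - f2 x u + 'i%C *: f3 x u - 'i%C *: f4 x u].

(* Here and below, mu is the scalar measure of the POVM in the reference
   state, and D the derivative of the POVM with respect to mu. *)
Definition rnorm mu D r f : \bar R :=
  ereal_inf [set M : \bar R | exists f1 f2 f3 f4, Pos f f1 f2 f3 f4 /\
    M = ereal_sup [set ((\int[mu]_x
          ((complex.Re (scalarization D
              (fun x u => (f1 x u + f2 x u + f3 x u + f4 x u)%R) s x)) `^ r)%:E)
          `^ r^-1)%E | s in state e]].

Definition Lr mu D r : set (borelType X -> H -> H) :=
  [set f | Lspan f /\ (rnorm mu D r f < +oo)%E].

Definition block_ae mu (S1 S2 f : borelType X -> H -> H) : Prop :=
  {ae mu, forall x, block_ge0 (S1 x) (f x) (adjoint (f x)) (S2 x)}.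

Definition decnorm mu D r f : \bar R :=
  ereal_inf [set M : \bar R | exists S1 S2,
    [/\ Lspan S1 /\ nonneg S1, Lspan S2 /\ nonneg S2, block_ae mu S1 S2 f &
        M = maxe (rnorm mu D r S1) (rnorm mu D r S2)]].

End QuantumRandomVariables.

Section SeparableNorms.
Context (R : realType) (X : ptopologicalType).
Context (H : hilbert R) (K : tensor_square H) (I : countType) (e : I -> H).
Implicit Types (mu : set (borelType X) -> \bar R).
Implicit Types (D f g : borelType X -> H -> H) (F : borelType X -> K -> K).

Definition ftens f g : borelType X -> K -> K := fun x => optens K (f x) (g x).

Definition sepnorm mu D F : \bar R :=
  ereal_sup [set (\int[mu]_x
      (complex.Re `|scalarization (basis_tens K e) (ftens D D) F s x|)%:E)%E
    | s in sep_state K e].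

(* The space L^1 of the tensor POVM E |-> \int_E D (x) D dmu on K, where
   mu = Tr(rho nu). Its reference state is rho (x) rho: since Tr(rho D) = 1
   a.e., its scalar measure in that state is mu itself and its derivative with
   respect to mu is D (x) D. The supremum in this norm is over all states of K,
   not only the separable ones. *)
Definition L1tens mu D : set (borelType X -> K -> K) :=
  Lr (basis_tens K e) mu (ftens D D) 1.

Definition L1sep mu D : set (borelType X -> K -> K) :=
  [set F | Lspan (basis_tens K e) F /\ (sepnorm mu D F < +oo)%E].

(* The parameter L is the space over which S1 and S2 range. If H is
   finite-dimensional, L1tens and L1sep have the same positive elements. If H
   is infinite-dimensional, f and g of finite p- and q-norm exist for which no
   S1, S2 in L1tens are admissible, so that the infimum over L1tens is +oo:
   take X the disjoint union of the unit spheres of C^n (n > 0), H the direct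
   sum of the C^n, nu(E) = m(E) Id where m has total mass 2^-n on the n-th
   sphere and is uniform there, p = q = 2, and f(v), g(v) equal to n 2^(n/2)
   times the projections on v and on its conjugate. *)
Definition sepdecnorm (L : set (borelType X -> K -> K)) mu D F : \bar R :=
  ereal_inf [set M : \bar R | exists S1 S2,
    [/\ L S1 /\ nonneg S1, L S2 /\ nonneg S2, block_ae mu S1 S2 F &
        M = maxe (sepnorm mu D S1) (sepnorm mu D S2)]].

End SeparableNorms.

Arguments ftens {R X H} K f g.
Arguments sepnorm {R X H} K {I} e mu D F.
Arguments L1tens {R X H} K {I} e mu D.
Arguments L1sep {R X H} K {I} e mu D.
Arguments sepdecnorm {R X H} K {I} e L mu D F.

(* Main.v *)
(* Let F be the sum f_1 + f_2 + f_3 + f_4 of a decomposition of f, and G the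
   analogous sum for g. The operator matrices [F f; f^* F] and [G g; g^* G] are
   positive, so by the Schur product theorem [F (x) G, f (x) g; (f (x) g)^*, F (x) G]
   is positive too. As (D (x) D)^(1/2) = D^(1/2) (x) D^(1/2), this gives
   |(f (x) g)_s| <= (F (x) G)_s for every state s. For a product state,
   (F (x) G)_(s1 (x) s2) = F_s1 G_s2, whose integral is bounded by Hoelder's
   inequality; convex combinations follow by linearity, and limits of these by
   Fatou's lemma, because the formula
     Tr(s P) = \sum_j <s P^(1/2) e_j, P^(1/2) e_j>
   shows that s |-> Tr(s P) is lower semicontinuous. For the second inequality,
   tensoring the operator matrices of admissible pairs for f and g yields an
   admissible pair for f (x) g, to which the first inequality applies. *)

Require Import Defs.
From HB Require Import structures.
From mathcomp Require Import all_boot all_order all_algebra.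
From mathcomp Require Import sesquilinear complex.
From mathcomp Require Import all_classical all_reals all_analysis.
From mathcomp Require Import measurable_realfun ring lra.

Set Implicit Arguments.
Unset Strict Implicit.
Unset Printing Implicit Defensive.

Import Order.TTheory GRing.Theory Num.Theory.
Import numFieldNormedType.Exports.
Import ComplexField.Normc.

Local Open Scope classical_set_scope.
Local Open Scope ring_scope.

(** * Hilbert spaces *)

(** Adjoints, square roots and tensor products of operators are picked by [xget], so each has to be
    constructed and shown unique before anything can be computed with it. The square root is built
    as a limit of explicit polynomials, because the same limit later gives the weak measurability of
    x |-> D(x)^(1/2). Boundedness of A (x) B and positivity of tensored operator matrices both come
    from Schur's theorem for finite Gram kernels, followed by density. A second obstacle is the null
    set: D(x) is bounded and positive only almost everywhere, and scalarizations are uncontrolled,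
    possibly not even measurable, on the exceptional set. Integrals are therefore compared with
    those of a version [D'] that is positive everywhere, through comparison lemmas that allow a
    non-measurable function on one side. Finally, the norms are infima that need not be attained and
    may vanish. The estimates run with strict real upper bounds a and b, which [le_mul_of_lt] turns
    into the product of the norms at the very end. *)

Section InnerProduct.
Context (R : realType) (H : hilbert R).
Implicit Types (u v w : H) (a b : R[i]) (t : R).

(** Limits and sums are taken in [R] rather than in [R[i]]: by [innerE], the values of [rip] against
    v and i v recover the inner product, so a statement about [inner] splits into two real ones. *)
Definition rip u v : R := complex.Re (inner u v).

Lemma innerDl u v w : inner (u + v) w = inner u w + inner v w.
Proof. exact: linearDl. Qed.
Lemma innerDr u v w : inner u (v + w) = inner u v + inner u w.
Proof. exact: linearDr. Qed.
Lemma innerNl u v : inner (- u) v = - inner u v.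
Proof. exact: linearNl. Qed.
Lemma innerNr u v : inner u (- v) = - inner u v.
Proof. exact: linearNr. Qed.
Lemma innerBl u v w : inner (u - v) w = inner u w - inner v w.
Proof. exact: linearBl. Qed.
Lemma innerBr u v w : inner u (v - w) = inner u v - inner u w.
Proof. exact: linearBr. Qed.
Lemma inner0l u : inner 0 u = 0.
Proof. exact: linear0l. Qed.
Lemma inner0r u : inner u 0 = 0.
Proof. exact: linear0r. Qed.
Lemma innerZl a u v : inner (a *: u) v = a * inner u v.
Proof. exact: linearZl_LR. Qed.
Lemma innerZr a u v : inner u (a *: v) = (a^*)%C * inner u v.
Proof. exact: linearZr_LR. Qed.
Lemma inner_suml (J : Type) (r : seq J) (P : pred J) (F : J -> H) v :
  inner (\sum_(j <- r | P j) F j) v = \sum_(j <- r | P j) inner (F j) v.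
Proof. exact: linear_sumlz. Qed.
Lemma inner_sumr (J : Type) (r : seq J) (P : pred J) (F : J -> H) v :
  inner v (\sum_(j <- r | P j) F j) = \sum_(j <- r | P j) inner v (F j).
Proof. exact: linear_sumr. Qed.

Lemma innerC u v : inner u v = ((inner v u)^*)%C.
Proof. by rewrite hermC expr0 mul1r. Qed.

Lemma innerE u v : inner u v = (rip u v +i* rip u ('i%C *: v))%C.
Proof. by rewrite /rip innerZr; case: (inner u v) => x y; congr Complex; simpc. Qed.

Lemma inner_ge0 u : 0 <= inner u u.
Proof. exact: dnorm_ge0. Qed.

Lemma inner_uu u : inner u u = ((rip u u)%:C)%C.
Proof.
have := inner_ge0 u; rewrite /rip lecE /= => /andP[/eqP h _].
by case: (inner u u) h => x y /= ->.
Qed.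

Lemma ripC u v : rip u v = rip v u.
Proof. by rewrite /rip innerC; case: (inner v u). Qed.
Lemma rip_ge0 u : 0 <= rip u u.
Proof. by have := inner_ge0 u; rewrite inner_uu ler0c. Qed.
Lemma rip_eq0 u : rip u u = 0 -> u = 0.
Proof. by move=> h; apply/eqP; rewrite -(dnorm_eq0 inner) inner_uu h. Qed.
Lemma ripDl u v w : rip (u + v) w = rip u w + rip v w.
Proof. by rewrite /rip innerDl raddfD. Qed.
Lemma ripDr u v w : rip u (v + w) = rip u v + rip u w.
Proof. by rewrite /rip innerDr raddfD. Qed.
Lemma ripNl u v : rip (- u) v = - rip u v.
Proof. by rewrite /rip innerNl raddfN. Qed.
Lemma ripNr u v : rip u (- v) = - rip u v.
Proof. by rewrite /rip innerNr raddfN. Qed.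
Lemma ripBl u v w : rip (u - v) w = rip u w - rip v w.
Proof. by rewrite ripDl ripNl. Qed.
Lemma ripBr u v w : rip u (v - w) = rip u v - rip u w.
Proof. by rewrite ripDr ripNr. Qed.
Lemma rip0l u : rip 0 u = 0.
Proof. by rewrite /rip inner0l. Qed.
Lemma rip0r u : rip u 0 = 0.
Proof. by rewrite /rip inner0r. Qed.
Lemma ripZl t u v : rip ((t%:C)%C *: u) v = t * rip u v.
Proof. by rewrite /rip innerZl; case: (inner u v) => x y /=; simpc. Qed.
Lemma ripZr t u v : rip u ((t%:C)%C *: v) = t * rip u v.
Proof. by rewrite ripC ripZl ripC. Qed.
Lemma rip_il u v : rip ('i%C *: u) v = - rip u ('i%C *: v).
Proof. by rewrite /rip innerZl innerZr; case: (inner u v) => x y /=; simpc. Qed.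
Lemma Im_inner u v : complex.Im (inner u v) = rip u ('i%C *: v).
Proof. by rewrite innerE. Qed.

Lemma sqr_hnorm u : hnorm u ^+ 2 = rip u u.
Proof. by rewrite sqr_sqrtr// rip_ge0. Qed.
Lemma hnorm_ge0 u : 0 <= hnorm u.
Proof. exact: sqrtr_ge0. Qed.
Lemma hnorm0 : hnorm (0 : H) = 0.
Proof. by rewrite /hnorm inner0l sqrtr0. Qed.
Lemma hnorm_eq0 u : hnorm u = 0 -> u = 0.
Proof. by move=> h; apply: rip_eq0; rewrite -sqr_hnorm h expr0n. Qed.
Lemma hnormN u : hnorm (- u) = hnorm u.
Proof. by rewrite /hnorm innerNl innerNr opprK. Qed.
Lemma hnormBC u v : hnorm (u - v) = hnorm (v - u).
Proof. by rewrite -hnormN opprB. Qed.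

Lemma innerZZ a u : inner (a *: u) (a *: u) = (((normc a) ^+ 2 * rip u u)%:C)%C.
Proof.
rewrite innerZl innerZr inner_uu; case: a => x y; rewrite /normc sqr_sqrtr; last first.
  by rewrite addr_ge0// sqr_ge0.
apply/eqP; rewrite eq_complex; simpc.
by apply/andP; split; apply/eqP => /=; ring.
Qed.

Lemma normc_ge0 a : 0 <= normc a.
Proof. by case: a => x y; exact: sqrtr_ge0. Qed.

Lemma hnormZ a u : hnorm (a *: u) = normc a * hnorm u.
Proof.
by rewrite /hnorm innerZZ /= sqrtrM ?sqr_ge0// sqrtr_sqr ger0_norm// normc_ge0.
Qed.

Lemma hnormZr t u : hnorm ((t%:C)%C *: u) = `|t| * hnorm u.
Proof. by rewrite hnormZ /normc /= expr0n /= addr0 sqrtr_sqr. Qed.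

End InnerProduct.

(** For c > 0 the polynomial is evaluated at its minimum t = -b/c. For c = 0 and b nonzero, t = -(a
    + 1)/(2b) gives the value -1, a contradiction. *)
Lemma psd_quadratic (R : realType) (a b c : R) :
  (forall t : R, 0 <= a + t * b *+ 2 + t ^+ 2 * c) -> 0 <= a -> 0 <= c -> b ^+ 2 <= a * c.
Proof.
move=> h a0 c0; have [c_eq0|cn0] := eqVneq c 0.
  have [->|bn0] := eqVneq b 0; first by rewrite expr0n mulr_ge0.
  have := h (- (a + 1) / (b *+ 2)).
  have b2 : b *+ 2 != 0 by rewrite mulrn_eq0.
  rewrite c_eq0 mulr0 addr0 -mulrnAr mulfVK// => /le_trans.
  by move=> /(_ (- 1)) ; rewrite opprD addrA subrr add0r lexx => /(_ isT); lra.
have cp : 0 < c by rewrite lt0r cn0.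
have := h (- b / c).
have -> : a + - b / c * b *+ 2 + (- b / c) ^+ 2 * c = (a * c - b ^+ 2) / c.
  by field.
by rewrite pmulr_lge0 ?invr_gt0// subr_ge0.
Qed.

Section Norm.
Context (R : realType) (H : hilbert R).
Implicit Types (u v w : H) (a b : R[i]) (t : R).

Lemma rip_CS u v : rip u v <= hnorm u * hnorm v.
Proof.
have [h|h] := leP (rip u v) 0; first by rewrite (le_trans h)// mulr_ge0// hnorm_ge0.
rewrite -(@ler_pXn2r _ 2)// ?nnegrE ?mulr_ge0 ?hnorm_ge0 ?(ltW h)//.
rewrite exprMn !sqr_hnorm; apply: psd_quadratic; rewrite ?rip_ge0// => t.
have := rip_ge0 (u + (t%:C)%C *: v); rewrite !ripDl !ripDr !ripZl !ripZr (ripC v u).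
by congr (_ <= _); ring.
Qed.

Lemma abs_rip u v : `|rip u v| <= hnorm u * hnorm v.
Proof.
by rewrite ler_norml rip_CS andbT lerNl -ripNl (le_trans (rip_CS _ _))// hnormN.
Qed.

Lemma normc_inner u v : normc (inner u v) <= hnorm u * hnorm v.
Proof.
set z := inner u v; have [z0|zn0] := eqVneq (normc z) 0.
  by rewrite z0 mulr_ge0// hnorm_ge0.
have zp : 0 < normc z by rewrite lt0r zn0 normc_ge0.
have := rip_CS ((z^*)%C *: u) v; rewrite hnormZ /rip innerZl -/z.
have -> : normc (z^*)%C = normc z by case: (z) => x y /=; rewrite sqrrN.
have -> : complex.Re ((z^*)%C * z) = normc z * normc z.
  rewrite -expr2; case: (z) => x y /=; rewrite sqr_sqrtr ?addr_ge0 ?sqr_ge0//.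
  by simpc; ring.
by rewrite -mulrA ler_pM2l.
Qed.

Lemma hnormD u v : hnorm (u + v) <= hnorm u + hnorm v.
Proof.
rewrite -(@ler_pXn2r _ 2)// ?nnegrE ?addr_ge0 ?hnorm_ge0//.
rewrite sqr_hnorm ripDl !ripDr (ripC v u) sqrrD !sqr_hnorm.
have := rip_CS u v; lra.
Qed.

Lemma hnorm_triangle u v w : hnorm (u - w) <= hnorm (u - v) + hnorm (v - w).
Proof. by rewrite -(subrKA v) hnormD. Qed.

Lemma hnorm_dist u v : `|hnorm u - hnorm v| <= hnorm (u - v).
Proof.
have h1 := hnormD (u - v) v; have h2 := hnormD (v - u) u.
rewrite !subrK in h1 h2; rewrite (hnormBC v) in h2.
by rewrite ler_norml; apply/andP; split; lra.
Qed.

Lemma rip_eqP u v : (forall w, rip u w = rip v w) -> u = v.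
Proof.
move=> h; apply/eqP; rewrite -subr_eq0; apply/eqP; apply: rip_eq0.
by rewrite ripBl h subrr.
Qed.

End Norm.

Section Convergence.
Context (R : realType) (H : hilbert R).
Implicit Types (us vs : nat -> H) (u v w : H).

Definition hcvg us u := (fun n => hnorm (us n - u)) @ \oo --> (0 : R).

Lemma hcvgP us u : hcvg us u <-> forall eps : R, 0 < eps ->
  \forall n \near \oo, hnorm (us n - u) < eps.
Proof.
split=> [/cvgrPdist_lt h eps e0|h].
  by apply: filterS (h _ e0) => n; rewrite sub0r normrN ger0_norm ?hnorm_ge0.
apply/cvgrPdist_lt => eps e0; apply: filterS (h _ e0) => n.
by rewrite sub0r normrN ger0_norm ?hnorm_ge0.
Qed.

Lemma hcvg_cst u : hcvg (fun=> u) u.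
Proof. by rewrite /hcvg subrr hnorm0; exact: cvg_cst. Qed.

Lemma hcvg_le (d : nat -> R) us u :
  (forall n, hnorm (us n - u) <= d n) -> d @ \oo --> (0 : R) -> hcvg us u.
Proof.
move=> h d0; apply: squeeze_cvgr (cvg_cst (0 : R)) d0.
by apply: nearW => n; rewrite hnorm_ge0 h.
Qed.

Lemma hcvgD us vs u v : hcvg us u -> hcvg vs v -> hcvg (fun n => us n + vs n) (u + v).
Proof.
move=> hu hv; apply: (@hcvg_le (fun n => hnorm (us n - u) + hnorm (vs n - v))).
  by move=> n; rewrite opprD addrACA hnormD.
by rewrite -(addr0 (0 : R)); apply: cvgD.
Qed.

Lemma hcvgZ (a : R[i]) us u : hcvg us u -> hcvg (fun n => a *: us n) (a *: u).
Proof.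
move=> hu; apply: (@hcvg_le (fun n => normc a * hnorm (us n - u))).
  by move=> n; rewrite -scalerBr hnormZ.
by rewrite -(mulr0 (normc a)); apply: cvgMr.
Qed.

Lemma hcvgN us u : hcvg us u -> hcvg (fun n => - us n) (- u).
Proof.
by move=> /(@hcvgZ (-1)); rewrite scaleN1r; under eq_fun do rewrite scaleN1r.
Qed.

Lemma hcvg_unique us u v : hcvg us u -> hcvg us v -> u = v.
Proof.
move=> hu hv; apply/eqP; rewrite -subr_eq0; apply/eqP/hnorm_eq0.
have h : (fun n => hnorm (us n - u) + hnorm (us n - v)) @ \oo --> (0 + 0 : R).
  exact: cvgD.
apply/eqP; rewrite eq_le hnorm_ge0 andbT -[leRHS]addr0.
apply: (ler_cvg_to (cvg_cst (hnorm (u - v))) h); apply: nearW => n.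
by rewrite (hnormBC (us n) u) hnorm_triangle.
Qed.

Lemma hcvg_norm us u : hcvg us u -> hnorm (us n) @[n --> \oo] --> hnorm u.
Proof.
move=> hu; apply/cvgrPdist_le => eps e0.
have /hcvgP/(_ _ e0) := hu; apply: filterS => n h.
by rewrite distrC (le_trans (hnorm_dist _ _))// ltW.
Qed.

Lemma hcvg_rip us vs u v : hcvg us u -> hcvg vs v ->
  rip (us n) (vs n) @[n --> \oo] --> rip u v.
Proof.
move=> hu hv.
have pol x y : rip x y = (hnorm (x + y) ^+ 2 - hnorm (x - y) ^+ 2) / 4.
  by rewrite !sqr_hnorm !(ripDl, ripDr, ripNl, ripNr) (ripC y x); field.
rewrite pol; under eq_fun do rewrite pol.
apply: cvgMl; apply: cvgB; rewrite expr2; under eq_fun do rewrite expr2.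
  by apply: cvgM; apply: hcvg_norm; apply: hcvgD.
by apply: cvgM; apply: hcvg_norm; apply: hcvgD => //; exact: hcvgN.
Qed.

Lemma hcvg_cauchy us (b : nat -> R) (l : R) :
  (forall m n, (m <= n)%N -> hnorm (us n - us m) <= b n - b m) ->
  b @ \oo --> l -> exists u, hcvg us u.
Proof.
move=> h bl; have [|u hu] := @hilbert_complete _ H us.
  move=> eps e0; have e2 : 0 < eps / 2 by rewrite divr_gt0.
  move/cvgrPdist_lt : bl => /(_ _ e2)[N _ hN]; exists N => m n Nm Nn.
  have := hN _ Nm; have := hN _ Nn; rewrite /= !ltr_norml => /andP[? ?] /andP[? ?].
  have [mn|/ltnW nm] := leqP m n.
    by rewrite hnormBC (le_lt_trans (h _ _ mn))//; lra.
  by rewrite (le_lt_trans (h _ _ nm))//; lra.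
exists u; apply/hcvgP => eps /hu[N hN]; near=> n; apply: hN.
by near: n; exists N.
Unshelve. all: by end_near. Qed.

End Convergence.

(** * Bounded and positive operators *)

Section BoundedOperators.
Context (R : realType) (H : hilbert R).
Implicit Types (u v w : H) (a : R[i]) (A B C T : H -> H).

Lemma bop_linear T : bounded_op T -> linear T. Proof. by case. Qed.

Lemma bopD T u v : bounded_op T -> T (u + v) = T u + T v.
Proof. by move=> [h _]; have := h 1 u v; rewrite !scale1r. Qed.
Lemma bop0 T : bounded_op T -> T 0 = 0.
Proof.
by move=> hT; apply: (@addrI _ (T 0)); rewrite -(bopD _ _ hT) !addr0.
Qed.
Lemma bopZ T a u : bounded_op T -> T (a *: u) = a *: T u.
Proof. by move=> hT; have := bop_linear hT a u 0; rewrite (bop0 hT) !addr0. Qed.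
Lemma bopN T u : bounded_op T -> T (- u) = - T u.
Proof. by move=> hT; rewrite -scaleN1r (bopZ _ _ hT) scaleN1r. Qed.
Lemma bopB T u v : bounded_op T -> T (u - v) = T u - T v.
Proof. by move=> hT; rewrite (bopD _ _ hT) (bopN _ hT). Qed.
Lemma bop_sum (J : Type) (r : seq J) (P : pred J) (F : J -> H) T : bounded_op T ->
  T (\sum_(j <- r | P j) F j) = \sum_(j <- r | P j) T (F j).
Proof.
move=> hT; elim/big_rec2 : _ => [|j x y _ <-]; first exact: bop0.
exact: bopD.
Qed.

Lemma bop_bound T : bounded_op T ->
  exists2 M : R, 0 < M & forall u, hnorm (T u) <= M * hnorm u.
Proof.
move=> [_ [M hM]]; exists (`|M| + 1) => [|u]; first by rewrite ltr_wpDl.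
rewrite (le_trans (hM u))// ler_wpM2r ?hnorm_ge0//.
by rewrite (le_trans (ler_norm _))// lerDl.
Qed.

Lemma bop_id : bounded_op (@id H).
Proof. by split=> //; exists 1 => u; rewrite mul1r. Qed.

Lemma bop_zero : bounded_op (fun _ : H => 0 : H).
Proof.
split=> [a u v|]; first by rewrite scaler0 addr0.
by exists 0 => u; rewrite hnorm0 mul0r.
Qed.

Lemma bop_comp A B : bounded_op A -> bounded_op B -> bounded_op (A \o B).
Proof.
move=> hA hB; split=> [a u v /=|]; first by rewrite (bop_linear hB) (bop_linear hA).
have [M M0 hM] := bop_bound hA; have [N N0 hN] := bop_bound hB.
exists (M * N) => u /=; rewrite (le_trans (hM _))// -mulrA ler_wpM2l// ltW//.
Qed.

Lemma bop_add A B : bounded_op A -> bounded_op B -> bounded_op (fun u => A u + B u).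
Proof.
move=> hA hB; split=> [a u v|].
  by rewrite (bop_linear hB) (bop_linear hA) scalerDr addrACA.
have [M M0 hM] := bop_bound hA; have [N N0 hN] := bop_bound hB.
by exists (M + N) => u; rewrite (le_trans (hnormD _ _))// mulrDl lerD.
Qed.

Lemma bop_scale a A : bounded_op A -> bounded_op (fun u => a *: A u).
Proof.
move=> hA; split=> [b u v|].
  by rewrite (bop_linear hA) scalerDr !scalerA (mulrC a).
have [M M0 hM] := bop_bound hA.
exists (normc a * M) => u; rewrite hnormZ -mulrA ler_wpM2l// normc_ge0//.
Qed.

Lemma bop_opp A : bounded_op A -> bounded_op (fun u => - A u).
Proof. by move=> /(bop_scale (-1)); under eq_fun do rewrite scaleN1r. Qed.

Lemma bop_sub A B : bounded_op A -> bounded_op B -> bounded_op (fun u => A u - B u).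
Proof. by move=> hA /bop_opp; exact: bop_add. Qed.

Lemma bop_sumf (J : Type) (r : seq J) (F : J -> H -> H) :
  (forall j, bounded_op (F j)) -> bounded_op (fun u => \sum_(j <- r) F j u).
Proof.
move=> hF; elim: r => [|j r ih].
  by under eq_fun do rewrite big_nil; exact: bop_zero.
by under eq_fun do rewrite big_cons; exact: bop_add.
Qed.

Lemma hcvg_bop T us u : bounded_op T -> hcvg us u -> hcvg (T \o us) (T u).
Proof.
move=> hT hu; have [M M0 hM] := bop_bound hT.
apply: (@hcvg_le _ _ (fun n => M * hnorm (us n - u))) => [n|].
  by rewrite /= -(bopB _ _ hT).
by rewrite -(mulr0 M); apply: cvgMr.
Qed.

(** The defining identity determines the operator picked by [xget], so an explicit candidate may
    replace it. *)
Lemma adjointP T T' : bounded_op T' ->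
  (forall u v, inner (T u) v = inner u (T' v)) -> adjoint T = T'.
Proof.
move=> hT' hadj; rewrite /adjoint; case: xgetP => [S _ [hS hS']|/(_ T') []]//=.
apply/funext => v; apply: rip_eqP => w; rewrite ripC (ripC (T' v)) /rip.
by rewrite -hadj -hS'.
Qed.

End BoundedOperators.

Section PositiveOperators.
Context (R : realType) (H : hilbert R).
Implicit Types (u v w : H) (a : R[i]) (A B C T : H -> H).

Definition selfadj T := forall u v, inner (T u) v = inner u (T v).

Lemma ge0_complexE (z : R[i]) : (0 <= z) = (complex.Im z == 0) && (0 <= complex.Re z).
Proof. by rewrite lecE. Qed.

Lemma positive_bop T : positive_op T -> bounded_op T. Proof. by case. Qed.

Lemma positive_rip T u : positive_op T -> 0 <= rip (T u) u.
Proof. by move=> [_ /(_ u)]; rewrite ge0_complexE => /andP[]. Qed.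

(** Polarization: reality of the form at u + v matches the imaginary parts of both sides, reality at
    u + i v the real parts. *)
Lemma linear_selfadj T : linear T -> (forall u, complex.Im (inner (T u) u) = 0) -> selfadj T.
Proof.
move=> lT him u v.
have lD x y : T (x + y) = T x + T y by have := lT 1 x y; rewrite !scale1r.
have l0 : T 0 = 0 by apply: (@addrI _ (T 0)); rewrite -lD !addr0.
have lZ b x : T (b *: x) = b *: T x by have := lT b x 0; rewrite l0 !addr0.
have h1 := him (u + v); have h2 := him (u + 'i%C *: v).
move: h1 h2 (him u) (him v); rewrite !lD !lZ !innerDl !innerDr !innerZl !innerZr.
rewrite [inner u (T v)]innerC; case: (inner (T u) v) => x y; case: (inner (T v) u) => x' y'.
case: (inner (T u) u) => p p'; case: (inner (T v) v) => q q'; simpc => /=.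
by move=> h1 h2 h3 h4; congr Complex; lra.
Qed.

Lemma positive_selfadj T : positive_op T -> selfadj T.
Proof.
move=> [[lT _] pT]; apply: linear_selfadj => // u.
by have := pT u; rewrite ge0_complexE => /andP[/eqP].
Qed.

Lemma selfadj_Im T u : selfadj T -> complex.Im (inner (T u) u) = 0.
Proof.
move=> /(_ u u); rewrite [inner u _]innerC; case: (inner (T u) u) => x y [] /=.
by move=> h; lra.
Qed.

Lemma selfadj_positive T : bounded_op T -> selfadj T -> (forall u, 0 <= rip (T u) u) ->
  positive_op T.
Proof.
by move=> hT sT pT; split=> // u; rewrite ge0_complexE selfadj_Im// eqxx pT.
Qed.

Lemma selfadj_rip T u v : selfadj T -> rip (T u) v = rip u (T v).
Proof. by move=> h; rewrite /rip h. Qed.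

Lemma positive_CS T u v : linear T -> selfadj T -> (forall u, 0 <= rip (T u) u) ->
  rip (T u) v ^+ 2 <= rip (T u) u * rip (T v) v.
Proof.
move=> lT sT pT; apply: psd_quadratic => // t.
have := pT (u + (t%:C)%C *: v); rewrite addrC lT !ripDl !ripDr !ripZl !ripZr.
have -> : rip (T v) u = rip (T u) v by rewrite (selfadj_rip _ _ sT) ripC.
by congr (_ <= _); ring.
Qed.

Lemma positive_eq0 T u : positive_op T -> rip (T u) u = 0 -> T u = 0.
Proof.
move=> pT h0; apply: rip_eq0; apply/eqP; rewrite -sqrf_eq0 eq_le sqr_ge0 andbT.
have := @positive_CS T u (T u) (bop_linear (positive_bop pT)) (positive_selfadj pT).
by rewrite h0 mul0r; apply => w; exact: positive_rip.
Qed.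

(** Cauchy-Schwarz for the form of T, with T u as second vector, gives |T u|^4 <= <T u, u> <T T u, T
    u> <= t^2 |u|^2 |T u|^2. *)
Lemma positive_form_norm T (t : R) : 0 <= t -> linear T -> selfadj T ->
  (forall u, 0 <= rip (T u) u) -> (forall u, rip (T u) u <= t * hnorm u ^+ 2) ->
  forall u, hnorm (T u) <= t * hnorm u.
Proof.
move=> t0 lT sT pT T1 u; have := @positive_CS T u (T u) lT sT pT.
rewrite -sqr_hnorm => h.
have {}h : (hnorm (T u) ^+ 2) ^+ 2 <= (t * hnorm u) ^+ 2 * hnorm (T u) ^+ 2.
  apply: (le_trans h).
  have -> : (t * hnorm u) ^+ 2 * hnorm (T u) ^+ 2 =
    (t * hnorm u ^+ 2) * (t * hnorm (T u) ^+ 2) by ring.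
  by apply: ler_pM.
have [->|n0] := eqVneq (hnorm (T u)) 0; first by rewrite mulr_ge0// hnorm_ge0.
have p0 : 0 < hnorm (T u) ^+ 2 by rewrite exprn_gt0// lt0r n0 hnorm_ge0.
move: h; rewrite [X in X <= _]expr2 ler_pM2r// ler_pXn2r ?nnegrE ?mulr_ge0 ?hnorm_ge0//.
Qed.

Lemma positive_comp T A : positive_op A -> bounded_op T -> selfadj T ->
  positive_op (T \o A \o T).
Proof.
move=> pA hT sT; split=> [|u /=]; first by do 2 apply: bop_comp => //; case: pA.
by rewrite sT; case: pA.
Qed.

Lemma selfadj_adjoint T : bounded_op T -> selfadj T -> adjoint T = T.
Proof. exact: adjointP. Qed.

End PositiveOperators.

(** * Square roots of positive operators *)

Section SquareRoot.
Context (R : realType) (H : hilbert R).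
Implicit Types (u v w : H) (a : R[i]) (A B C T : H -> H).
Local Notation "t *r u" := ((t%:C)%C *: u) (at level 40).

(* If S = 1 - T, a fixed point B of B = (S + B^2) / 2 satisfies (1 - B)^2 = T. *)
Fixpoint sqrt_iter (S : H -> H) n : H -> H :=
  if n is n'.+1 then fun u => 2^-1 *r (S u + sqrt_iter S n' (sqrt_iter S n' u))
  else fun=> 0.

(** The same recursion run on the scalar S = 1. It increases within [0, 1], and its increments
    dominate those of [sqrt_iter], which makes the latter Cauchy. *)
Fixpoint sqrt_bound n : R := if n is n'.+1 then (1 + sqrt_bound n' ^+ 2) / 2 else 0.

Lemma sqrt_bound01 n : 0 <= sqrt_bound n <= 1.
Proof.
elim: n => [|n /andP[h0 h1]] /=; first by rewrite lexx ler01.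
have : sqrt_bound n ^+ 2 <= 1 by rewrite exprn_ile1.
by have := sqr_ge0 (sqrt_bound n); move=> *; apply/andP; split; lra.
Qed.

Lemma sqrt_bound_nd m n : (m <= n)%N -> sqrt_bound m <= sqrt_bound n.
Proof.
move=> mn; apply: (nondecreasing_seqP sqrt_bound).1 mn.
elim=> [|k ih] /=; first by rewrite expr0n addr0 divr_ge0.
rewrite ler_pM2r ?invr_gt0// lerD2l ler_pXn2r// nnegrE.
  by have /andP[] := sqrt_bound01 k.
by have /andP[] := sqrt_bound01 k.+1.
Qed.

Context (S : H -> H) (bS : bounded_op S) (sS : selfadj S)
  (S1 : forall u, hnorm (S u) <= hnorm u).
Let B := sqrt_iter S.

Lemma sqrt_iter_bop n : bounded_op (B n).
Proof.
elim: n => [|n ih]; first exact: bop_zero.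
by apply: bop_scale; apply: bop_add => //; exact: (bop_comp ih ih).
Qed.

Lemma sqrt_iter_selfadj n : selfadj (B n).
Proof.
elim: n => [|n ih] u v /=; first by rewrite inner0l inner0r.
by rewrite innerZl innerZr conjc_real !innerDl !innerDr sS !ih.
Qed.

Lemma sqrt_iter_comm C n : bounded_op C -> (forall u, C (S u) = S (C u)) ->
  forall u, C (B n u) = B n (C u).
Proof.
move=> bC hC; elim: n => [|n ih] u /=; first exact: bop0.
by rewrite (bopZ _ _ bC) (bopD _ _ bC) hC !ih.
Qed.

Lemma sqrt_iter_le n u : hnorm (B n u) <= sqrt_bound n * hnorm u.
Proof.
elim: n u => [|n ih] u /=; first by rewrite hnorm0 mul0r.
have /andP[b0 _] := sqrt_bound01 n.
rewrite hnormZr ger0_norm ?invr_ge0// mulrAC mulrC ler_wpM2r// ?invr_ge0//.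
rewrite (le_trans (hnormD _ _))// mulrDl mul1r lerD//.
by rewrite (le_trans (ih _))// expr2 -mulrA ler_wpM2l.
Qed.

Lemma sqrt_iter_step n u :
  hnorm (B n.+1 u - B n u) <= (sqrt_bound n.+1 - sqrt_bound n) * hnorm u.
Proof.
elim: n u => [|n ih] u.
  rewrite /= expr0n /= !subr0 !addr0 div1r hnormZr ger0_norm ?invr_ge0//.
  by rewrite ler_wpM2l ?invr_ge0// addr0.
(* Difference of squares in the form X X - Y Y = X (X - Y) + (X - Y) Y for consecutive iterates X
   and Y; the scalar sequence is split in the same way just below. *)
have -> : B n.+2 u - B n.+1 u =
    2^-1 *r (B n.+1 (B n.+1 u - B n u) + (B n.+1 (B n u) - B n (B n u))).
  rewrite (bopB _ _ (sqrt_iter_bop n.+1)) addrA subrK.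
  by rewrite [B n.+2 u]/= [in X in _ - X]/B /= -scalerBr opprD addrACA subrr add0r.
have -> : (sqrt_bound n.+2 - sqrt_bound n.+1) * hnorm u = 2^-1 *
    (sqrt_bound n.+1 * ((sqrt_bound n.+1 - sqrt_bound n) * hnorm u) +
     (sqrt_bound n.+1 - sqrt_bound n) * (sqrt_bound n * hnorm u)).
  by rewrite /=; field.
rewrite hnormZr ger0_norm ?invr_ge0// ler_wpM2l ?invr_ge0//.
have /andP[b0 _] := sqrt_bound01 n.+1.
rewrite (le_trans (hnormD _ _))// lerD//.
  by rewrite (le_trans (sqrt_iter_le _ _))// ler_wpM2l.
rewrite (le_trans (ih _))// ler_wpM2l ?sqrt_iter_le//.
by rewrite subr_ge0 sqrt_bound_nd.
Qed.

Lemma sqrt_iter_cauchy u m n : (m <= n)%N ->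
  hnorm (B n u - B m u) <= sqrt_bound n * hnorm u - sqrt_bound m * hnorm u.
Proof.
move=> mn; rewrite -(subnK mn); elim: (n - m)%N => [|k ih].
  by rewrite add0n !subrr hnorm0.
rewrite addSn (le_trans (hnorm_triangle _ (B (k + m) u) _))//.
have := sqrt_iter_step (k + m) u; lra.
Qed.

Lemma sqrt_lim_ex : exists L : H -> H, [/\ forall u, hcvg (B ^~ u) (L u),
  bounded_op L, selfadj L & forall u, hnorm (L u) <= hnorm u].
Proof.
have cb : cvg (sqrt_bound @ \oo).
  apply: nondecreasing_is_cvgn => //; first by move=> m n; exact: sqrt_bound_nd.
  by exists 1 => _ [n _ <-]; have /andP[] := sqrt_bound01 n.
move: cb => /cvg_ex[l hl].
have hex u : exists w, hcvg (B ^~ u) w.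
  apply: (@hcvg_cauchy _ _ _ (fun n => sqrt_bound n * hnorm u) (l * hnorm u)).
    by move=> m n; exact: sqrt_iter_cauchy.
  exact: cvgMl.
have [L hL] := choice hex; exists L.
have L1 u : hnorm (L u) <= hnorm u.
  apply: (ler_cvg_to (hcvg_norm (hL u)) (cvg_cst _)); apply: nearW => n.
  rewrite (le_trans (sqrt_iter_le _ _))// ler_piMl ?hnorm_ge0//.
  by have /andP[] := sqrt_bound01 n.
have lL : linear L.
  move=> a u v; apply: hcvg_unique (hL _) _.
  under eq_fun do rewrite (bop_linear (sqrt_iter_bop _)).
  by apply: hcvgD => //; exact: hcvgZ.
split=> //; first by split=> //; exists 1 => u; rewrite mul1r.
apply: linear_selfadj => // u; rewrite Im_inner.
have h0 : rip (B n u) ('i%C *: u) @[n --> \oo] --> (0 : R).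
  rewrite (_ : (fun n => _) = fun=> 0); first exact: cvg_cst.
  by apply/funext => n; rewrite -Im_inner selfadj_Im//; exact: sqrt_iter_selfadj.
exact: (cvg_unique _ (hcvg_rip (hL u) (hcvg_cst _)) h0).
Qed.

End SquareRoot.

Section SquareRootExistence.
Context (R : realType) (H : hilbert R).
Implicit Types (u v w : H) (a : R[i]) (c : R) (A B C T : H -> H).
Local Notation "t *r u" := ((t%:C)%C *: u) (at level 40).

(** If T / c lies between 0 and 1, then sqrt T = sqrt c (1 - L), where L is the limit of the
    iteration for S = 1 - T / c. The approximants are named because the measurability of square
    roots is read off from them. *)
Definition sqrt_approx T c n u : H :=
  Num.sqrt c *r (u - sqrt_iter (fun w => w - c^-1 *r T w) n u).

(** The root commutes with whatever commutes with T because the iterates are polynomials in T. This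
    clause serves uniqueness; the convergence clause serves measurability. *)
Lemma sqrt_ex T c : positive_op T -> 0 < c ->
  (forall u, rip (T u) u <= c * hnorm u ^+ 2) ->
  exists B, [/\ positive_op B, forall u, B (B u) = T u,
    forall C, bounded_op C -> (forall u, C (T u) = T (C u)) ->
      forall u, C (B u) = B (C u) &
    forall u, hcvg (fun n => sqrt_approx T c n u) (B u)].
Proof.
move=> pT c0 hc; have bT := positive_bop pT.
pose S w : H := w - c^-1 *r T w.
have bS : bounded_op S by apply: bop_sub; [exact: bop_id|exact: bop_scale].
have sS : selfadj S.
  by move=> u v; rewrite innerBl innerBr innerZl innerZr conjc_real (positive_selfadj pT).
have c1 : 0 < c^-1 by rewrite invr_gt0.
have S1 : forall u, hnorm (S u) <= hnorm u.
  move=> v; rewrite -[leRHS]mul1r; move: v.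
  apply: positive_form_norm => // u; first exact: bop_linear.
    rewrite ripBl ripZl -sqr_hnorm subr_ge0 mulrC ler_pdivrMr// mulrC; exact: hc.
  by rewrite mul1r ripBl ripZl -sqr_hnorm gerBl mulr_ge0// ?(ltW c1)// positive_rip.
have [L [hL bL sL L1]] := sqrt_lim_ex bS sS S1.
(* Squares converge strongly because the iterates are contractions: the error made in the inner
   argument is not amplified. *)
have hLL u : hcvg (fun n => sqrt_iter S n (sqrt_iter S n u)) (L (L u)).
  apply: (@hcvg_le _ _ (fun n => hnorm (sqrt_iter S n u - L u) +
      hnorm (sqrt_iter S n (L u) - L (L u)))) => [n|].
    rewrite (le_trans (hnorm_triangle _ (sqrt_iter S n (L u)) _))// lerD2r.
    rewrite -(bopB _ _ (sqrt_iter_bop bS n)) (le_trans (sqrt_iter_le S1 _ _))//.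
    by rewrite ler_piMl ?hnorm_ge0//; have /andP[] := sqrt_bound01 R n.
  by rewrite -(addr0 (0 : R)); apply: cvgD; exact: hL.
(* The limit of the recursion is 2 L = S + L^2, that is, (1 - L)^2 = 1 - S = T / c. *)
have fixL u : S u + L (L u) = L u + L u.
  have h1 : hcvg (fun n => sqrt_iter S n.+1 u) (L u).
    have := hL u; rewrite /hcvg.
    by rewrite -(@cvg_shiftS _ (fun n => hnorm (sqrt_iter S n u - L u))).
  have h2 : hcvg (fun n => sqrt_iter S n.+1 u) (2^-1 *r (S u + L (L u))).
    by apply: hcvgZ; apply: hcvgD; [exact: hcvg_cst|exact: hLL].
  rewrite -(scale1r (S u + _)).
  have -> : (1 : R[i]) = ((2 : R)%:C)%C * ((2^-1 : R)%:C)%C.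
    by rewrite -rmorphM /= mulfV.
  rewrite -scalerA (hcvg_unique h2 h1).
  by rewrite (_ : ((2:R)%:C)%C = 1 + 1) ?scalerDl ?scale1r// -rmorphD.
pose B u : H := Num.sqrt c *r (u - L u).
have bB : bounded_op B.
  by apply: bop_scale; apply: bop_sub => //; exact: bop_id.
have sB : selfadj B.
  by move=> u v; rewrite innerZl innerZr conjc_real innerBl innerBr sL.
exists B; split.
- apply: selfadj_positive => // u.
  rewrite ripZl mulr_ge0 ?sqrtr_ge0// ripBl subr_ge0 (le_trans (rip_CS _ _))//.
  by rewrite -sqr_hnorm expr2 ler_wpM2r// hnorm_ge0.
- move=> u; have key : u - L u - L (u - L u) = u - S u.
    rewrite (bopB _ _ bL) (_ : L (L u) = L u + L u - S u); last first.
      by rewrite -fixL addrC addKr.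
    by rewrite (opprB (L u + L u)) addrCA (opprD (L u)) (addrA (L u)) subrr sub0r opprB subrKA.
  rewrite /B (bopZ _ _ bL) -scalerBr scalerA key -rmorphM /= -expr2 sqr_sqrtr ?ltW//.
  rewrite /S opprB addrC subrK scalerA -rmorphM /= mulfV ?scale1r//.
  by rewrite gt_eqF.
- move=> C bC hC u; rewrite /B (bopZ _ _ bC) (bopB _ _ bC); congr (_ *: (_ - _)).
  have h1 : hcvg (fun n => sqrt_iter S n (C u)) (C (L u)).
    have := hcvg_bop bC (hL u); congr hcvg; apply/funext => n /=.
    apply: sqrt_iter_comm => // w.
    by rewrite /S (bopB _ _ bC) (bopZ _ _ bC) hC.
  exact: hcvg_unique h1 (hL _).
- move=> u; apply: hcvgZ; apply: hcvgD; first exact: hcvg_cst.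
  by apply: hcvgN; exact: hL.
Qed.

Lemma bop_form_bound T : bounded_op T ->
  exists2 c, 0 < c & forall u, rip (T u) u <= c * hnorm u ^+ 2.
Proof.
move=> /bop_bound[M M0 hM]; exists M => // u.
by rewrite (le_trans (rip_CS _ _))// expr2 mulrA ler_wpM2r// hnorm_ge0.
Qed.

(** With y = (A - B) u and A, B commuting, (A + B) y = (A^2 - B^2) u = 0. The forms of A and B at y
    are nonnegative with sum 0, so A y = B y = 0, and |y|^2 = <u, (A - B) y> = 0. *)
Lemma sqrt_uniq T A B : positive_op A -> positive_op B ->
  (forall u, A (A u) = T u) -> (forall u, B (B u) = T u) ->
  (forall C, bounded_op C -> (forall u, C (T u) = T (C u)) ->
    forall u, C (B u) = B (C u)) -> A = B.
Proof.
move=> pA pB hA hB hcomm.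
have bA := positive_bop pA; have bB := positive_bop pB.
have AB u : A (B u) = B (A u) by apply: hcomm => // v; rewrite -!hA.
apply/funext => u; apply/eqP; rewrite -subr_eq0; apply/eqP; apply: rip_eq0.
set y := A u - B u.
have h : rip (A y) y + rip (B y) y = 0.
  rewrite -ripDl (_ : A y + B y = 0) ?rip0l//.
  by rewrite /y (bopB _ _ bA) (bopB _ _ bB) hA hB AB addrA subrK subrr.
have := positive_rip y pA; have := positive_rip y pB => hBy hAy.
have Ay : A y = 0 by apply: positive_eq0 => //; lra.
have By : B y = 0 by apply: positive_eq0 => //; lra.
rewrite {1}/y ripBl (selfadj_rip _ _ (positive_selfadj pA)).
by rewrite (selfadj_rip _ _ (positive_selfadj pB)) Ay By !rip0r subrr.
Qed.

Lemma opsqrt_unique T B : positive_op B -> (forall u, B (B u) = T u) -> opsqrt T = B.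
Proof.
move=> pB hB; have pT : positive_op T.
  rewrite (_ : T = B \o id \o B); last by apply/funext => u; rewrite /= hB.
  apply: positive_comp; [|exact: positive_bop|exact: positive_selfadj].
  by split=> [|u]; [exact: bop_id|exact: inner_ge0].
have [c c0 hc] := bop_form_bound (positive_bop pT).
have [B' [pB' hB' comm _]] := sqrt_ex pT c0 hc.
rewrite (sqrt_uniq pB pB' hB hB' comm) /opsqrt.
case: xgetP => [A _ [pA hA]|/(_ B') []].
  by apply: (sqrt_uniq (T := T)) => // u; rewrite -hA.
by split=> //; apply/funext => u; exact: hB'.
Qed.

Lemma opsqrt_cvg T c u : positive_op T -> 0 < c ->
  (forall u, rip (T u) u <= c * hnorm u ^+ 2) ->
  hcvg (fun n => sqrt_approx T c n u) (opsqrt T u).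
Proof.
move=> pT c0 hc; have [B [pB hB _ hcv]] := sqrt_ex pT c0 hc.
by rewrite (opsqrt_unique pB hB).
Qed.

Lemma opsqrt_positive T : positive_op T -> positive_op (opsqrt T).
Proof.
move=> pT; have [c c0 hc] := bop_form_bound (positive_bop pT).
by have [B [pB hB _ _]] := sqrt_ex pT c0 hc; rewrite (opsqrt_unique pB hB).
Qed.

Lemma opsqrtK T u : positive_op T -> opsqrt T (opsqrt T u) = T u.
Proof.
move=> pT; have [c c0 hc] := bop_form_bound (positive_bop pT).
by have [B [pB hB _ _]] := sqrt_ex pT c0 hc; rewrite (opsqrt_unique pB hB).
Qed.

Lemma opsqrt_bop T : positive_op T -> bounded_op (opsqrt T).
Proof. by move=> /opsqrt_positive/positive_bop. Qed.

Lemma opsqrt_selfadj T : positive_op T -> selfadj (opsqrt T).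
Proof. by move=> /opsqrt_positive/positive_selfadj. Qed.

Lemma opsqrt_norm T u : positive_op T -> hnorm (opsqrt T u) ^+ 2 = rip (T u) u.
Proof. by move=> pT; rewrite sqr_hnorm -(selfadj_rip _ _ (opsqrt_selfadj pT)) opsqrtK. Qed.

End SquareRootExistence.

(** * Orthonormal bases *)

(** [pickle_inv] is [None] off the range of [pickle]; such indices contribute 0, so one series
    covers finite and infinite index types. *)
Lemma esum_enum (R : realType) (I : countType) (a : I -> \bar R) :
  (forall i, (0 <= a i)%E) ->
  (\esum_(i in [set: I]) a i =
   \sum_(0 <= n <oo) (if @pickle_inv I n is Some i then a i else 0))%E.
Proof.
move=> a0; set b := fun n => (if @pickle_inv I n is Some i then a i else 0)%E.
have b0 n : (0 <= b n)%E by rewrite /b; case: pickle_inv.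
rewrite (nneseries_esumT b0).
have -> : (\esum_(i in [set: I]) a i = \esum_(i in [set: I]) b (pickle i))%E.
  by apply: eq_esum => i _; rewrite /b pickleK_inv.
rewrite -esum_image; last by move=> i j _ _; exact: (pcan_inj pickleK_inv).
rewrite esum_mkcond; apply: eq_esum => n _; case: ifPn => // hn.
rewrite /b; case hp : (pickle_inv n) => [i|//]; exfalso; move/negP: hn; apply.
by rewrite inE; exists i => //; have := @pickle_invK I n; rewrite hp.
Qed.

Section Basis.
Context (R : realType) (H : hilbert R) (I : countType) (e : I -> H).
Context (he : orthonormal_basis e).
Implicit Types (u v w : H).

(** The basis as a sequence padded with 0, which treats finite and infinite bases alike. The price
    is that some terms are not unit vectors, hence the form of [basis_enum_unit]. *)
Definition basis_enum n : H := if @pickle_inv I n is Some i then e i else 0.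
Local Notation en := basis_enum.

Definition basis_proj n u : H := \sum_(k < n) inner u (en k) *: en k.
Local Notation P := basis_proj.

Lemma basis_enum_orth k l : k != l -> inner (en k) (en l) = 0.
Proof.
move=> kl; rewrite /en.
case hk : (pickle_inv k) => [i|]; last by rewrite inner0l.
case hl : (pickle_inv l) => [j|]; last by rewrite inner0r.
rewrite he.1; case: eqP => // ij; move: kl.
have := @pickle_invK I k; have := @pickle_invK I l; rewrite hk hl /= ij => -> ->.
by rewrite eqxx.
Qed.

Lemma basis_enum_unit u k : inner u (en k) * inner (en k) (en k) = inner u (en k).
Proof.
rewrite /en; case: (pickle_inv k) => [i|]; last by rewrite inner0r mul0r.
by rewrite he.1 eqxx mulr1.
Qed.

Lemma inner_proj_enum n l u : (l < n)%N -> inner (P n u) (en l) = inner u (en l).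
Proof.
move=> ln; rewrite inner_suml (bigD1 (Ordinal ln))//= big1 => [|k kl].
  by rewrite addr0 innerZl basis_enum_unit.
by rewrite innerZl basis_enum_orth ?mulr0.
Qed.

Definition bessel n u : R := \sum_(k < n) normc (inner u (en k)) ^+ 2.

Lemma mul_conjc_normc (z : R[i]) : (z^*)%C * z = ((normc z ^+ 2)%:C)%C.
Proof.
case: z => x y; rewrite /normc sqr_sqrtr ?addr_ge0 ?sqr_ge0//.
by simpc; congr Complex; ring.
Qed.

Lemma rip_proj m n u : (m <= n)%N -> rip (P n u) (P m u) = bessel m u.
Proof.
move=> mn; rewrite /rip inner_sumr raddf_sum; apply: eq_bigr => k _ /=.
rewrite innerZr inner_proj_enum ?mul_conjc_normc//.
exact: leq_trans mn.
Qed.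

Lemma rip_self_proj n u : rip u (P n u) = bessel n u.
Proof.
rewrite /rip inner_sumr raddf_sum; apply: eq_bigr => k _ /=.
by rewrite innerZr mul_conjc_normc.
Qed.

Lemma bessel_nd u : nondecreasing_seq (bessel ^~ u).
Proof.
apply/nondecreasing_seqP => n; rewrite /bessel big_ord_recr /= lerDl.
exact: sqr_ge0.
Qed.

Lemma bessel_le n u : bessel n u <= hnorm u ^+ 2.
Proof.
have := rip_ge0 (u - P n u).
rewrite ripBl !ripBr (ripC (P n u) u) rip_self_proj rip_proj// sqr_hnorm.
by move=> h; lra.
Qed.

Lemma hcvg_cauchy_sqr (us : nat -> H) (b : nat -> R) (l : R) :
  (forall m n, (m <= n)%N -> hnorm (us n - us m) ^+ 2 <= b n - b m) ->
  b @ \oo --> l -> exists u, hcvg us u.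
Proof.
move=> h bl; have [|u hu] := @hilbert_complete _ H us.
  move=> eps e0; have e2 : 0 < eps ^+ 2 / 2 by rewrite divr_gt0// exprn_gt0.
  move/cvgrPdist_lt : bl => /(_ _ e2)[N _ hN]; exists N => m n Nm Nn.
  have := hN _ Nm; have := hN _ Nn; rewrite /= !ltr_norml => /andP[? ?] /andP[? ?].
  rewrite -(@ltr_pXn2r _ 2)// ?nnegrE ?hnorm_ge0 ?(ltW e0)//.
  have [mn|/ltnW nm] := leqP m n.
    by rewrite hnormBC (le_lt_trans (h _ _ mn))//; lra.
  by rewrite (le_lt_trans (h _ _ nm))//; lra.
exists u; apply/hcvgP => eps /hu[N hN]; near=> n; apply: hN.
by near: n; exists N.
Unshelve. all: by end_near. Qed.

Lemma inner_cvg_eq us u v w :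
  hcvg us u -> (\forall n \near \oo, inner (us n) w = inner v w) -> inner u w = inner v w.
Proof.
have key z : hcvg us u -> (\forall n \near \oo, rip (us n) z = rip v z) -> rip u z = rip v z.
  move=> hu hz; have h2 : rip (us n) z @[n --> \oo] --> rip v z.
    by apply: cvg_near_cst; apply: filterS hz => n ->.
  exact: (cvg_unique _ (hcvg_rip hu (hcvg_cst z)) h2).
move=> hu hw; rewrite innerE [RHS]innerE; congr Complex; apply: key => //.
  by apply: filterS hw => n; rewrite /rip => ->.
by apply: filterS hw => n; rewrite -!Im_inner => ->.
Qed.

(** Bessel's inequality makes the partial sums Cauchy. Each coefficient is constant from some index
    on, so the limit has the coefficients of u, and totality of the basis identifies the two. *)
Lemma basis_proj_cvg u : hcvg (P ^~ u) u.
Proof.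
have [||u' hu'] := @hcvg_cauchy_sqr (P ^~ u) (bessel ^~ u) (limn (bessel ^~ u)).
- move=> m n mn; rewrite sqr_hnorm ripBl !ripBr (ripC (P m u)) !rip_proj//.
  by lra.
- apply: nondecreasing_is_cvgn; first exact: bessel_nd.
  by exists (hnorm u ^+ 2) => _ [n _ <-]; exact: bessel_le.
suff uu : u' = u by rewrite uu in hu'.
apply/eqP; rewrite -subr_eq0; apply/eqP; apply: he.2 => i.
apply/eqP; rewrite innerBl subr_eq0; apply/eqP; apply: inner_cvg_eq hu' _.
have -> : e i = en (pickle i) by rewrite /en pickleK_inv.
exists (pickle i).+1 => // n /= hn; exact: inner_proj_enum.
Qed.

Lemma bessel_cvg u : bessel n u @[n --> \oo] --> hnorm u ^+ 2.
Proof.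
rewrite sqr_hnorm; under eq_fun do rewrite -rip_self_proj.
exact: hcvg_rip (hcvg_cst u) (basis_proj_cvg u).
Qed.

Lemma parseval u :
  (\esum_(i in [set: I]) (normc (inner u (e i)) ^+ 2)%:E = (hnorm u ^+ 2)%:E)%E.
Proof.
rewrite esum_enum => [|i]; last by rewrite lee_fin sqr_ge0.
apply/cvg_lim => //.
rewrite (_ : (fun n => _) = EFin \o (bessel ^~ u)); last first.
  apply/funext => n /=; rewrite big_mkord /bessel -sumEFin; apply: eq_bigr => k _.
  rewrite /en; case: (pickle_inv k) => [i //|].
  by rewrite inner0r normc0 expr0n.
by apply: cvg_EFin; [exact: nearW|exact: bessel_cvg].
Qed.

End Basis.

(** * The trace *)

(** True at infinite x as well, since [fine] sends both infinities to 0; this makes [rsumZ] hold for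
    arbitrary families. *)
Lemma fineZ (R : realType) (c : R) (x : \bar R) : fine (c%:E * x)%E = c * fine x.
Proof.
case: x => [x//| |]; rewrite [fine _ in RHS]/= mulr0.
  have [c0|c0|->] := ltgtP c 0; last by rewrite mul0e.
    by rewrite lt0_muley// lte_fin.
  by rewrite gt0_muley// lte_fin.
have [c0|c0|->] := ltgtP c 0; last by rewrite mul0e.
  by rewrite lt0_muleNy// lte_fin.
by rewrite gt0_muleNy// lte_fin.
Qed.

Section RealSums.
Context (R : realType) (I : countType).
Implicit Types (a b : I -> \bar R) (u v : I -> R) (c : R).

Lemma esum_swap (J : countType) (a : I -> J -> \bar R) : (forall i j, (0 <= a i j)%E) ->
  (\esum_(i in [set: I]) \esum_(j in [set: J]) a i j =
   \esum_(j in [set: J]) \esum_(i in [set: I]) a i j)%E.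
Proof.
move=> a0; rewrite !esum_esum//.
apply: (@reindex_esum _ _ _ _ _ (fun k : J * I => (k.2, k.1)) (fun k => a k.1 k.2)).
split=> //; first by move=> [x y] [x' y'] _ _ /= [-> ->].
by move=> [x y] _; exists (y, x).
Qed.

Lemma ge0_esumZl c a : 0 <= c -> (forall i, (0 <= a i)%E) ->
  (\esum_(i in [set: I]) (c%:E * a i) = c%:E * \esum_(i in [set: I]) a i)%E.
Proof.
move=> c0 a0; rewrite !esum_enum// => [|i]; last by rewrite mule_ge0// lee_fin.
rewrite -nneseriesZl => [|n _]; last by case: pickle_inv.
by apply: eq_eseriesr => n _; case: pickle_inv => //; rewrite mule0.
Qed.

Definition asum u : Prop := (\esum_(i in [set: I]) `|u i|%:E < +oo)%E.

Lemma asum_le u v : (forall i, `|u i| <= v i) -> asum v -> asum u.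
Proof.
move=> uv; apply: le_lt_trans; apply: le_esum => i _; rewrite lee_fin.
by rewrite (le_trans (uv i))// ler_norm.
Qed.

Lemma asumZ c u : asum u -> asum (fun i => c * u i).
Proof.
move=> hu; rewrite /asum; under eq_esum do rewrite normrM EFinM.
by rewrite ge0_esumZl// lte_mul_pinfty// lee_fin.
Qed.

Lemma asumD u v : asum u -> asum v -> asum (fun i => u i + v i).
Proof.
move=> hu hv; apply: (@asum_le _ (fun i => `|u i| + `|v i|)) => [i|].
  exact: ler_normD.
rewrite /asum; under eq_esum do rewrite ger0_norm ?addr_ge0// EFinD.
by rewrite esumD// lte_add_pinfty.
Qed.

Lemma asum_fin_num u : (forall i, 0 <= u i) -> asum u ->
  (\esum_(i in [set: I]) (u i)%:E)%E \is a fin_num.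
Proof.
move=> u0 su; rewrite ge0_fin_numE; last by apply: esum_ge0 => i _; rewrite lee_fin.
by move: su; rewrite /asum; under eq_esum do rewrite ger0_norm//.
Qed.

(** [rsum] is defined by positive and negative parts; additivity requires freedom to use any other
    summable decomposition. *)
Lemma rsum_sub u v : (forall i, 0 <= u i) -> (forall i, 0 <= v i) ->
  asum u -> asum v ->
  rsum (fun i => u i - v i) = fine (\esum_(i in [set: I]) (u i)%:E)%E -
                              fine (\esum_(i in [set: I]) (v i)%:E)%E.
Proof.
move=> u0 v0 su sv; rewrite /rsum.
have ->: EFin \o (fun i => u i - v i) = ((EFin \o u) \- (EFin \o v))%E.
  by apply/funext => i /=; rewrite EFinB.
have hu : summable [set: I] (EFin \o u) by exact: su.
have hv : summable [set: I] (EFin \o v) by exact: sv.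
have h := esumB hu hv.
have h1 := summable_funepos (summableB hu hv).
have h2 := summable_funeneg (summableB hu hv).
apply: EFin_inj; rewrite EFinB [RHS]EFinB !fineK ?asum_fin_num//.
- by apply: h => i _; rewrite lee_fin.
- move: h2; rewrite summableE; under eq_esum do rewrite gee0_abs ?funeneg_ge0//.
  by [].
- move: h1; rewrite summableE; under eq_esum do rewrite gee0_abs ?funepos_ge0//.
  by [].
Qed.

Lemma rsum_ge0E u : (forall i, 0 <= u i) ->
  rsum u = fine (\esum_(i in [set: I]) (u i)%:E)%E.
Proof.
move=> u0; rewrite /rsum.
have -> : ((EFin \o u)^\+ = EFin \o u)%E.
  by apply/funext => i; rewrite (@ge0_funeposE _ _ [set: I]) ?inE// => j _; rewrite lee_fin.
have -> : ((EFin \o u)^\- = cst 0)%E.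
  by apply/funext => i; rewrite (@ge0_funenegE _ _ [set: I]) ?inE// => j _; rewrite lee_fin.
by rewrite [X in _ - fine X]esum1//= subr0.
Qed.

Lemma rsum_parts u : asum u -> exists v w, [/\ forall i, 0 <= v i, forall i, 0 <= w i,
  asum v, asum w & u = fun i => v i - w i].
Proof.
move=> hu; exists (fun i => Num.max (u i) 0), (fun i => Num.max (- u i) 0); split.
- by move=> i; rewrite le_max lexx orbT.
- by move=> i; rewrite le_max lexx orbT.
- apply: (@asum_le _ (fun i => `|u i|)) => [i|].
    by rewrite ger0_norm ?le_max ?lexx ?orbT// ge_max ler_norm normr_ge0.
  by rewrite /asum; under eq_esum do rewrite normr_id.
- apply: (@asum_le _ (fun i => `|u i|)) => [i|].
    by rewrite ger0_norm ?le_max ?lexx ?orbT// ge_max -normrN ler_norm normr_ge0.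
  by rewrite /asum; under eq_esum do rewrite normr_id.
- by apply/funext => i; case: (lerP (u i) 0); case: (lerP (- u i) 0); lra.
Qed.

Lemma fine_esumD u v : (forall i, 0 <= u i) -> (forall i, 0 <= v i) -> asum u -> asum v ->
  fine (\esum_(i in [set: I]) (u i + v i)%:E)%E =
  fine (\esum_(i in [set: I]) (u i)%:E)%E + fine (\esum_(i in [set: I]) (v i)%:E)%E.
Proof.
move=> u0 v0 su sv; under eq_esum do rewrite EFinD.
rewrite esumD => [|i _|i _]; rewrite ?lee_fin//.
by rewrite fineD ?asum_fin_num.
Qed.

Lemma rsumD u v : asum u -> asum v -> rsum (fun i => u i + v i) = rsum u + rsum v.
Proof.
move=> /rsum_parts[u1 [u2 [u10 u20 su1 su2 ->]]] /rsum_parts[v1 [v2 [v10 v20 sv1 sv2 ->]]].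
rewrite (_ : (fun i => _) = fun i => (u1 i + v1 i) - (u2 i + v2 i)); last first.
  by apply/funext => i; lra.
rewrite !rsum_sub//; try by [exact: asumD | move=> i; rewrite addr_ge0].
by rewrite !fine_esumD//; lra.
Qed.

Lemma rsumN u : rsum (fun i => - u i) = - rsum u.
Proof.
rewrite /rsum (_ : EFin \o _ = (\- (EFin \o u))%E); last by apply/funext.
by rewrite funeposN funenegN opprB.
Qed.

Lemma rsumZ c u : rsum (fun i => c * u i) = c * rsum u.
Proof.
wlog c0 : c / 0 <= c.
  move=> h; have [|c0] := leP 0 c; first exact: h.
  rewrite -[c in RHS]opprK mulNr -h ?oppr_ge0 ?ltW// -rsumN.
  by congr rsum; apply/funext => i; rewrite mulNr opprK.
rewrite /rsum (_ : EFin \o _ = (fun i => c%:E * (EFin \o u) i)%E); last by apply/funext.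
rewrite ge0_funeposM// ge0_funenegM// !ge0_esumZl//.
by rewrite !fineZ mulrBr.
Qed.

Lemma rsum_le u v : asum u -> asum v -> (forall i, u i <= v i) -> rsum u <= rsum v.
Proof.
move=> su sv uv; rewrite -subr_ge0 -rsumN -rsumD//; last first.
  by have := asumZ (-1) su; under eq_fun do rewrite mulN1r.
rewrite rsum_ge0E => [|i]; last by rewrite subr_ge0.
by apply/fine_ge0/esum_ge0 => i _; rewrite lee_fin subr_ge0.
Qed.

End RealSums.

Section TraceFormula.
Context (R : realType) (H : hilbert R) (I : countType) (e : I -> H).
Context (he : orthonormal_basis e).
Implicit Types (u v w : H) (A B P T X Y s : H -> H).
Local Notation "t *r u" := ((t%:C)%C *: u) (at level 40).

Lemma normc_conj (z : R[i]) : normc (z^*)%C = normc z.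
Proof. by case: z => x y /=; rewrite sqrrN. Qed.

(** By Parseval both sides are the double sum of |<X e_i, e_j>|^2, taken in the two orders. The
    cyclicity of the trace used below comes from here. *)
Lemma hilbert_schmidt_adjoint X Y : (forall u v, inner (X u) v = inner u (Y v)) ->
  (\esum_(i in [set: I]) (hnorm (X (e i)) ^+ 2)%:E =
   \esum_(i in [set: I]) (hnorm (Y (e i)) ^+ 2)%:E)%E.
Proof.
move=> XY; under eq_esum do rewrite -(parseval he).
under [RHS]eq_esum do rewrite -(parseval he).
rewrite esum_swap => [|i j]; last by rewrite lee_fin sqr_ge0.
apply: eq_esum => j _; apply: eq_esum => i _.
by rewrite XY innerC normc_conj.
Qed.

(** This says that r is Hilbert-Schmidt. For r = [opsqrt s] the sum is the trace of s, hence the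
    name. *)
Definition has_trace (r : H -> H) : Prop :=
  (\esum_(i in [set: I]) (hnorm (r (e i)) ^+ 2)%:E < +oo)%E.

Lemma has_trace_comp T r (M : R) : has_trace r ->
  (forall u, hnorm (T (r u)) <= M * hnorm (r u)) -> has_trace (T \o r).
Proof.
move=> hr hM; rewrite /has_trace.
have [M0|M0] := leP 0 M; last first.
  rewrite esum1// => i _ /=; have := hM (e i) => h.
  suff -> : hnorm (T (r (e i))) = 0 by rewrite expr0n.
  apply/eqP; rewrite eq_le hnorm_ge0 andbT (le_trans h)//.
  by rewrite mulr_le0_ge0 ?hnorm_ge0// ltW.
apply: (@le_lt_trans _ _ (\esum_(i in [set: I]) ((M ^+ 2)%:E * (hnorm (r (e i)) ^+ 2)%:E))%E).
  apply: le_esum => i _; rewrite -EFinM lee_fin -exprMn.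
  by rewrite ler_pXn2r ?nnegrE ?mulr_ge0 ?hnorm_ge0//; exact: hM.
rewrite ge0_esumZl ?sqr_ge0// => [|i]; last by rewrite lee_fin sqr_ge0.
by rewrite lte_mul_pinfty// lee_fin sqr_ge0.
Qed.

Lemma asum_has_trace r : has_trace r -> asum (fun i => hnorm (r (e i)) ^+ 2).
Proof. by rewrite /asum; under eq_esum do rewrite ger0_norm ?sqr_ge0//. Qed.

Section Weighted.
Context (s : H -> H) (ps : positive_op s) (ts : has_trace (opsqrt s)).
Let r := opsqrt s.

Lemma asum_weighted A : bounded_op A -> asum (fun j => rip (A (r (e j))) (r (e j))).
Proof.
move=> /bop_bound[M M0 hM].
apply: (@asum_le _ _ _ (fun j => M * hnorm (r (e j)) ^+ 2)) => [j|].
  by rewrite (le_trans (abs_rip _ _))// expr2 mulrA ler_wpM2r// hnorm_ge0.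
by apply: asumZ; exact: asum_has_trace.
Qed.

(** Polarization writes the terms on the left as |X_1 e_i|^2 - |X_(-1) e_i|^2 and those on the right
    likewise with Y, where X_c = (r A + c r)/2 and Y_c = (A' r + c r)/2 are mutually adjoint and so
    have equal Hilbert-Schmidt norms. The result is the cyclicity Tr(s A) = Tr(r A r). *)
Lemma rsum_trace A A' : bounded_op A -> bounded_op A' ->
  (forall u v, inner (A u) v = inner u (A' v)) ->
  rsum (fun i => rip (s (A (e i))) (e i)) = rsum (fun j => rip (A (r (e j))) (r (e j))).
Proof.
move=> bA bA' AA'.
have br : bounded_op r by exact: opsqrt_bop.
have sr : selfadj r by exact: opsqrt_selfadj.
have pol x y : rip x y = hnorm (2^-1 *r (x + y)) ^+ 2 - hnorm (2^-1 *r (x - y)) ^+ 2.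
  rewrite !sqr_hnorm !ripZl !ripZr !(ripDl, ripDr, ripNl, ripNr) (ripC y x).
  by field.
pose X (c : R) u := 2^-1 *r (r (A u) + c *r r u).
pose Y (c : R) u := 2^-1 *r (A' (r u) + c *r r u).
have XY c u v : inner (X c u) v = inner u (Y c v).
  by rewrite innerZl innerZr !innerDl !innerDr innerZl innerZr !conjc_real sr AA' sr.
have YX c u v : inner (Y c u) v = inner u (X c v).
  by rewrite innerC -XY -innerC.
have tY c : has_trace (Y c).
  have [M M0 hM] := bop_bound bA'.
  apply: (@has_trace_comp (fun w => 2^-1 *r (A' w + c *r w)) _ (2^-1 * (M + `|c|))) => // u.
  rewrite hnormZr ger0_norm ?invr_ge0// -mulrA ler_wpM2l ?invr_ge0//.
  by rewrite (le_trans (hnormD _ _))// mulrDl lerD// hnormZr.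
have tX c : has_trace (X c) by rewrite /has_trace (hilbert_schmidt_adjoint (XY c)); exact: tY.
have -> : (fun i => rip (s (A (e i))) (e i)) =
    (fun i => hnorm (X 1 (e i)) ^+ 2 - hnorm (X (-1) (e i)) ^+ 2).
  apply/funext => i; rewrite -(opsqrtK _ ps) (selfadj_rip _ _ sr) pol /X.
  by rewrite scale1r rmorphN1 scaleN1r.
have -> : (fun j => rip (A (r (e j))) (r (e j))) =
    (fun j => hnorm (Y 1 (e j)) ^+ 2 - hnorm (Y (-1) (e j)) ^+ 2).
  apply/funext => i; rewrite /rip AA' -/(rip _ _) ripC pol /Y.
  by rewrite scale1r rmorphN1 scaleN1r.
rewrite !rsum_sub; try by [move=> i; rewrite sqr_ge0 | exact: asum_has_trace].
by congr (fine _ - fine _); exact: hilbert_schmidt_adjoint.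
Qed.

Lemma trace_formula A A' : bounded_op A -> bounded_op A' ->
  (forall u v, inner (A u) v = inner u (A' v)) ->
  tr e (s \o A) = (rsum (fun j => rip (A (r (e j))) (r (e j))) +i*
                   rsum (fun j => complex.Im (inner (A (r (e j))) (r (e j)))))%C.
Proof.
move=> bA bA' AA'; rewrite /tr; congr Complex; first exact: (rsum_trace bA bA' AA').
have bs := positive_bop ps.
(* The imaginary part for A is the real part for -i A, to which the real case applies. *)
have iE x y : complex.Im (inner x y) = rip (- ('i%C *: x)) y.
  by rewrite Im_inner ripNl rip_il opprK.
have h2 : rsum (fun i => rip (s (- ('i%C *: A (e i)))) (e i)) =
    rsum (fun j => rip (- ('i%C *: A (r (e j)))) (r (e j))).
  apply: (@rsum_trace (fun u => - ('i%C *: A u)) (fun v => 'i%C *: A' v)).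
  - by apply: bop_opp; apply: bop_scale.
  - exact: bop_scale.
  - by move=> u v; rewrite innerNl innerZl innerZr AA'; rewrite -mulNr; congr (_ * _); simpc.
rewrite (_ : (fun i => _) = fun i => rip (s (- ('i%C *: A (e i)))) (e i)).
  by rewrite h2; congr rsum; apply/funext => j; rewrite iE.
by apply/funext => i /=; rewrite iE (bopN _ bs) (bopZ _ _ bs).
Qed.

Lemma trace_positive P : positive_op P ->
  ((complex.Re (tr e (s \o P)))%:E =
   \esum_(j in [set: I]) (rip (P (r (e j))) (r (e j)))%:E)%E.
Proof.
move=> pP; have bP := positive_bop pP.
have P0 j : 0 <= rip (P (r (e j))) (r (e j)) by exact: positive_rip.
rewrite (trace_formula bP bP (positive_selfadj pP)) /= rsum_ge0E// fineK//.
rewrite ge0_fin_numE; last by apply: esum_ge0 => j _; rewrite lee_fin.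
by have := asum_weighted bP; rewrite /asum; under eq_esum do rewrite ger0_norm//.
Qed.

(** Let x + i y be the trace on the left, n its modulus and a_j = <A r e_j, r e_j>. Then n^2 = x x +
    y y is the sum of the x Re a_j + y Im a_j <= n |a_j|, so n^2 <= n p, where p is the trace on the
    right. *)
Lemma trace_dominated A A' P : bounded_op A -> bounded_op A' ->
  (forall u v, inner (A u) v = inner u (A' v)) -> positive_op P ->
  (forall u, normc (inner (A u) u) <= rip (P u) u) ->
  normc (tr e (s \o A)) <= complex.Re (tr e (s \o P)).
Proof.
move=> bA bA' AA' pP AP; have bP := positive_bop pP.
rewrite (trace_formula bA bA' AA') (trace_formula bP bP (positive_selfadj pP)) /=.
set x := rsum _; set y := rsum _; set p := rsum _.
have sP := asum_weighted bP.
have sRe := asum_weighted bA.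
have sIm : asum (fun j => complex.Im (inner (A (r (e j))) (r (e j)))).
  rewrite (_ : (fun j => _) = fun j => rip ((fun u => - ('i%C *: A u)) (r (e j))) (r (e j))).
    by apply: (@asum_weighted (fun u => - ('i%C *: A u))); apply: bop_opp; apply: bop_scale.
  by apply/funext => j; rewrite Im_inner ripNl rip_il opprK.
set n := Num.sqrt _.
have nn : n ^+ 2 = x * x + y * y.
  by rewrite sqr_sqrtr ?addr_ge0 ?sqr_ge0// !expr2.
have n0 : 0 <= n by exact: sqrtr_ge0.
have : n ^+ 2 <= n * p.
  rewrite nn -!rsumZ -rsumD; [|exact: asumZ|exact: asumZ].
  apply: rsum_le; [by apply: asumD; exact: asumZ|exact: asumZ|move=> j].
  apply: (@le_trans _ _ (n * normc (inner (A (r (e j))) (r (e j))))); last first.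
    by rewrite ler_wpM2l.
  rewrite /rip; case: (inner _ _) => a b /=; rewrite /n -sqrtrM ?addr_ge0 ?sqr_ge0//.
  rewrite (le_trans (ler_norm _))// -sqrtr_sqr ler_wsqrtr//.
  (* Lagrange's identity: (x^2 + y^2)(a^2 + b^2) - (x a + y b)^2 = (x b - y a)^2. *)
  have := sqr_ge0 (x * b - y * a).
  rewrite !expr2 => h; rewrite -subr_ge0; apply: le_trans h _.
  by rewrite le_eqVlt; apply/orP; left; apply/eqP; ring.
have [n_eq0|nn0] := eqVneq n 0; last by rewrite expr2 ler_pM2l// lt0r nn0.
rewrite n_eq0 => _; rewrite /p rsum_ge0E => [|j]; last exact: positive_rip.
by apply/fine_ge0/esum_ge0 => j _; rewrite lee_fin positive_rip.
Qed.

End Weighted.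

Lemma has_trace_sqrt s : positive_op s ->
  (\esum_(i in [set: I]) (rip (s (e i)) (e i))%:E < +oo)%E -> has_trace (opsqrt s).
Proof.
by move=> ps hs; rewrite /has_trace; under eq_esum do rewrite opsqrt_norm//.
Qed.

(** [tr] passes through [fine], which maps a divergent sum to 0; the value 1 therefore certifies
    convergence. *)
Lemma stateP s : state e s <->
  positive_op s /\ (\esum_(i in [set: I]) (rip (s (e i)) (e i))%:E = 1)%E.
Proof.
split=> -[ps hs]; split=> //.
  move/(congr1 (@complex.Re R)) : hs => /=.
  rewrite -/(rip _ _) rsum_ge0E => [|i]; last exact: positive_rip.
  by case: (\esum_(_ in _) _)%E => [x /= ->|/=/eqP|/=/eqP]; rewrite ?[0 == 1]eq_sym ?oner_eq0.
rewrite /tr (_ : (fun i => complex.Re _) = fun i => rip (s (e i)) (e i))//.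
rewrite rsum_ge0E => [|i]; last exact: positive_rip.
rewrite hs (_ : (fun i => _) = fun=> 0).
  by rewrite rsum_ge0E// esum1.
by apply/funext => i; rewrite (selfadj_Im _ (positive_selfadj ps)).
Qed.

Lemma state_positive s : state e s -> positive_op s. Proof. by case. Qed.

Lemma state_has_trace s : state e s -> has_trace (opsqrt s).
Proof. by move=> /stateP[ps hs]; apply: has_trace_sqrt; rewrite // hs ltry. Qed.

(** The projection on v when |v| = 1. As states, these recover quadratic forms from traces, which
    links measurability tested on states to weak measurability. *)
Definition rank_one v : H -> H := fun w => inner w v *: v.

Lemma rank_one_positive v : positive_op (rank_one v).
Proof.
apply: selfadj_positive.
- split=> [a x y|]; first by rewrite /rank_one innerDl innerZl scalerDl scalerA.
  exists (hnorm v * hnorm v) => u; rewrite /rank_one hnormZ.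
  by rewrite mulrAC ler_wpM2r ?hnorm_ge0// mulrC normc_inner.
- by move=> x y; rewrite /rank_one innerZl innerZr -innerC mulrC.
- move=> u; rewrite /rank_one /rip innerZl (innerC v u) mulrC mul_conjc_normc /=.
  exact: sqr_ge0.
Qed.

Lemma esum_rank_one (q : R) v : 0 <= q ->
  (\esum_(j in [set: I]) (normc (inner (e j) v) ^+ 2 * q)%:E = (hnorm v ^+ 2 * q)%:E)%E.
Proof.
move=> q0; under eq_esum do rewrite mulrC EFinM innerC normc_conj.
rewrite ge0_esumZl// => [|i]; last by rewrite lee_fin sqr_ge0.
by rewrite parseval// -EFinM mulrC.
Qed.

Lemma rank_one_state v : hnorm v = 1 -> state e (rank_one v).
Proof.
move=> v1; apply/stateP; split; first exact: rank_one_positive.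
have := esum_rank_one v (@ler01 R); rewrite v1 expr1n mulr1 => <-.
apply: eq_esum => j _; congr EFin.
by rewrite /rank_one /rip innerZl (innerC v) mulrC mul_conjc_normc /= mulr1.
Qed.

Lemma trace_rank_one v P : hnorm v = 1 -> positive_op P ->
  complex.Re (tr e (rank_one v \o P)) = rip (P v) v.
Proof.
move=> v1 pP; have sv := rank_one_state v1; apply: EFin_inj.
rewrite (trace_positive (state_positive sv) (state_has_trace sv) pP).
have -> : opsqrt (rank_one v) = rank_one v.
  apply: opsqrt_unique; first exact: rank_one_positive.
  by move=> u; rewrite /rank_one innerZl inner_uu -sqr_hnorm v1 expr1n mulr1.
have := esum_rank_one v (positive_rip v pP); rewrite v1 expr1n mul1r => <-.
apply: eq_esum => j _; congr EFin.
rewrite /rank_one (bopZ _ _ (positive_bop pP)) /rip innerZl innerZr mulrA.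
by rewrite (mulrC (inner _ _)) mul_conjc_normc; case: (inner (P v) v) => x y /=; simpc.
Qed.

(** With r = T^(1/2), Parseval gives <T u, u> = |r u|^2 = sum of |<u, r e_i>|^2, and Cauchy-Schwarz
    bounds this by |u|^2 times the sum of the |r e_i|^2, which is the trace of T. *)
Lemma trace_form_le T (t : R) u : positive_op T ->
  (\esum_(i in [set: I]) (rip (T (e i)) (e i))%:E <= t%:E)%E -> rip (T u) u <= t * hnorm u ^+ 2.
Proof.
move=> pT hT; have sr := opsqrt_selfadj pT.
rewrite -opsqrt_norm// -lee_fin -(parseval he).
apply: (@le_trans _ _ (\esum_(i in [set: I]) ((hnorm u ^+ 2)%:E * (rip (T (e i)) (e i))%:E))%E).
  apply: le_esum => i _; rewrite -EFinM lee_fin -opsqrt_norm// -exprMn sr.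
  by rewrite ler_pXn2r ?nnegrE ?normc_ge0 ?mulr_ge0 ?hnorm_ge0 ?normc_inner.
rewrite ge0_esumZl ?sqr_ge0// => [|i]; last by rewrite lee_fin positive_rip.
by rewrite (mulrC t) (EFinM _ t); apply: lee_wpmul2l; rewrite ?lee_fin ?sqr_ge0.
Qed.

Lemma state_le1 s u : state e s -> rip (s u) u <= hnorm u ^+ 2.
Proof.
by move=> /stateP[ps ts]; rewrite -[leRHS]mul1r; apply: trace_form_le => //; rewrite ts.
Qed.

(* The trace norm is computed from opsqrt (T^* T) = |T|, and |T| has the same
   norm as T on every vector. *)
Lemma trace_norm_form T (t : R) u : bounded_op T -> selfadj T -> 0 <= t ->
  (trace_norm e T <= t%:E)%E -> `|rip (T u) u| <= t * hnorm u ^+ 2.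
Proof.
move=> bT sT t0; rewrite /trace_norm (selfadj_adjoint bT sT) => ht.
have pTT : positive_op (T \o T).
  apply: (@positive_comp _ _ T id) => //.
  by split=> [|v]; [exact: bop_id|exact: inner_ge0].
have pA := opsqrt_positive pTT.
have hA v : hnorm (opsqrt (T \o T) v) <= t * hnorm v.
  apply: positive_form_norm => // [||w|w].
  - exact: bop_linear (positive_bop pA).
  - exact: positive_selfadj.
  - exact: positive_rip.
  - exact: trace_form_le.
have -> : hnorm u ^+ 2 = hnorm u * hnorm u by [].
rewrite mulrA (le_trans (abs_rip _ _))// ler_wpM2r ?hnorm_ge0//.
suff <- : hnorm (opsqrt (T \o T) u) = hnorm (T u) by [].
apply/eqP; rewrite -(@eqrXn2 _ 2)// ?hnorm_ge0//; apply/eqP.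
by rewrite opsqrt_norm//= (selfadj_rip _ _ sT) sqr_hnorm.
Qed.

(** P^(1/2) s^(1/2) and its adjoint have the same Hilbert-Schmidt norm. Here the state enters
    linearly, at vectors independent of it, whereas in [trace_positive] it enters through its square
    root. *)
Lemma trace_positive_sqrt s P : state e s -> positive_op P ->
  ((complex.Re (tr e (s \o P)))%:E =
   \esum_(j in [set: I]) (rip (s (opsqrt P (e j))) (opsqrt P (e j)))%:E)%E.
Proof.
move=> hs pP; have ps := state_positive hs.
rewrite (trace_positive ps (state_has_trace hs) pP).
under eq_esum do rewrite -(opsqrt_norm _ pP).
rewrite (@hilbert_schmidt_adjoint (opsqrt P \o opsqrt s) (opsqrt s \o opsqrt P)).
  by apply: eq_esum => j _ /=; rewrite opsqrt_norm.
by move=> u v /=; rewrite (opsqrt_selfadj pP) (opsqrt_selfadj ps).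
Qed.

End TraceFormula.

(** * The Schur product theorem *)

Section SchurProduct.
Context (R : realType) (T : finType).
Implicit Types (M N : T -> T -> R[i]) (z : T -> R[i]).
Local Notation "z ^*" := (conjc z) : ring_scope.

Definition kernel_form M z : R[i] := \sum_k \sum_l z k * (z l)^* * M k l.

Definition psd_kernel M : Prop := forall z, 0 <= kernel_form M z.

Lemma kernel_form_shift M z (a : T) (c : R[i]) :
  kernel_form M (fun k => z k - c * (k == a)%:R) =
  kernel_form M z - c^* * (\sum_k z k * M k a) - c * (\sum_l (z l)^* * M a l) + c * c^* * M a a.
Proof.
have delta (F : T -> R[i]) : \sum_k (k == a)%:R * F k = F a.
  rewrite (bigD1 a)//= eqxx mul1r big1 ?addr0// => k /negbTE ->; exact: mul0r.
have -> : \sum_l (z l)^* * M a l = \sum_k (k == a)%:R * \sum_l (z l)^* * M k l.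
  by rewrite delta.
have -> : c * c^* * M a a = \sum_k (k == a)%:R * \sum_l (l == a)%:R * (c * c^* * M k l).
  by rewrite !delta.
have -> : \sum_k z k * M k a = \sum_k z k * \sum_l (l == a)%:R * M k l.
  by apply: eq_bigr => k _; rewrite delta.
rewrite /kernel_form !mulr_sumr -!sumrB -big_split; apply: eq_bigr => k _ /=.
rewrite !mulr_sumr -!sumrB -big_split; apply: eq_bigr => l _ /=.
by rewrite rmorphB rmorphM /= conjc_nat; ring.
Qed.

Lemma kernel_form0 M : kernel_form M (fun=> 0) = 0.
Proof. by rewrite /kernel_form big1// => k _; rewrite big1// => l _; rewrite !mul0r. Qed.

Lemma kernel_form1 M (a : T) (c : R[i]) :
  kernel_form M (fun k => 0 - c * (k == a)%:R) = c * c^* * M a a.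
Proof.
rewrite kernel_form_shift kernel_form0 !big1 ?mulr0 ?subr0 ?add0r//.
  by move=> l _; rewrite conjc0 mul0r.
by move=> l _; rewrite mul0r.
Qed.

Lemma kernel_form2 M (a b : T) (c d : R[i]) :
  kernel_form M (fun k => 0 - c * (k == a)%:R - d * (k == b)%:R) =
  c * c^* * M a a + d^* * c * M a b + d * c^* * M b a + d * d^* * M b b.
Proof.
have delta (F : T -> R[i]) : \sum_k (k == a)%:R * F k = F a.
  rewrite (bigD1 a)//= eqxx mul1r big1 ?addr0// => k /negbTE ->; exact: mul0r.
have dl (F : T -> R[i]) : \sum_k (0 - c * (k == a)%:R) * F k = - (c * F a).
  rewrite -(delta F) mulr_sumr -sumrN; apply: eq_bigr => k _.
  by rewrite sub0r mulNr mulrA.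
have dr (F : T -> R[i]) : \sum_k (0 - c * (k == a)%:R)^* * F k = - (c^* * F a).
  rewrite -(delta F) mulr_sumr -sumrN; apply: eq_bigr => k _.
  by rewrite sub0r rmorphN rmorphM /= conjc_nat mulNr mulrA.
by rewrite kernel_form_shift kernel_form1 dl dr; ring.
Qed.

Section Psd.
Context (M : T -> T -> R[i]) (psdM : psd_kernel M).

Lemma psd_diag_ge0 a : 0 <= M a a.
Proof.
by have := psdM (fun k => 0 - 1 * (k == a)%:R); rewrite kernel_form1 conjc1 !mul1r.
Qed.

(** Reality of the form at the vectors supported on {a, b} with coefficients (-1, -1) and (-1, -i)
    settles the imaginary and the real parts in turn. *)
Lemma psd_herm a b : M b a = (M a b)^*.
Proof.
have h1 := psdM (fun k => 0 - 1 * (k == a)%:R - 1 * (k == b)%:R).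
have h2 := psdM (fun k => 0 - 1 * (k == a)%:R - 'i%C * (k == b)%:R).
move: h1 h2 (psd_diag_ge0 a) (psd_diag_ge0 b); rewrite !kernel_form2.
case: (M a a) (M a b) (M b a) (M b b) => [a1 a2] [b1 b2] [c1 c2] [d1 d2].
rewrite !ge0_complexE; simpc => /= /andP[/eqP h1 _] /andP[/eqP h2 _].
move=> /andP[/eqP h3 _] /andP[/eqP h4 _].
by congr Complex; lra.
Qed.

Lemma psd_diag_eq0 a b : M a a = 0 -> M a b = 0.
Proof.
move=> Ma0; have Mb0 := psd_diag_ge0 b.
pose n := complex.Re (M a b) ^+ 2 + complex.Im (M a b) ^+ 2.
have [n0|nn0] := eqVneq n 0.
  move/eqP: n0; rewrite paddr_eq0 ?sqr_ge0// !sqrf_eq0.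
  by case: (M a b) => x y /= /andP[/eqP -> /eqP ->].
(* With this t, the vector with t conj(M a b) at a and -1 at b gives the form the negative value -M
   b b - 2. *)
pose t : R := (complex.Re (M b b) + 1) / n.
have := psdM (fun k => 0 - (- (t%:C)%C * (M a b)^*) * (k == a)%:R - 1 * (k == b)%:R).
rewrite kernel_form2 Ma0 (psd_herm a b) mulr0 add0r.
have tn : t * n = complex.Re (M b b) + 1 by rewrite mulfVK.
move: tn Mb0; rewrite /n; case: (M a b) (M b b) => [b1 b2] [d1 d2] /=.
rewrite !ge0_complexE; simpc => /= tn /andP[/eqP _ d1p] /andP[_ h]; exfalso.
suff : 0 <= - 2 * (t * (b1 ^+ 2 + b2 ^+ 2)) + d1 by rewrite tn; lra.
by apply: le_trans h _; rewrite le_eqVlt; apply/orP; left; apply/eqP; ring.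
Qed.

Definition schur_complement a k l : R[i] := M k l - M k a * M a l / M a a.

(** Completing the square: the form of the complement at z is the form of M at z shifted at a by the
    minimizing multiple S / M a a. *)
Lemma schur_complement_psd a : M a a != 0 -> psd_kernel (schur_complement a).
Proof.
move=> Ma z; set S := \sum_k z k * M k a.
have Sc : \sum_l (z l)^* * M a l = S^*.
  rewrite rmorph_sum; apply: eq_bigr => l _.
  by rewrite rmorphM /= -(psd_herm l a).
have Mar : (M a a)^* = M a a by rewrite -psd_herm.
have := psdM (fun k => z k - (S / M a a) * (k == a)%:R).
rewrite kernel_form_shift Sc -/S rmorphM /= conjc_inv Mar.
congr (0 <= _); rewrite (_ : _ + _ = kernel_form M z - S * S^* / M a a); last first.
  by field.
rewrite /kernel_form -Sc mulr_suml mulr_suml -sumrB; apply: eq_bigr => k _.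
rewrite -mulrA mulr_suml mulr_sumr -sumrB; apply: eq_bigr => l _.
by rewrite /schur_complement; ring.
Qed.

End Psd.

(** Induction on the number of nonzero diagonal entries of M. Splitting off the rank-one kernel M k
    a conj(M l a) / M a a leaves the Schur complement, which has a zero at (a, a) and no new nonzero
    diagonal entry; the rank-one part contributes the form of N at k |-> M k a. The sum of all
    entries suffices later, since coefficients are carried by the vectors of the Gram kernels. *)
Lemma schur_product M N : psd_kernel M -> psd_kernel N ->
  0 <= \sum_k \sum_l M k l * N k l.
Proof.
move=> + psdN; have [n] := ubnP #|[pred k | M k k != 0]|.
elim: n M => // n ih M hn psdM.
have [/existsP[a Ma]|] := boolP [exists k, M k k != 0]; last first.
  rewrite negb_exists => /forallP M0.
  rewrite big1// => k _; rewrite big1// => l _.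
  by rewrite psd_diag_eq0 ?mul0r//; have := M0 k; rewrite negbK => /eqP.
have -> : \sum_k \sum_l M k l * N k l =
    (\sum_k \sum_l schur_complement M a k l * N k l) +
    (\sum_k \sum_l M k a * (M l a)^* * N k l) / M a a.
  rewrite mulr_suml -big_split; apply: eq_bigr => k _ /=.
  rewrite mulr_suml -big_split; apply: eq_bigr => l _ /=.
  by rewrite /schur_complement (psd_herm psdM l a); field.
rewrite addr_ge0 ?divr_ge0 ?psd_diag_ge0//; last exact: psdN.
apply: ih; last exact: schur_complement_psd.
rewrite -ltnS (leq_trans _ hn)// ltnS proper_card//.
apply/properP; split.
  apply/fintype.subsetP => k; rewrite !inE; apply: contraNneq => Mk.
  by rewrite /schur_complement Mk psd_diag_eq0// !mul0r subr0.
by exists a; rewrite !inE// negbK /schur_complement mulfK// subrr.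
Qed.

End SchurProduct.

(** * Tensor products of operators *)

Section TensorOperators.
Context (R : realType) (H : hilbert R) (K : tensor_square H).
Implicit Types (a b c d u v : H) (z w : K) (A B C S T : H -> H).
Implicit Types (s : seq (H * H)).

(** Lists of pairs represent elements of the algebraic tensor product, but not uniquely. [tmap] acts
    on lists, and it is the bound [tmap_bound], applied to differences, that makes it respect
    equality of sums. *)
Definition tsum s : K := \sum_(ab <- s) tens K ab.1 ab.2.

Definition tmap A B s : seq (H * H) := [seq (A ab.1, B ab.2) | ab <- s].

Lemma tens_inner a b c d : inner (tens K a b) (tens K c d) = inner a c * inner b d.
Proof. exact: inner_tens. Qed.

Lemma tsum_cat s s' : tsum (s ++ s') = tsum s + tsum s'.
Proof. by rewrite /tsum big_cat. Qed.

Lemma tsum_scale (x : R[i]) s : tsum [seq (x *: ab.1, ab.2) | ab <- s] = x *: tsum s.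
Proof.
rewrite /tsum big_map scaler_sumr; apply: eq_bigr => ab _ /=.
exact: linearZl_LR.
Qed.

Lemma tsum_map A B s : tsum (tmap A B s) = \sum_(ab <- s) tens K (A ab.1) (B ab.2).
Proof. by rewrite /tsum big_map. Qed.

Definition el1 s (k : 'I_(size s)) : H := (nth (0, 0) s k).1.
Definition el2 s (k : 'I_(size s)) : H := (nth (0, 0) s k).2.

Lemma tsumE s : tsum s = \sum_(k < size s) tens K (el1 k) (el2 k).
Proof. by rewrite /tsum (big_nth (0, 0)) big_mkord. Qed.

Lemma tsum_mapE A B s : tsum (tmap A B s) = \sum_(k < size s) tens K (A (el1 k)) (B (el2 k)).
Proof. by rewrite tsum_map (big_nth (0, 0)) big_mkord. Qed.

Lemma inner_tsum (T T' : finType) (a b : T -> H) (c d : T' -> H) :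
  inner (\sum_k tens K (a k) (b k)) (\sum_l tens K (c l) (d l)) =
  \sum_k \sum_l inner (a k) (c l) * inner (b k) (d l).
Proof.
rewrite inner_suml; apply: eq_bigr => k _; rewrite inner_sumr.
by apply: eq_bigr => l _; rewrite tens_inner.
Qed.

Lemma bop_comb (T : finType) A (x : T -> R[i]) (a : T -> H) : bounded_op A ->
  A (\sum_k x k *: a k) = \sum_k x k *: A (a k).
Proof. by move=> hA; rewrite (bop_sum _ _ _ hA); apply: eq_bigr => k _; rewrite (bopZ _ _ hA). Qed.

Lemma inner_comb (T T' : finType) (x : T -> R[i]) (y : T' -> R[i]) (a : T -> H) (b : T' -> H) :
  inner (\sum_k x k *: a k) (\sum_l y l *: b l) =
  \sum_k \sum_l x k * ((y l)^*)%C * inner (a k) (b l).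
Proof.
rewrite inner_suml; apply: eq_bigr => k _; rewrite inner_sumr.
by apply: eq_bigr => l _; rewrite innerZl innerZr mulrA.
Qed.

Lemma psd_gram (T : finType) (a : T -> H) : psd_kernel (fun k l => inner (a k) (a l)).
Proof. by move=> x; rewrite /kernel_form -inner_comb inner_ge0. Qed.

Lemma psd_gram_sub (T : finType) A (M : R) (a : T -> H) : bounded_op A ->
  0 <= M -> (forall u, hnorm (A u) <= M * hnorm u) ->
  psd_kernel (fun k l => ((M ^+ 2)%:C)%C * inner (a k) (a l) - inner (A (a k)) (A (a l))).
Proof.
move=> hA M0 hM x.
have -> : kernel_form (fun k l => ((M ^+ 2)%:C)%C * inner (a k) (a l) -
    inner (A (a k)) (A (a l))) x = ((M ^+ 2)%:C)%C * kernel_form (fun k l => inner (a k) (a l)) x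
     - kernel_form (fun k l => inner (A (a k)) (A (a l))) x.
  rewrite /kernel_form mulr_sumr -sumrB; apply: eq_bigr => k _.
  by rewrite mulr_sumr -sumrB; apply: eq_bigr => l _; rewrite mulrBr mulrCA.
rewrite /kernel_form -!inner_comb -(bop_comb _ _ hA) !inner_uu -rmorphM -rmorphB ler0c subr_ge0.
rewrite -!sqr_hnorm -exprMn ler_pXn2r ?nnegrE ?mulr_ge0 ?hnorm_ge0//.
Qed.

(** Let G1, G2 be the Gram kernels of the two factors and GA, GB those of their images. Entrywise,
    M^2 N^2 G1 G2 - GA GB = N^2 (M^2 G1 - GA) G2 + GA (N^2 G2 - GB), and [schur_product] applies to
    both summands. *)
Lemma tmap_bound A B (M N : R) s : bounded_op A -> bounded_op B -> 0 <= M -> 0 <= N ->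
  (forall u, hnorm (A u) <= M * hnorm u) -> (forall u, hnorm (B u) <= N * hnorm u) ->
  hnorm (tsum (tmap A B s)) <= M * N * hnorm (tsum s).
Proof.
move=> hA hB M0 N0 hM hN.
rewrite -(@ler_pXn2r _ 2)// ?nnegrE ?mulr_ge0 ?hnorm_ge0//.
rewrite !exprMn !sqr_hnorm -subr_ge0 -ler0c rmorphB /= rmorphM /= -!inner_uu tsum_mapE tsumE.
rewrite !inner_tsum.
have h1 := schur_product (psd_gram_sub (@el1 s) hA M0 hM) (psd_gram (@el2 s)).
have h2 := schur_product (psd_gram (fun k => A (@el1 s k))) (psd_gram_sub (@el2 s) hB N0 hN).
have N2 : 0 <= ((N ^+ 2)%:C)%C :> R[i] by rewrite ler0c sqr_ge0.
have := addr_ge0 (mulr_ge0 N2 h1) h2; congr (0 <= _).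
rewrite !mulr_sumr -big_split -sumrB; apply: eq_bigr => k _ /=.
rewrite !mulr_sumr -big_split -sumrB; apply: eq_bigr => l _ /=.
by rewrite rmorphM; ring.
Qed.

Lemma tsum_dense z : exists ss : nat -> seq (H * H), hcvg (fun n => tsum (ss n)) z.
Proof.
have h n : exists s, hnorm (tsum s - z) < n.+1%:R^-1.
  have [|s hs] := @tens_dense _ _ K z n.+1%:R^-1; first by rewrite invr_gt0.
  by exists s; rewrite hnormBC.
have [ss hss] := choice h; exists ss.
apply: (@hcvg_le _ _ (fun n => n.+1%:R^-1)) => [n|]; first exact: ltW.
exact: cvg_harmonic.
Qed.

Lemma tens_ext (T T' : K -> K) : bounded_op T -> bounded_op T' ->
  (forall a b, T (tens K a b) = T' (tens K a b)) -> T = T'.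
Proof.
move=> hT hT' h; apply/funext => z; have [ss hss] := tsum_dense z.
apply: hcvg_unique (hcvg_bop hT hss) _.
have := hcvg_bop hT' hss; congr hcvg; apply/funext => n /=.
rewrite /tsum (bop_sum _ _ _ hT) (bop_sum _ _ _ hT').
by apply: eq_bigr => ab _; rewrite h.
Qed.

(** Extension by continuity from sums of elementary tensors. The bound on differences gives
    convergence of the images of an approximating sequence and independence of its choice; linearity
    and boundedness pass to the limit. *)
Lemma optens_ex A B : bounded_op A -> bounded_op B ->
  exists T : K -> K, bounded_op T /\ forall a b, T (tens K a b) = tens K (A a) (B b).
Proof.
move=> hA hB; have [M M0 hM] := bop_bound hA; have [N N0 hN] := bop_bound hB.
have bnd s := tmap_bound s hA hB (ltW M0) (ltW N0) hM hN.
(* A difference of sums is again the sum of a list, with the signs put into the first factors, so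
   the bound applies to it. *)
have tmapB s s' : exists t, tsum t = tsum s - tsum s' /\
    tsum (tmap A B t) = tsum (tmap A B s) - tsum (tmap A B s').
  exists (s ++ [seq (-1 *: ab.1, ab.2) | ab <- s']); split.
    by rewrite tsum_cat tsum_scale scaleN1r.
  rewrite {1}/tmap map_cat tsum_cat -/(tmap A B s); congr (_ + _).
  rewrite -map_comp /tsum !big_map -sumrN; apply: eq_bigr => ab _ /=.
  by rewrite (bopZ _ _ hA) scaleN1r; exact: linearNl.
have bndB s s' : hnorm (tsum (tmap A B s) - tsum (tmap A B s')) <=
    M * N * hnorm (tsum s - tsum s').
  by have [t [<- <-]] := tmapB s s'; exact: bnd.
have uniq_lim z ss ss' w w' : hcvg (fun n => tsum (ss n)) z -> hcvg (fun n => tsum (ss' n)) z ->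
    hcvg (fun n => tsum (tmap A B (ss n))) w -> hcvg (fun n => tsum (tmap A B (ss' n))) w' ->
    w = w'.
  move=> h1 h2 h3 h4; apply: (hcvg_unique h3).
  apply: (@hcvg_le _ _ (fun n => M * N * (hnorm (tsum (ss n) - z) + hnorm (tsum (ss' n) - z)) +
      hnorm (tsum (tmap A B (ss' n)) - w'))) => [n|].
    rewrite (le_trans (hnorm_triangle _ (tsum (tmap A B (ss' n))) _))// lerD2r.
    rewrite (le_trans (bndB _ _))// ler_wpM2l ?mulr_ge0 ?(ltW M0) ?(ltW N0)//.
    by rewrite (hnormBC (tsum (ss' n))) hnorm_triangle.
  rewrite [X in _ --> X](_ : 0 = M * N * (0 + 0) + 0); last by rewrite !addr0 mulr0.
  by apply: cvgD => //; apply: cvgMr; exact: cvgD.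
have hex z : exists w, exists2 ss, hcvg (fun n => tsum (ss n)) z &
    hcvg (fun n => tsum (tmap A B (ss n))) w.
  have [ss cz] := tsum_dense z.
  have [|w hw] := @hilbert_complete _ K (fun n => tsum (tmap A B (ss n))); last first.
    exists w; exists ss => //; apply/hcvgP => eps /hw[n0 hn0]; near=> n; apply: hn0.
    by near: n; exists n0.
  move=> eps e0; pose d := eps / (M * N * 2).
  have d0 : 0 < d by rewrite divr_gt0// !mulr_gt0.
  have /hcvgP/(_ _ d0)[n0 _ hn0] := cz; exists n0 => m n hm hn.
  rewrite (le_lt_trans (bndB _ _))//.
  rewrite (@le_lt_trans _ _ (M * N * (hnorm (tsum (ss m) - z) + hnorm (tsum (ss n) - z))))//.
    by rewrite ler_wpM2l ?mulr_ge0 ?(ltW M0) ?(ltW N0)// (hnormBC (tsum (ss n))) hnorm_triangle.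
  have -> : eps = M * N * (d + d) by rewrite /d; field; rewrite !gt_eqF.
  by rewrite ltr_pM2l ?mulr_gt0// ltrD// hn0.
have [T hT] := choice hex; exists T; split; last first.
  move=> a b; have [ss h1 h2] := hT (tens K a b).
  apply: (uniq_lim _ _ (fun=> [:: (a, b)]) _ _ h1 _ h2).
    by rewrite /tsum big_seq1; exact: hcvg_cst.
  by rewrite /tsum big_seq1; exact: hcvg_cst.
split.
  move=> x z z'; have [ss h1 h2] := hT z; have [ss' h1' h2'] := hT z'.
  have [ss'' h1'' h2''] := hT (x *: z + z').
  apply: (uniq_lim _ _ (fun n => [seq (x *: ab.1, ab.2) | ab <- ss n] ++ ss' n) _ _ h1'' _ h2'').
    under eq_fun do rewrite tsum_cat tsum_scale.
    by apply: hcvgD => //; exact: hcvgZ.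
  have -> : (fun n => tsum (tmap A B ([seq (x *: ab.1, ab.2) | ab <- ss n] ++ ss' n))) =
      (fun n => x *: tsum (tmap A B (ss n)) + tsum (tmap A B (ss' n))).
    apply/funext => n; rewrite {1}/tmap map_cat tsum_cat -/(tmap A B (ss' n)); congr (_ + _).
    rewrite -map_comp /tsum !big_map scaler_sumr; apply: eq_bigr => ab _ /=.
    by rewrite (bopZ _ _ hA); exact: linearZl_LR.
  by apply: hcvgD => //; exact: hcvgZ.
exists (M * N) => z; have [ss h1 h2] := hT z.
apply: (ler_cvg_to (hcvg_norm h2) (cvgMr (hcvg_norm h1))).
by apply: nearW => n; exact: bnd.
Unshelve. all: by end_near. Qed.

Section Spec.
Context (A B : H -> H) (hA : bounded_op A) (hB : bounded_op B).

Lemma optensP : bounded_op (optens K A B) /\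
  forall a b, optens K A B (tens K a b) = tens K (A a) (B b).
Proof.
by rewrite /optens; case: xgetP => [T _ //|]; have [T hT] := optens_ex hA hB => /(_ T).
Qed.

Lemma optens_bop : bounded_op (optens K A B). Proof. by case: optensP. Qed.

Lemma optens_tens a b : optens K A B (tens K a b) = tens K (A a) (B b).
Proof. by case: optensP. Qed.

Lemma optens_tsum s : optens K A B (tsum s) = tsum (tmap A B s).
Proof.
rewrite tsum_map /tsum (bop_sum _ _ _ optens_bop).
by apply: eq_bigr => ab _; rewrite optens_tens.
Qed.

Lemma optens_uniq (T : K -> K) : bounded_op T ->
  (forall a b, T (tens K a b) = tens K (A a) (B b)) -> optens K A B = T.
Proof.
by move=> hT h; apply: (tens_ext optens_bop hT) => a b; rewrite optens_tens h.
Qed.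

End Spec.

Lemma optens_comp A B C D : bounded_op A -> bounded_op B -> bounded_op C -> bounded_op D ->
  forall z, optens K A B (optens K C D z) = optens K (A \o C) (B \o D) z.
Proof.
move=> hA hB hC hD z; rewrite (@optens_uniq (A \o C) (B \o D) _ _ (optens K A B \o optens K C D))//.
- exact: bop_comp.
- exact: bop_comp.
- by apply: bop_comp; exact: optens_bop.
- by move=> a b /=; rewrite !optens_tens.
Qed.

Lemma optens_adj A B A' B' : bounded_op A -> bounded_op B -> bounded_op A' -> bounded_op B' ->
  (forall u v, inner (A u) v = inner u (A' v)) ->
  (forall u v, inner (B u) v = inner u (B' v)) ->
  forall z w, inner (optens K A B z) w = inner z (optens K A' B' w).
Proof.
move=> hA hB hA' hB' AA' BB'.
have bT := optens_bop hA hB; have bT' := optens_bop hA' hB'.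
have key z w : rip (optens K A B z) w = rip z (optens K A' B' w).
  have [ss hss] := tsum_dense z; have [tt htt] := tsum_dense w.
  have h1 := hcvg_rip (hcvg_bop bT hss) htt.
  have h2 := hcvg_rip hss (hcvg_bop bT' htt).
  have e n : rip (optens K A B (tsum (ss n))) (tsum (tt n)) =
      rip (tsum (ss n)) (optens K A' B' (tsum (tt n))).
    rewrite !optens_tsum// /rip !tsum_mapE !tsumE !inner_tsum.
    congr complex.Re; apply: eq_bigr => k _; apply: eq_bigr => l _.
    by rewrite AA' BB'.
  rewrite (_ : (fun n => rip ((optens K A B \o (fun n => tsum (ss n))) n) (tsum (tt n))) =
    (fun n => rip (tsum (ss n)) (optens K A' B' (tsum (tt n))))) in h1; last exact/funext.
  exact: (cvg_unique _ h1 h2).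
move=> z w; rewrite innerE [RHS]innerE key.
by congr Complex; rewrite key (bopZ _ _ bT').
Qed.

Lemma optens_selfadj A B : bounded_op A -> bounded_op B -> selfadj A -> selfadj B ->
  selfadj (optens K A B).
Proof. by move=> hA hB sA sB z w; exact: optens_adj. Qed.

Lemma optens_positive A B : positive_op A -> positive_op B -> positive_op (optens K A B).
Proof.
move=> pA pB; have bA := opsqrt_bop pA; have bB := opsqrt_bop pB.
split; first by apply: optens_bop; exact: positive_bop.
move=> z; have -> : optens K A B z =
    optens K (opsqrt A) (opsqrt B) (optens K (opsqrt A) (opsqrt B) z).
  rewrite optens_comp//; congr (optens K _ _ z); apply/funext => u /=; by rewrite opsqrtK.
rewrite (optens_selfadj bA bB (opsqrt_selfadj pA) (opsqrt_selfadj pB)).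
exact: inner_ge0.
Qed.

Lemma opsqrt_optens A B : positive_op A -> positive_op B ->
  opsqrt (optens K A B) = optens K (opsqrt A) (opsqrt B).
Proof.
move=> pA pB; have bA := opsqrt_bop pA; have bB := opsqrt_bop pB.
apply: opsqrt_unique; first by apply: optens_positive; exact: opsqrt_positive.
move=> z; rewrite optens_comp//; congr (optens K _ _ z).
  by apply/funext => u /=; rewrite opsqrtK.
by apply/funext => u /=; rewrite opsqrtK.
Qed.

(** A positive operator matrix evaluated at finite families a_k and c_k gives a positive kernel on
    ['I_n + 'I_m]. The entrywise product of two such kernels sums to the form of the tensored matrix
    at the elements built from the families; density extends the inequality to all of K. *)
Lemma block_ge0_optens P1 A A' P2 Q1 B B' Q2 :
  bounded_op P1 -> bounded_op A -> bounded_op A' -> bounded_op P2 ->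
  bounded_op Q1 -> bounded_op B -> bounded_op B' -> bounded_op Q2 ->
  block_ge0 P1 A A' P2 -> block_ge0 Q1 B B' Q2 ->
  block_ge0 (optens K P1 Q1) (optens K A B) (optens K A' B') (optens K P2 Q2).
Proof.
move=> bP1 bA bA' bP2 bQ1 bB bB' bQ2 hP hQ.
have kerpsd X1 Y Y' X2 : bounded_op X1 -> bounded_op Y -> bounded_op Y' -> bounded_op X2 ->
    block_ge0 X1 Y Y' X2 -> forall (n m : nat) (a : 'I_n -> H) (c : 'I_m -> H),
    psd_kernel (fun x y : 'I_n + 'I_m => match x, y with
      | inl k, inl l => inner (X1 (a k)) (a l) | inr k, inl l => inner (Y (c k)) (a l)
      | inl k, inr l => inner (Y' (a k)) (c l) | inr k, inr l => inner (X2 (c k)) (c l) end).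
  move=> h1 h2 h3 h4 hb n m a c x.
  have := hb (\sum_k x (inl k) *: a k) (\sum_k x (inr k) *: c k).
  rewrite /kernel_form big_sumType /= (bop_comb _ _ h1) (bop_comb _ _ h2).
  rewrite (bop_comb _ _ h3) (bop_comb _ _ h4) !innerDl !inner_comb addrACA.
  by congr (0 <= _ + _); rewrite -big_split; apply: eq_bigr => k _; rewrite big_sumType.
have real_form (z w : seq (H * H)) :
    0 <= inner (optens K P1 Q1 (tsum z) + optens K A B (tsum w)) (tsum z) +
    inner (optens K A' B' (tsum z) + optens K P2 Q2 (tsum w)) (tsum w).
  have := schur_product (kerpsd _ _ _ _ bP1 bA bA' bP2 hP _ _ (@el1 z) (@el1 w))
    (kerpsd _ _ _ _ bQ1 bB bB' bQ2 hQ _ _ (@el2 z) (@el2 w)).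
  rewrite big_sumType /= !optens_tsum// !tsum_mapE !(tsumE z) !(tsumE w) !innerDl !inner_tsum.
  rewrite addrACA.
  by congr (0 <= _ + _); rewrite -big_split; apply: eq_bigr => k _; rewrite big_sumType.
move=> z w; have [ss hz] := tsum_dense z; have [tt hw] := tsum_dense w.
have bT1 := optens_bop bP1 bQ1; have bT2 := optens_bop bA bB.
have bT3 := optens_bop bA' bB'; have bT4 := optens_bop bP2 bQ2.
set F1 := optens K P1 Q1 in bT1 *; set F2 := optens K A B in bT2 *.
set F3 := optens K A' B' in bT3 *; set F4 := optens K P2 Q2 in bT4 *.
have h1 := hcvgD (hcvg_bop bT1 hz) (hcvg_bop bT2 hw).
have h2 := hcvgD (hcvg_bop bT3 hz) (hcvg_bop bT4 hw).
rewrite ge0_complexE !raddfD /= !Im_inner -!/(rip _ _); apply/andP; split.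
  have h := cvgD (hcvg_rip h1 (hcvgZ 'i%C hz)) (hcvg_rip h2 (hcvgZ 'i%C hw)).
  have {}h := h ltac:(typeclasses eauto); rewrite (_ : (_ + _ : nat -> R) = fun=> 0) in h.
    by rewrite (cvg_unique _ h (cvg_cst 0)).
  apply/funext => n; rewrite !fctE /= -!Im_inner -raddfD.
  by have := real_form (ss n) (tt n); rewrite ge0_complexE => /andP[/eqP].
have h := cvgD (hcvg_rip h1 hz) (hcvg_rip h2 hw).
apply: (ler_cvg_to (cvg_cst 0) (h ltac:(typeclasses eauto))); apply: nearW => n.
rewrite !fctE /= /rip -raddfD.
by have := real_form (ss n) (tt n); rewrite ge0_complexE => /andP[].
Qed.

End TensorOperators.

(** * States of the tensor square *)

Section TensorBasis.
Context (R : realType) (H : hilbert R) (K : tensor_square H).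
Context (I : countType) (e : I -> H) (he : orthonormal_basis e).
Implicit Types (a b u v : H) (z w : K) (A B P Q : H -> H).

Lemma hnorm_tens a b : hnorm (tens K a b) = hnorm a * hnorm b.
Proof.
apply/eqP; rewrite -(@eqrXn2 _ 2)// ?mulr_ge0 ?hnorm_ge0//; apply/eqP.
by rewrite exprMn !sqr_hnorm /rip tens_inner !inner_uu; simpc.
Qed.

(** For totality, let z be orthogonal to all e_i (x) e_j. Expanding the second factor, then the
    first, makes z orthogonal to all elementary tensors, whose sums are dense. *)
Lemma tens_orthonormal : orthonormal_basis (basis_tens K e).
Proof.
split=> [[i j] [k l]|z hz].
  rewrite /basis_tens /= tens_inner !he.1 xpair_eqE.
  by case: (i == k); case: (j == l); rewrite ?mulr0 ?mulr1 ?mul0r.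
have tcvgr a us u : hcvg us u -> hcvg (fun n => tens K a (us n)) (tens K a u).
  move=> hu; apply: (@hcvg_le _ _ (fun n => hnorm a * hnorm (us n - u))) => [n|].
    by rewrite -(linearBr (tens K)) hnorm_tens.
  by rewrite -(mulr0 (hnorm a)); apply: cvgMr.
have tcvgl b us u : hcvg us u -> hcvg (fun n => tens K (us n) b) (tens K u b).
  move=> hu; apply: (@hcvg_le _ _ (fun n => hnorm (us n - u) * hnorm b)) => [n|].
    by rewrite -(linearBl (tens K)) hnorm_tens.
  by rewrite -(mul0r (hnorm b)); apply: cvgMl.
have h1 i b : inner (tens K (e i) b) z = 0.
  rewrite -(inner0l z); apply: inner_cvg_eq (tcvgr _ _ _ (basis_proj_cvg he b)) _.
  apply: nearW => n; rewrite inner0l (linear_sumr (tens K)) inner_suml big1// => k _ /=.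
  rewrite linearZr_LR innerZl /basis_enum; case: pickle_inv => [j|].
    by rewrite -[tens K _ _]/(basis_tens K e (i, j)) [inner _ z]innerC hz conjc0 mulr0.
  by rewrite (linear0r (tens K)) inner0l mulr0.
have h2 a b : inner (tens K a b) z = 0.
  rewrite -(inner0l z); apply: inner_cvg_eq (tcvgl _ _ _ (basis_proj_cvg he a)) _.
  apply: nearW => n; rewrite inner0l (linear_sumlz (tens K)) inner_suml big1// => k _ /=.
  rewrite linearZl_LR innerZl /basis_enum; case: pickle_inv => [j|].
    by rewrite h1 mulr0.
  by rewrite (linear0l (tens K)) inner0l mulr0.
have [ss hss] := tsum_dense z; apply: rip_eq0.
have h : rip (tsum K (ss n)) z @[n --> \oo] --> (0 : R).
  rewrite (_ : (fun n => _) = fun=> 0); first exact: cvg_cst.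
  by apply/funext => n; rewrite /rip /tsum inner_suml big1.
exact: (cvg_unique _ (hcvg_rip hss (hcvg_cst z)) h).
Qed.

End TensorBasis.

Section ProductStates.
Context (R : realType) (H : hilbert R) (K : tensor_square H).
Context (I : countType) (e : I -> H) (he : orthonormal_basis e).
Implicit Types (a b u v : H) (z w : K) (A B P Q : H -> H).
Let eK := basis_tens K e.
Let heK := tens_orthonormal K he.

Lemma esum_prod (x y : I -> R) (X Y : R) :
  (forall i, 0 <= x i) -> (forall i, 0 <= y i) ->
  (\esum_(i in [set: I]) (x i)%:E = X%:E)%E -> (\esum_(i in [set: I]) (y i)%:E = Y%:E)%E ->
  (\esum_(i in [set: I * I]) (x i.1 * y i.2)%:E = (X * Y)%:E)%E.
Proof.
move=> x0 y0 hX hY.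
have -> : [set: I * I] = [set: I] `*`` (fun=> [set: I]) by apply/seteqP; split.
rewrite -(@esum_esum _ _ _ _ _ (fun i j => (x i * y j)%:E)) => [|i j _ _]; last first.
  by rewrite lee_fin mulr_ge0.
have Y0 : 0 <= Y by rewrite -lee_fin -hY; apply: esum_ge0 => i _; rewrite lee_fin.
have hi i : (\esum_(j in [set: I]) (x i * y j)%:E = Y%:E * (x i)%:E)%E.
  under eq_esum do rewrite EFinM.
  by rewrite ge0_esumZl// hY muleC.
under eq_esum do rewrite hi.
by rewrite ge0_esumZl// hX -EFinM mulrC.
Qed.

Lemma inner_positive P u : positive_op P -> inner (P u) u = ((rip (P u) u)%:C)%C.
Proof.
move=> pP; have := selfadj_Im u (positive_selfadj pP).
by rewrite /rip; case: (inner (P u) u) => x y /= ->.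
Qed.

Lemma rip_optens P Q a b : positive_op P -> positive_op Q ->
  rip (optens K P Q (tens K a b)) (tens K a b) = rip (P a) a * rip (Q b) b.
Proof.
move=> pP pQ; rewrite (optens_tens _ (positive_bop pP) (positive_bop pQ)).
by rewrite /rip tens_inner !inner_positive//; simpc.
Qed.

Lemma state_optens s1 s2 : state e s1 -> state e s2 -> state eK (optens K s1 s2).
Proof.
move=> /stateP[p1 t1] /stateP[p2 t2]; apply/stateP; split; first exact: optens_positive.
have := esum_prod (fun i => positive_rip (e i) p1) (fun i => positive_rip (e i) p2) t1 t2.
by rewrite mulr1 => <-; apply: eq_esum => -[i j] _; rewrite rip_optens.
Qed.

(** The square root of a tensor product is the tensor product of the square roots, so the terms of
    [trace_positive] on the product basis factor. *)
Lemma trace_optens s1 s2 P Q : state e s1 -> state e s2 -> positive_op P -> positive_op Q ->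
  complex.Re (tr eK (optens K s1 s2 \o optens K P Q)) =
  complex.Re (tr e (s1 \o P)) * complex.Re (tr e (s2 \o Q)).
Proof.
move=> h1 h2 pP pQ; have p1 := state_positive h1; have p2 := state_positive h2.
have h12 := state_optens h1 h2; have p12 := optens_positive K p1 p2.
apply: EFin_inj.
rewrite (trace_positive heK p12 (state_has_trace h12) (optens_positive K pP pQ)).
rewrite -(esum_prod _ _ (esym (trace_positive he p1 (state_has_trace h1) pP))
  (esym (trace_positive he p2 (state_has_trace h2) pQ))); last 2 first.
- by move=> i; exact: positive_rip.
- by move=> i; exact: positive_rip.
apply: eq_esum => -[i j] _; rewrite opsqrt_optens// /eK /basis_tens /=.
by rewrite (optens_tens _ (opsqrt_bop p1) (opsqrt_bop p2)) rip_optens.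
Qed.

Section Convex.
Context (n : nat) (x : 'I_n -> R) (s1 s2 : 'I_n -> H -> H).
Hypotheses (x0 : forall k, 0 <= x k) (x1 : \sum_(k < n) x k = 1).
Hypothesis hs : forall k, state e (s1 k) /\ state e (s2 k).
Let c z : K := \sum_(k < n) ((x k)%:C)%C *: optens K (s1 k) (s2 k) z.

Lemma rip_conv z w : rip (c z) w = \sum_(k < n) x k * rip (optens K (s1 k) (s2 k) z) w.
Proof.
rewrite /rip /c inner_suml raddf_sum; apply: eq_bigr => k _ /=.
by rewrite -!/(rip _ _) ripZl.
Qed.

Lemma conv_positive : positive_op c.
Proof.
have p k : positive_op (optens K (s1 k) (s2 k)).
  by have [/state_positive p1 /state_positive p2] := hs k; exact: optens_positive.
split.
  by apply: bop_sumf => k; apply: bop_scale; exact: positive_bop.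
move=> z; rewrite inner_suml sumr_ge0// => k _; rewrite innerZl mulr_ge0 ?ler0c//.
by case: (p k).
Qed.

Lemma esum_conv (J : countType) (z : J -> K) :
  (\esum_(j in [set: J]) (rip (c (z j)) (z j))%:E =
   \sum_(k < n) (x k)%:E * \esum_(j in [set: J]) (rip (optens K (s1 k) (s2 k) (z j)) (z j))%:E)%E.
Proof.
have p k j : 0 <= rip (optens K (s1 k) (s2 k) (z j)) (z j).
  have [/state_positive p1 /state_positive p2] := hs k; apply: positive_rip.
  exact: optens_positive.
under eq_esum do rewrite rip_conv -sumEFin.
rewrite esum_sum => [|j k _ _]; last by rewrite lee_fin mulr_ge0.
apply: eq_bigr => k _; under eq_esum do rewrite EFinM.
by rewrite ge0_esumZl// => j; rewrite lee_fin.
Qed.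

Lemma conv_state : state eK c.
Proof.
apply/stateP; split; first exact: conv_positive.
rewrite esum_conv -[RHS]/((1 : R)%:E) -x1 -sumEFin; apply: eq_bigr => k _.
by have [h1 h2] := hs k; have /stateP[_ ->] := state_optens h1 h2; rewrite mule1.
Qed.

(** Relies on [trace_positive_sqrt], which is linear in the state; the square root of a convex
    combination has no such expansion. *)
Lemma trace_conv (P : K -> K) : positive_op P ->
  complex.Re (tr eK (c \o P)) =
  \sum_(k < n) x k * complex.Re (tr eK (optens K (s1 k) (s2 k) \o P)).
Proof.
move=> pP; apply: EFin_inj; rewrite (trace_positive_sqrt heK conv_state pP).
rewrite esum_conv -sumEFin; apply: eq_bigr => k _.
have [h1 h2] := hs k.
by rewrite -(trace_positive_sqrt heK (state_optens h1 h2) pP).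
Qed.

End Convex.

(** A finite partial sum of the formula for Tr(s P) already exceeds y. By [trace_norm_form] the
    forms of c n converge at its finitely many vectors, and the full sum for c n dominates its
    partial sum. *)
Lemma trace_lower_semicontinuous (s : K -> K) (c : nat -> K -> K) (P : K -> K) (y : R) :
  state eK s -> (forall n, state eK (c n)) -> positive_op P ->
  (forall n, (trace_norm eK (fun z => (s z - c n z)%R) < (n.+1%:R^-1)%:E)%E) ->
  y < complex.Re (tr eK (s \o P)) -> \forall n \near \oo, y <= complex.Re (tr eK (c n \o P)).
Proof.
move=> hs hc pP hn; rewrite -lte_fin (trace_positive_sqrt heK hs pP).
move=> /ereal_sup_gt[_ [X [finX _] <-]].
have ps := state_positive hs.
rewrite fsbig_finite//= sumEFin lte_fin => hy.
set v := fun j => opsqrt P (eK j).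
have hcv j : rip (c n (v j)) (v j) @[n --> \oo] --> rip (s (v j)) (v j).
  apply/cvgrPdist_le => eps eps0.
  have [n0 _ hn0] : \forall n \near \oo, n.+1%:R^-1 * hnorm (v j) ^+ 2 <= eps.
    have : n.+1%:R^-1 * hnorm (v j) ^+ 2 @[n --> \oo] --> (0 : R).
      by rewrite -(mul0r (hnorm (v j) ^+ 2)); apply: cvgMl; exact: cvg_harmonic.
    move=> /cvgrPdist_le/(_ _ eps0); apply: filterS => n.
    by rewrite sub0r normrN ger0_norm// mulr_ge0// sqr_ge0.
  exists n0 => // n /hn0; apply: le_trans; rewrite -ripBl.
  have pc := state_positive (hc n).
  apply: (trace_norm_form heK (T := fun z => s z - c n z)).
  - by apply: bop_sub; exact: positive_bop.
  - move=> z w; rewrite innerBl innerBr (positive_selfadj ps).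
    by rewrite (positive_selfadj pc).
  - by rewrite invr_ge0.
  - exact: ltW.
set J := finmap.enum_fset (fset_set X) in hy *.
have h : \sum_(j <- J) rip (c n (v j)) (v j) @[n --> \oo] -->
    \sum_(j <- J) rip (s (v j)) (v j).
  elim: J {hy} => [|j r ih].
    by rewrite big_nil; under eq_fun do rewrite big_nil; exact: cvg_cst.
  by rewrite big_cons; under eq_fun do rewrite big_cons; exact: cvgD.
move/cvgrPdist_lt: h; rewrite -subr_gt0 in hy => /(_ _ hy).
apply: filterS => n; rewrite ltr_norml => /andP[_ h2].
rewrite -lee_fin (trace_positive_sqrt heK (hc n) pP).
apply: (@le_trans _ _ (\sum_(j <- J) rip (c n (v j)) (v j))%:E).
  by rewrite lee_fin; lra.
apply: esum_ge; exists X; first by split.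
by rewrite fsbig_finite//= sumEFin.
Qed.

End ProductStates.

(** * Integration and measurability *)

Lemma measurable_fun_in d (T : measurableType d) (N : set T) : measurable N ->
  measurable_fun [set: T] (fun x => x \in N).
Proof.
move=> mN; apply: (measurable_fun_bool true); rewrite setTI.
rewrite (_ : _ @^-1` _ = N)//; apply/seteqP; split=> x /=; first by move/set_mem.
by move=> /mem_set.
Qed.

Section IntegralComparison.
Context d (T : measurableType d) (R : realType).
Implicit Types (f g : T -> \bar R).
Local Open Scope ereal_scope.

Import HBNNSimple.

(** Integrals are built from simple functions, whose level sets are measurable. Bare set functions
    are allowed so that [povm_at] can be one of them. *)
Lemma eq_measurable_integral (mu m : set T -> \bar R) :
  (forall A, measurable A -> mu A = m A) -> integral mu = integral m.
Proof.
move=> h; apply/funext => D; apply/funext => f; rewrite /integral.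
have hs (k : {nnsfun T >-> R}) : sintegral mu k = sintegral m k.
  rewrite /sintegral; apply: eq_fsbigr => x _; rewrite h//.
by congr (ereal_sup _ - ereal_sup _); apply/seteqP; split=> _ [k hk <-];
  exists k => //; rewrite hs.
Qed.

Context (mu : {measure set T -> \bar R}).

Lemma ge0_le_integral_nomeas f g : (forall x, 0 <= f x) -> (forall x, f x <= g x) ->
  \int[mu]_x f x <= \int[mu]_x g x.
Proof.
move=> f0 fg; have g0 x : 0 <= g x by exact: le_trans (fg x).
rewrite !ge0_integralTE//; apply: ereal_sup_le => _ [k hk <-].
by exists k => //= x; exact: le_trans (fg x).
Qed.

(* f is not assumed measurable: scalarizations are arbitrary on a null set. *)
Lemma integral_le_off_null f g N : measurable N -> mu N = 0 ->
  (forall x, 0 <= f x) -> (forall x, 0 <= g x) -> measurable_fun [set: T] g ->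
  (forall x, ~ N x -> f x <= g x) -> \int[mu]_x f x <= \int[mu]_x g x.
Proof.
move=> mN N0 f0 g0 mg fg.
(* The value +oo on N makes the domination hold everywhere without changing the integral. *)
pose g' x := if x \in N then +oo else g x.
have g'0 x : 0 <= g' x by rewrite /g'; case: ifP.
have mg' : measurable_fun [set: T] g'.
  apply: measurable_fun_ifT => //; first exact: measurable_fun_in.
rewrite (@ge0_ae_eq_integral _ _ _ mu setT g g')//.
  apply: ge0_le_integral_nomeas => // x; rewrite /g'; case: ifPn => xN.
    exact: leey.
  by apply: fg => Nx; rewrite mem_set in xN.
exists N; split=> // x /= /not_implyP[_] h; apply: contrapT => Nx; apply: h.
by rewrite /g' memNset.
Qed.

(** Here the function of unknown measurability is the larger one, so the measurable one is set to 0
    on N. *)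
Lemma integral_ge_off_null f g N : measurable N -> mu N = 0 ->
  (forall x, 0 <= f x) -> (forall x, 0 <= g x) -> measurable_fun [set: T] g ->
  (forall x, ~ N x -> g x <= f x) -> \int[mu]_x g x <= \int[mu]_x f x.
Proof.
move=> mN N0 f0 g0 mg fg.
pose g' x := if x \in N then 0 else g x.
have g'0 x : 0 <= g' x by rewrite /g'; case: ifP.
have mg' : measurable_fun [set: T] g'.
  apply: measurable_fun_ifT => //; first exact: measurable_fun_in.
rewrite (@ge0_ae_eq_integral _ _ _ mu setT g g')//.
  apply: ge0_le_integral_nomeas => // x; rewrite /g'; case: ifPn => xN //.
  by apply: fg => Nx; rewrite mem_set in xN.
exists N; split=> // x /= /not_implyP[_] h; apply: contrapT => Nx; apply: h.
by rewrite /g' memNset.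
Qed.

Lemma ae_ge0_of_integral (f : T -> R) : mu.-integrable setT (EFin \o f) ->
  (forall E, measurable E -> 0 <= \int[mu]_(x in E) (f x)%:E) ->
  {ae mu, forall x, (0 <= f x)%R}.
Proof.
move=> fi h; have mf : measurable_fun [set: T] f.
  by apply/measurable_EFinP; exact: measurable_int fi.
pose E := [set x | (f x < 0)%R].
have mE : measurable E.
  by rewrite /E -[X in measurable X]setTI; apply: measurable_fun_ltr => //; exact: measurable_cst.
have fiE : mu.-integrable E (EFin \o f) by apply: integrableS fi.
have h0 : \int[mu]_(x in E) `|(EFin \o f) x| = 0.
  apply/eqP; rewrite eq_le integral_ge0// andbT.
  rewrite (eq_integral (fun x => - (EFin \o f) x)); last first.
    by move=> x; rewrite inE => xE /=; rewrite ltr0_norm.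
  rewrite integralN /=; first by rewrite leeNl oppe0 h.
  by apply: integrable_add_def.
have [N [mN N0 hN]] : ae_eq mu E (EFin \o f) (cst 0).
  by apply/(ae_eq_integral_abs _ mE) => //; exact: measurable_int fiE.
exists N; split=> // x /= /negP; rewrite -ltNge => fx0; apply: hN => /= hx.
by have := hx fx0 => -[] fx; move: fx0; rewrite fx ltxx.
Qed.

End IntegralComparison.

Section MeasurableSums.
Context d (T : measurableType d) (R : realType) (I : countType).

Lemma measurable_esum (u : I -> T -> \bar R) : (forall i x, (0 <= u i x)%E) ->
  (forall i, measurable_fun [set: T] (u i)) ->
  measurable_fun [set: T] (fun x => \esum_(i in [set: I]) u i x)%E.
Proof.
move=> u0 mu; under eq_fun do rewrite esum_enum//.
pose h n x := (if @pickle_inv I n is Some i then u i x else 0)%E.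
have := @ge0_emeasurable_sum _ _ _ setT h xpredT.
move=> /(_ _ _)/=.
rewrite (_ : (fun x => _) = (fun x => \sum_(0 <= n <oo | n \in xpredT) h n x)%E); last first.
  by apply/funext => x; apply: eq_eseriesl.
apply.
- by move=> k x _ _; rewrite /h; case: pickle_inv.
- move=> k _; rewrite /h; case: pickle_inv => [i|]; first exact: mu.
  exact: measurable_cst.
Qed.

Lemma measurable_rsum (u : I -> T -> R) : (forall i, measurable_fun [set: T] (u i)) ->
  measurable_fun [set: T] (fun x => rsum (fun i => u i x)).
Proof.
move=> mu; apply: measurable_funB.
  apply: (@measurableT_comp _ _ _ _ _ _ fine); first exact: fine_measurable.
  have h i : measurable_fun [set: T] (fun x => maxe (u i x)%:E 0%E).
    by apply: measurable_maxe => //; apply/measurable_EFinP.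
  under eq_fun do under eq_esum do rewrite funeposE.
  by apply: (measurable_esum _ h) => i x; rewrite le_max lexx orbT.
apply: (@measurableT_comp _ _ _ _ _ _ fine); first exact: fine_measurable.
have h i : measurable_fun [set: T] (fun x => maxe (- (u i x)%:E)%E 0%E).
  by apply: measurable_maxe => //; apply: measurableT_comp => //; apply/measurable_EFinP.
under eq_fun do under eq_esum do rewrite funenegE.
by apply: (measurable_esum _ h) => i x; rewrite le_max lexx orbT.
Qed.

End MeasurableSums.

(** * Countable dense sets and weakly measurable operator-valued functions *)

Section DenseSequence.
Context (R : realType) (H : hilbert R) (I : countType) (e : I -> H).
Context (he : orthonormal_basis e).

Definition comb (t : seq (I * R[i])) : H := \sum_(p <- t) p.2 *: e p.1.

Definition rat_comb (t : seq (I * (rat * rat))) : seq (I * R[i]) :=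
  [seq (p.1, (ratr p.2.1 +i* ratr p.2.2)%C) | p <- t].

Lemma rat_approx (x eps : R) : 0 < eps -> exists y : rat, `|x - ratr y| < eps.
Proof.
move=> e0; have /rat_in_itvoo[y] : x - eps < x + eps by lra.
rewrite in_itv /= => /andP[h1 h2]; exists y.
by rewrite ltr_norml; apply/andP; split; lra.
Qed.

Lemma comb_approx (t : seq (I * R[i])) (eps : R) : 0 < eps ->
  exists t', hnorm (comb t - comb (rat_comb t')) < eps.
Proof.
elim: t eps => [|[i [x y]] t ih] eps e0.
  by exists [::]; rewrite /comb !big_nil subrr hnorm0.
have e4 : 0 < eps / 4 by rewrite divr_gt0.
have [a ha] := rat_approx x e4; have [b hb] := rat_approx y e4.
have [|t' ht'] := ih (eps / 2); first by rewrite divr_gt0.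
exists ((i, (a, b)) :: t'); rewrite /comb /= !big_cons /= -/(comb t) -/(comb (rat_comb t')).
rewrite opprD addrACA -scalerBl.
rewrite (le_lt_trans (hnormD _ _))// (splitr eps) ler_ltD// hnormZ.
have -> : hnorm (e i) = 1 by rewrite /hnorm he.1 eqxx sqrtr1.
rewrite mulr1.
have -> : (x +i* y)%C - (ratr a +i* ratr b)%C = ((x - ratr a)%:C)%C + 'i%C * ((y - ratr b)%:C)%C.
  by simpc.
rewrite (le_trans (le_normcD _ _))// /normc /=; simpc.
rewrite /= !(expr0n, addr0, add0r) /= !sqrtr_sqr; lra.
Qed.

Lemma basis_proj_comb n (u : H) : exists t, basis_proj e n u = comb t.
Proof.
elim: n => [|n [t ht]]; first by exists [::]; rewrite /basis_proj big_ord0 /comb big_nil.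
rewrite /basis_proj big_ord_recr /= -/(basis_proj e n u) ht /basis_enum.
case: pickle_inv => [i|]; last by exists t; rewrite scaler0 addr0.
by exists ((i, inner u (e i)) :: t); rewrite /comb big_cons addrC.
Qed.

(** Finite combinations of basis vectors with coefficients in Q + i Q, enumerated by [unpickle].
    They reduce conditions on all vectors to countably many, for null sets in [derivative_positive]
    and for measurable sets in [wmeas_opsqrt]. *)
Definition dense_seq n : H := comb (rat_comb (odflt [::] (unpickle n))).

Lemma dense_seqP (u : H) (eps : R) : 0 < eps -> exists n, hnorm (u - dense_seq n) < eps.
Proof.
move=> e0; have e2 : 0 < eps / 2 by rewrite divr_gt0.
have /hcvgP/(_ _ e2)[n _ hn] := basis_proj_cvg he u.
have [t ht] := basis_proj_comb n u.
have [t' ht'] := comb_approx t e2; exists (pickle t').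
rewrite /dense_seq pickleK /= (le_lt_trans (hnorm_triangle _ (comb t) _))//.
by rewrite (splitr eps) ltrD// hnormBC -ht; apply: hn => /=.
Qed.

Lemma dense_seq_cvg u : exists k : nat -> nat, hcvg (fun n => dense_seq (k n)) u.
Proof.
have h n : exists k, hnorm (u - dense_seq k) < n.+1%:R^-1.
  by apply: dense_seqP; rewrite invr_gt0.
have [k hk] := choice h; exists k.
apply: (@hcvg_le _ _ (fun n => n.+1%:R^-1)) => [n|]; last exact: cvg_harmonic.
by rewrite hnormBC ltW.
Qed.

End DenseSequence.

Section WeakMeasurability.
Context d (T : measurableType d) (R : realType) (H : hilbert R).
Context (I : countType) (e : I -> H) (he : orthonormal_basis e).
Implicit Types (A B : T -> H -> H) (u v : H).

Definition wmeas A : Prop :=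
  forall u v, measurable_fun [set: T] (fun x => rip (A x u) v).

Lemma wmeas_cst (B : H -> H) : wmeas (fun=> B).
Proof. by move=> u v; exact: measurable_cst. Qed.

Lemma wmeas_add A B : wmeas A -> wmeas B -> wmeas (fun x u => A x u + B x u).
Proof.
by move=> mA mB u v; under eq_fun do rewrite ripDl; exact: measurable_funD.
Qed.

Lemma wmeas_scale (c : R) A : wmeas A -> wmeas (fun x u => (c%:C)%C *: A x u).
Proof.
move=> mA u v; under eq_fun do rewrite ripZl.
by apply: measurable_funM => //; exact: measurable_cst.
Qed.

Lemma wmeas_sub A B : wmeas A -> wmeas B -> wmeas (fun x u => A x u - B x u).
Proof.
by move=> mA mB u v; under eq_fun do rewrite ripBl; exact: measurable_funB.
Qed.

(** Expanding B(x) u in the basis makes <A B u, v> a limit of finite sums of products <B u, e_k> <A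
    e_k, v>; the two products in [h] form the real part of such a complex product. *)
Lemma wmeas_comp A B : (forall x, bounded_op (A x)) -> (forall x, bounded_op (B x)) ->
  wmeas A -> wmeas B -> wmeas (fun x => A x \o B x).
Proof.
move=> bA bB mA mB u v.
pose h n x := \sum_(k < n) (rip (B x u) (basis_enum e k) * rip (A x (basis_enum e k)) v -
  rip (B x u) ('i%C *: basis_enum e k) * rip (A x (basis_enum e k)) ('i%C *: v)).
apply: (@measurable_fun_cvg _ _ _ _ h) => [n|x _].
  apply: measurable_sum => k; apply: measurable_funB; apply: measurable_funM;
    first [exact: mA | exact: mB].
have := hcvg_rip (hcvg_bop (bA x) (basis_proj_cvg he (B x u))) (hcvg_cst v).
rewrite (_ : (fun n => rip _ v) = h ^~ x)//; apply/funext => n /=.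
rewrite /basis_proj (bop_sum _ _ _ (bA x)) /rip inner_suml raddf_sum.
apply: eq_bigr => k _ /=; rewrite (bopZ _ _ (bA x)) innerZl.
rewrite -!/(rip _ _) -!Im_inner /rip.
by case: (inner (B x u) _) => a b; case: (inner (A x _) v) => a' b'; simpc.
Qed.

Lemma wmeas_entry A : (forall x, bounded_op (A x)) ->
  (forall i j, measurable_fun [set: T] (fun x => complex.Re (entry e (A x) i j)) /\
               measurable_fun [set: T] (fun x => complex.Im (entry e (A x) i j))) ->
  wmeas A.
Proof.
move=> bA mA.
have mij i j : measurable_fun [set: T] (fun x => rip (A x (e j)) (e i)) by have [] := mA i j.
have mij' i j : measurable_fun [set: T] (fun x => rip (A x (e j)) ('i%C *: e i)).
  by have [_] := mA i j; under eq_fun do rewrite Im_inner.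
have step1 i u : measurable_fun [set: T] (fun x => rip (A x u) (e i)) /\
    measurable_fun [set: T] (fun x => rip (A x u) ('i%C *: e i)).
  have m1 k : measurable_fun [set: T] (fun x => rip (A x (basis_enum e k)) (e i)).
    rewrite /basis_enum; case: pickle_inv => [j|]; first exact: mij.
    by under eq_fun do rewrite (bop0 (bA _)) rip0l; exact: measurable_cst.
  have m2 k : measurable_fun [set: T] (fun x => rip (A x (basis_enum e k)) ('i%C *: e i)).
    rewrite /basis_enum; case: pickle_inv => [j|]; first exact: mij'.
    by under eq_fun do rewrite (bop0 (bA _)) rip0l; exact: measurable_cst.
  have key n : measurable_fun [set: T] (fun x => rip (A x (basis_proj e n u)) (e i)) /\
      measurable_fun [set: T] (fun x => rip (A x (basis_proj e n u)) ('i%C *: e i)).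
    have hs w x : rip (A x (basis_proj e n u)) w = \sum_(k < n)
        (complex.Re (inner u (basis_enum e k)) * rip (A x (basis_enum e k)) w +
         complex.Im (inner u (basis_enum e k)) * - rip (A x (basis_enum e k)) ('i%C *: w)).
      rewrite /basis_proj (bop_sum _ _ _ (bA x)) /rip inner_suml raddf_sum.
      apply: eq_bigr => k _ /=; rewrite (bopZ _ _ (bA x)) innerZl.
      rewrite -!/(rip _ _) -!Im_inner /rip.
      case: (inner u _) => a b; case: (inner (A x _) w) => a' b'; simpc.
      by rewrite /= ?mulrN.
    split; under eq_fun do rewrite hs.
      apply: measurable_sum => k; apply: measurable_funD; apply: measurable_funM;
        [exact: measurable_cst|exact: m1|exact: measurable_cst|].
      by apply: measurableT_comp => //; exact: m2.
    apply: measurable_sum => k; apply: measurable_funD; apply: measurable_funM;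
      [exact: measurable_cst|exact: m2|exact: measurable_cst|].
    have ii : 'i%C *: ('i%C *: e i) = - e i by rewrite scalerA -expr2 sqr_i scaleN1r.
    by under eq_fun do rewrite ii ripNr opprK; exact: m1.
  split; apply: measurable_fun_cvg => [n|x _].
  - by have [h _] := key n; exact: h.
  - exact: hcvg_rip (hcvg_bop (bA x) (basis_proj_cvg he u)) (hcvg_cst _).
  - by have [_ h] := key n; exact: h.
  - exact: hcvg_rip (hcvg_bop (bA x) (basis_proj_cvg he u)) (hcvg_cst _).
move=> u v.
apply: (@measurable_fun_cvg _ _ _ _ (fun n x => rip (A x u) (basis_proj e n v))) => [n|x _].
  have hs x : rip (A x u) (basis_proj e n v) = \sum_(k < n)
      (complex.Re (inner v (basis_enum e k)) * rip (A x u) (basis_enum e k) +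
       complex.Im (inner v (basis_enum e k)) * rip (A x u) ('i%C *: basis_enum e k)).
    rewrite /basis_proj [LHS]/rip inner_sumr raddf_sum; apply: eq_bigr => k _ /=.
    rewrite innerZr -!Im_inner /rip.
    by case: (inner v _) => a b; case: (inner (A x u) _) => a' b'; simpc.
  under eq_fun do rewrite hs.
  apply: measurable_sum => k; apply: measurable_funD; apply: measurable_funM; try exact: measurable_cst.
    rewrite /basis_enum; case: pickle_inv => [j|]; first by have [] := step1 j u.
    by under eq_fun do rewrite rip0r; exact: measurable_cst.
  rewrite /basis_enum; case: pickle_inv => [j|]; first by have [] := step1 j u.
  by under eq_fun do rewrite scaler0 rip0r; exact: measurable_cst.
exact: hcvg_rip (hcvg_cst _) (basis_proj_cvg he v).
Qed.

Lemma form_bound_dense (B : H -> H) (c : R) : bounded_op B ->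
  (forall n, rip (B (dense_seq e n)) (dense_seq e n) <= c * hnorm (dense_seq e n) ^+ 2) ->
  forall u, rip (B u) u <= c * hnorm u ^+ 2.
Proof.
move=> bB h u; have [k hk] := dense_seq_cvg he u.
apply: (ler_cvg_to (hcvg_rip (hcvg_bop bB hk) hk)); last by apply: nearW => n; exact: h.
apply: cvgMr; rewrite sqr_hnorm; under eq_fun do rewrite sqr_hnorm.
exact: hcvg_rip.
Qed.

(** The approximants require a bound on A(x), which is not uniform in x. The domain is cut into the
    sets [E n] on which n + 1 is such a bound, measurable because the bound is tested on the dense
    sequence; on each of them the approximants with c = n + 1 converge. *)
Lemma wmeas_opsqrt A : (forall x, positive_op (A x)) -> wmeas A ->
  wmeas (fun x => opsqrt (A x)).
Proof.
move=> pA mA u v.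
pose q := dense_seq e.
pose E n := \bigcap_k [set x | rip (A x (q k)) (q k) <= n.+1%:R * hnorm (q k) ^+ 2].
have mE n : measurable (E n).
  apply: bigcapT_measurable => k; rewrite -[X in measurable X]setTI.
  exact: measurable_fun_le.
have ET : \bigcup_n E n = setT.
  apply/seteqP; split=> // x _; have [c c0 hc] := bop_form_bound (positive_bop (pA x)).
  exists (Num.truncn c) => // k _ /=; rewrite (le_trans (hc _))// ler_wpM2r ?sqr_ge0//.
  by rewrite ltW// truncnS_gt.
rewrite -ET; apply/measurable_fun_bigcup => // n.
pose S x w := w - ((n.+1%:R^-1)%:C)%C *: A x w.
have mS : wmeas S by apply: wmeas_sub; [exact: wmeas_cst|exact: wmeas_scale].
have bS x : bounded_op (S x).
  by apply: bop_sub; [exact: bop_id|apply: bop_scale; exact: positive_bop].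
have mB k : wmeas (fun x => sqrt_iter (S x) k).
  elim: k => [|k ih]; first exact: wmeas_cst.
  have bk x : bounded_op (sqrt_iter (S x) k) by exact: sqrt_iter_bop.
  exact: (wmeas_scale (2^-1) (wmeas_add mS (wmeas_comp bk bk ih ih))).
apply: (@measurable_fun_cvg _ _ _ _ (fun k x => rip (sqrt_approx (A x) n.+1%:R k u) v)).
  move=> k; have mk : wmeas (fun x => sqrt_approx (A x) n.+1%:R k).
    apply: (@wmeas_scale _ (fun x u => u - sqrt_iter (S x) k u)).
    exact: (wmeas_sub (wmeas_cst id) (mB k)).
  by apply: measurable_funS (mk u v).
move=> x Ex; apply: hcvg_rip (hcvg_cst v); apply: opsqrt_cvg => //.
by apply: form_bound_dense => [|k]; [exact: positive_bop|exact: Ex].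
Qed.

End WeakMeasurability.

(** * The scalar measure and the density of a POVM *)

Section FiniteSums.
Context (R : realType) (H : hilbert R) (I : countType) (e : I -> H).
Context (he : orthonormal_basis e).

Lemma positive_sum (J : Type) (r : seq J) (P : J -> H -> H) :
  (forall j, positive_op (P j)) -> positive_op (fun u => \sum_(j <- r) P j u).
Proof.
move=> pP; split; first by apply: bop_sumf => j; exact: positive_bop.
by move=> u; rewrite inner_suml sumr_ge0// => j _; case: (pP j).
Qed.

Lemma trace_sum (J : choiceType) (r : seq J) (P : J -> H -> H) (s : H -> H) : state e s ->
  (forall j, positive_op (P j)) ->
  complex.Re (tr e (s \o (fun u => \sum_(j <- r) P j u))) =
  \sum_(j <- r) complex.Re (tr e (s \o P j)).
Proof.
move=> hs pP; have ps := state_positive hs; apply: EFin_inj.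
rewrite (trace_positive he ps (state_has_trace hs) (positive_sum r pP)) -sumEFin.
rewrite (eq_bigr _ (fun j _ => trace_positive he ps (state_has_trace hs) (pP j))).
rewrite -esum_sum => [|i j _ _]; last by rewrite lee_fin positive_rip.
apply: eq_esum => i _; rewrite sumEFin; congr EFin.
by rewrite /rip inner_suml raddf_sum.
Qed.

End FiniteSums.

Section BorelLevel.
Context (R : realType) (X : ptopologicalType).
Context (H : hilbert R) (I : countType) (e : I -> H) (he : orthonormal_basis e).
Local Notation T := (borelType X).
Implicit Types (f g : T -> H -> H).

(* povm_at is unconstrained on non-measurable sets, hence is not itself a measure. *)
Lemma povm_measure (nu : set T -> H -> H) (rho : H -> H) :
  povm e nu -> state e rho ->
  exists m : {measure set T -> \bar R}, forall A, measurable A -> povm_at e rho nu A = m A.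
Proof.
move=> [pnu addnu] hrho; have prho := state_positive hrho.
pose c (A : set T) : R := complex.Re (tr e (rho \o nu A)).
have cvgc (F : nat -> set T) : (forall n, measurable (F n)) -> trivIset setT F ->
    \sum_(k < n) c (F k) @[n --> \oo] --> c (\bigcup_n F n).
  move=> mF tF; have [h _] := addnu F mF tF rho hrho; move: h.
  rewrite (_ : (fun n => _) = fun n => \sum_(k < n) c (F k))//.
  by apply/funext => n; rewrite trace_sum// => k; exact: pnu.
(* The multiples n c(set0) converge, so their constant increments c(set0) tend to 0. *)
have c0 : c set0 = 0.
  have h : \sum_(k < n) c set0 @[n --> \oo] --> c (\bigcup_(n : nat) set0).
    by apply: (cvgc (fun=> set0)) => // i j _ _ [x []].
  rewrite bigcup0// in h.
  have h1 : \sum_(k < n.+1) c set0 @[n --> \oo] --> c set0.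
    by move: h; rewrite -cvg_shiftS.
  have h2 : (\sum_(k < n.+1) c set0 - \sum_(k < n) c set0) @[n --> \oo] --> c set0 - c set0.
    exact: cvgB.
  rewrite (_ : (fun n => _) = fun=> c set0) in h2; last first.
    by apply/funext => n; rewrite !sumr_const !card_ord mulrS addrK.
  by rewrite (cvg_unique _ (cvg_cst (c set0)) h2) // subrr.
have c_ge0 A : measurable A -> 0 <= c A.
  move=> mA; have pA := pnu _ mA.
  rewrite -lee_fin (trace_positive he prho (state_has_trace hrho) pA).
  by apply: esum_ge0 => i _; rewrite lee_fin positive_rip.
pose m0 (A : set T) : \bar R := if `[< measurable A >] then (c A)%:E else 0%E.
have m0E A : measurable A -> m0 A = (c A)%:E by rewrite /m0 => /asboolT ->.
have m00 : m0 set0 = 0%E by rewrite m0E// c0.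
have m0_ge0 A : (0 <= m0 A)%E.
  by rewrite /m0; case: asboolP => // mA; rewrite lee_fin c_ge0.
have m0_add : semi_sigma_additive m0.
  move=> F mF tF mUF; rewrite m0E//.
  rewrite (_ : (fun n => _) = EFin \o (fun n => \sum_(k < n) c (F k))).
    by apply: cvg_EFin; [exact: nearW|exact: cvgc].
  apply/funext => n /=; rewrite big_mkord -sumEFin; apply: eq_bigr => k _.
  exact: m0E.
pose m : {measure set T -> \bar R} := HB.pack_for {measure set T -> \bar R} m0
  (isMeasure.Build _ _ _ m0 m00 m0_ge0 m0_add).
by exists m => A mA; rewrite /= m0E.
Qed.

(** Rank-one states give the quadratic form at unit vectors and scaling gives it at all vectors.
    Since f(x) is self-adjoint, real polarization then recovers the real part of <f u, v>. *)
Lemma wmeas_qrv f : qrv e f -> nonneg f -> wmeas f.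
Proof.
move=> [bf mf] pf.
have unitm v : hnorm v = 1 -> measurable_fun [set: T] (fun x => rip (f x v) v).
  move=> v1; have [h _] := mf _ (rank_one_state he v1).
  by under eq_fun do rewrite -(trace_rank_one he v1 (pf _)); exact: h.
have quadm v : measurable_fun [set: T] (fun x => rip (f x v) v).
  have [v0|vn0] := eqVneq (hnorm v) 0.
    by rewrite (hnorm_eq0 v0); under eq_fun do rewrite rip0r; exact: measurable_cst.
  have vE : v = ((hnorm v)%:C)%C *: ((((hnorm v)^-1)%:C)%C *: v).
    by rewrite scalerA -rmorphM /= mulfV// scale1r.
  have w1 : hnorm ((((hnorm v)^-1)%:C)%C *: v) = 1.
    by rewrite hnormZr ger0_norm ?invr_ge0 ?hnorm_ge0// mulVf.
  rewrite vE; under eq_fun do rewrite (bopZ _ _ (bf _)) ripZl ripZr mulrA.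
  by apply: measurable_funM; [exact: measurable_cst|exact: unitm].
move=> u v.
have pol x : rip (f x u) v =
    4^-1 * (rip (f x (u + v)) (u + v) - rip (f x (u - v)) (u - v)).
  rewrite (bopD _ _ (bf x)) (bopB _ _ (bf x)) !(ripDl, ripDr, ripNl, ripNr).
  have -> : rip (f x v) u = rip (f x u) v.
    by rewrite (selfadj_rip _ _ (positive_selfadj (pf x))) ripC.
  by field.
under eq_fun do rewrite pol.
apply: measurable_funM; first exact: measurable_cst.
by apply: measurable_funB; exact: quadm.
Qed.

Lemma measurable_trace f s : (forall x, bounded_op (f x)) -> wmeas f -> bounded_op s ->
  measurable_fun [set: T] (fun x => complex.Re (tr e (s \o f x))) /\
  measurable_fun [set: T] (fun x => complex.Im (tr e (s \o f x))).
Proof.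
move=> bf mf bs; have ms := wmeas_comp he (fun=> bs) bf (wmeas_cst s) mf.
split; first by apply: measurable_rsum => i; exact: ms.
apply: measurable_rsum => i; under eq_fun do rewrite Im_inner; exact: ms.
Qed.

Lemma wmeas_Lspan f : nonneg f -> wmeas f -> Lspan e f.
Proof.
move=> pf mf; exists 1%N, (fun=> 1), (fun=> f); split=> [_|x u].
  split=> //; split=> [x|s hs]; first exact: positive_bop.
  apply: measurable_trace => // [x|]; first exact: positive_bop.
  exact: positive_bop (state_positive hs).
by rewrite big_ord1 scale1r.
Qed.

(** Conjugating the coefficients in a combination of positive functions yields an explicit pointwise
    adjoint [f'], which stands in for the one picked by [adjoint]. *)
Lemma LspanP f : Lspan e f -> exists f' : T -> H -> H,
  [/\ forall x, bounded_op (f x), forall x, bounded_op (f' x),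
      forall x u v, inner (f x u) v = inner u (f' x v) & wmeas f].
Proof.
move=> [n [c [g [hg hf]]]].
have fE : f = fun x u => \sum_(k < n) c k *: g k x u by apply/funext => x; apply/funext.
have bg k x : bounded_op (g k x) by have [[h _] _] := hg k; exact: h.
exists (fun x u => \sum_(k < n) ((c k)^*)%C *: g k x u); rewrite {}fE; split.
- by move=> x; apply: bop_sumf => k; exact: bop_scale.
- by move=> x; apply: bop_sumf => k; exact: bop_scale.
- move=> x u v; rewrite inner_suml inner_sumr; apply: eq_bigr => k _.
  have [_ pg] := hg k.
  by rewrite innerZl innerZr conjcK (positive_selfadj (pg x)).
- move=> u v.
  have mg k : wmeas (g k) by have [h1 h2] := hg k; exact: wmeas_qrv.
  have gE x : rip (\sum_(k < n) c k *: g k x u) v = \sum_(k < n)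
      (complex.Re (c k) * rip (g k x u) v - complex.Im (c k) * rip (g k x u) ('i%C *: v)).
    rewrite [LHS]/rip inner_suml raddf_sum; apply: eq_bigr => k _ /=.
    rewrite innerZl -Im_inner /rip.
    by case: (c k) => a b; case: (inner _ v) => a' b'; simpc.
  under eq_fun do rewrite gE.
  apply: measurable_sum => k; apply: measurable_funB; apply: measurable_funM;
    first [exact: measurable_cst|exact: mg].
Qed.

End BorelLevel.

Section Density.
Context (R : realType) (X : ptopologicalType).
Context (H : hilbert R) (I : countType) (e : I -> H) (he : orthonormal_basis e).
Local Notation T := (borelType X).
Context (m : {measure set T -> \bar R}) (nu : set T -> H -> H) (D : T -> H -> H).
Hypothesis pnu : forall E, measurable E -> positive_op (nu E).
Hypothesis hD : entrywise_derivative e nu m (fun x => entry e (D x)).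

(** [phi] is a density of [Phi]. As [hD] speaks of single entries, this relation is closed under
    linear combinations in order to reach quadratic forms. *)
Let represents (phi : T -> R) (Phi : set T -> R) : Prop :=
  m.-integrable setT (EFin \o phi) /\
  forall E, measurable E -> ((Phi E)%:E = \int[m]_(x in E) (phi x)%:E)%E.

Let represents_add phi Phi psi Psi : represents phi Phi -> represents psi Psi ->
  represents (fun x => phi x + psi x) (fun E => Phi E + Psi E).
Proof.
move=> [i1 h1] [i2 h2]; split.
  rewrite (_ : EFin \o _ = ((EFin \o phi) \+ (EFin \o psi))%E); last by apply/funext.
  exact: integrableD.
move=> E mE; rewrite EFinD h1// h2//.
have sub : E `<=` setT by [].
under [RHS]eq_integral do rewrite EFinD.
by rewrite integralD//; [exact: integrableS i1|exact: integrableS i2].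
Qed.

Let represents_scale (c : R) phi Phi : represents phi Phi ->
  represents (fun x => c * phi x) (fun E => c * Phi E).
Proof.
move=> [i1 h1]; split.
  rewrite (_ : EFin \o _ = (fun x => c%:E * (EFin \o phi) x)%E); last by apply/funext.
  exact: integrableZl.
move=> E mE; rewrite EFinM h1//.
under [RHS]eq_integral do rewrite EFinM.
by rewrite integralZl//; exact: integrableS i1.
Qed.

Let represents0 : represents (fun=> 0) (fun=> 0).
Proof. by split; [exact: integrable0|move=> E mE; rewrite integral0]. Qed.

Let represents_sum (J : Type) (r : seq J) (phi : J -> T -> R) (Phi : J -> set T -> R) :
  (forall j, represents (phi j) (Phi j)) ->
  represents (fun x => \sum_(j <- r) phi j x) (fun E => \sum_(j <- r) Phi j E).
Proof.
move=> h; elim: r => [|j r ih].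
  under eq_fun do rewrite big_nil; under [in X in represents _ X]eq_fun do rewrite big_nil.
  exact: represents0.
under eq_fun do rewrite big_cons; under [in X in represents _ X]eq_fun do rewrite big_cons.
exact: represents_add.
Qed.

(** The real part of c <A t, t> at a finite combination t, expanded into entries. The factors c = 1,
    i, -i test the real part and both signs of the imaginary part. *)
Let qform (A : H -> H) (t : seq (I * R[i])) (c : R[i]) : R :=
  \sum_(p <- t) \sum_(p' <- t) complex.Re (c * p.2 * ((p'.2)^*)%C * entry e A p'.1 p.1).

Let qformE A t c : bounded_op A ->
  qform A t c = complex.Re (c * inner (A (comb e t)) (comb e t)).
Proof.
move=> bA; rewrite /comb (bop_sum _ _ _ bA) inner_suml mulr_sumr raddf_sum.
apply: eq_bigr => p _ /=; rewrite inner_sumr mulr_sumr raddf_sum; apply: eq_bigr => p' _ /=.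
by rewrite (bopZ _ _ bA) innerZl innerZr /entry !mulrA.
Qed.

Let represents_qform t c : represents (fun x => qform (D x) t c) (fun E => qform (nu E) t c).
Proof.
have ReM (a b : R[i]) : complex.Re (a * b) =
    complex.Re a * complex.Re b + - complex.Im a * complex.Im b.
  by case: a b => [a1 a2] [b1 b2] /=; rewrite mulNr.
apply: represents_sum => p; apply: represents_sum => p'.
have [i1 i2 h] := hD p'.1 p.1.
under eq_fun do rewrite ReM; under [in X in represents _ X]eq_fun do rewrite ReM.
by apply: represents_add; apply: represents_scale; split=> // E /h[].
Qed.

(** Each vector has its own exceptional null set, so positivity is first obtained along the dense
    sequence and then extended to all vectors by continuity of D(x). *)
Lemma derivative_positive : {ae m, forall x, bounded_op (D x)} ->
  {ae m, forall x, positive_op (D x)}.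
Proof.
move=> bD.
have nonneg_ae t c : (forall E, measurable E -> 0 <= qform (nu E) t c) ->
    {ae m, forall x, 0 <= qform (D x) t c}.
  move=> h; have [i1 h1] := represents_qform t c.
  by apply: ae_ge0_of_integral => // E mE; rewrite -h1// lee_fin h.
have inner_pos E t : measurable E ->
    inner (nu E (comb e t)) (comb e t) = ((rip (nu E (comb e t)) (comb e t))%:C)%C.
  by move=> mE; rewrite inner_positive//; exact: pnu.
have ae1 n : {ae m, forall x, bounded_op (D x) -> 0 <= inner (D x (dense_seq e n)) (dense_seq e n)}.
  rewrite /dense_seq; set t := rat_comb R _.
  have h1 : {ae m, forall x, 0 <= qform (D x) t 1}.
    apply: nonneg_ae => E mE; have pE := pnu mE.
    by rewrite (qformE _ _ (positive_bop pE)) inner_pos// mul1r positive_rip.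
  have h2 : {ae m, forall x, 0 <= qform (D x) t 'i%C}.
    apply: nonneg_ae => E mE; have pE := pnu mE.
    by rewrite (qformE _ _ (positive_bop pE)) inner_pos//=; simpc.
  have h3 : {ae m, forall x, 0 <= qform (D x) t (- 'i%C)}.
    apply: nonneg_ae => E mE; have pE := pnu mE.
    by rewrite (qformE _ _ (positive_bop pE)) inner_pos//=; simpc; rewrite /= ?oppr0.
  apply: filterS3 h1 h2 h3 => x + + + bx; rewrite !qformE// ge0_complexE.
  by case: (inner _ _) => a b; simpc => /= h1 h2 h3; apply/andP; split=> //; apply/eqP; lra.
have ae2 : {ae m, forall x, forall n, bounded_op (D x) ->
    0 <= inner (D x (dense_seq e n)) (dense_seq e n)}.
  exact: ae_foralln.
apply: filterS2 bD ae2 => x bx hx; split=> // u.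
have [k hk] := dense_seq_cvg he u.
have hr := hcvg_rip (hcvg_bop bx hk) hk.
have hi := hcvg_rip (hcvg_bop bx hk) (hcvgZ 'i%C hk).
rewrite ge0_complexE Im_inner; apply/andP; split.
  apply/eqP; apply: (cvg_unique _ hi) => //.
  rewrite (_ : (fun n => _) = fun=> 0); first exact: cvg_cst.
  apply/funext => n /=; rewrite -Im_inner.
  by have := hx (k n) bx; rewrite ge0_complexE => /andP[/eqP].
apply: (ler_cvg_to (cvg_cst 0) hr); apply: nearW => n /=.
by have := hx (k n) bx; rewrite ge0_complexE => /andP[].
Qed.

(** Replacing D by 0 on the exceptional set keeps entries measurable and gives a positive operator,
    hence a square root, at every point. *)
Lemma good_density : {ae m, forall x, bounded_op (D x)} ->
  exists (N : set T) (D' : T -> H -> H), [/\ measurable N, m N = 0%E,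
    forall x, positive_op (D' x), wmeas D' & forall x, ~ N x -> D x = D' x].
Proof.
move=> /derivative_positive[N [mN N0 hN]].
have pD x : ~ N x -> positive_op (D x).
  by move=> Nx; apply: contrapT => h; apply: Nx; exact: hN.
pose D' x : H -> H := if x \in N then (fun=> 0) else D x.
have pD' x : positive_op (D' x).
  rewrite /D'; case: ifPn => [_|/negP xN]; last by apply: pD => Nx; apply: xN; rewrite inE.
  by split=> [|u]; [exact: bop_zero|rewrite inner0l].
exists N, D'; split=> //; last first.
  by move=> x Nx; rewrite /D' memNset.
apply: (wmeas_entry he) => [x|i j]; first exact: positive_bop.
have [/measurable_int/measurable_EFinP m1 /measurable_int/measurable_EFinP m2 _] := hD i j.
have h (F : R[i] -> R) : F 0 = 0 -> measurable_fun [set: T] (fun x => F (entry e (D x) i j)) ->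
    measurable_fun [set: T] (fun x => F (entry e (D' x) i j)).
  move=> F0 mF; rewrite (_ : (fun x => _) =
      fun x => if x \in N then 0 else F (entry e (D x) i j)); last first.
    by apply/funext => x; rewrite /D'; case: ifP => // _; rewrite /entry inner0l.
  by apply: measurable_fun_ifT => //; exact: measurable_fun_in.
by split; apply: h.
Qed.

End Density.

(** * Integrals of tensor products *)

Lemma le_poweR2r (R : realType) (p : R) (x y : \bar R) : 0 <= p -> (0 <= x)%E -> (x <= y)%E ->
  (x `^ p <= y `^ p)%E.
Proof.
move=> p0 x0 xy; have x1 : x \in `[0%E, +oo%E] by rewrite in_itv /= leey andbT.
have y1 : y \in `[0%E, +oo%E] by rewrite in_itv /= leey andbT (le_trans x0).
exact: gt0_ler_poweR p0 _ _ x1 y1 xy.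
Qed.

Section LiminfAux.
Context (R : realType).
Implicit Types (u : nat -> \bar R).
Local Open Scope ereal_scope.

Lemma limn_einf_ge u (y : \bar R) : (\forall n \near \oo, y <= u n) -> y <= limn_einf u.
Proof.
move=> [n0 _ hn0]; rewrite limn_einf_lim; apply: lime_ge; first exact: is_cvg_einfs.
exists n0 => // n hn; apply: le_ereal_inf_tmp => _ [k /= hk <-].
by apply: hn0; exact: leq_trans hk.
Qed.

Lemma limn_einf_le u (y : \bar R) : (forall n, u n <= y) -> limn_einf u <= y.
Proof.
move=> h; rewrite limn_einf_lim; apply: lime_le; first exact: is_cvg_einfs.
apply: nearW => n; apply: le_trans (h n); apply: ereal_inf_lbound.
by exists n => /=.
Qed.

Lemma measurable_fun_limn_einf d (T : measurableType d) (f : nat -> T -> \bar R) :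
  (forall n, measurable_fun [set: T] (f n)) ->
  measurable_fun [set: T] (fun x => limn_einf (f ^~ x)).
Proof.
move=> mf; apply: measurableT_comp => //.
apply: (@measurable_fun_limn_esup _ _ _ _ (fun n x => - f n x)) => n.
exact: measurableT_comp.
Qed.

End LiminfAux.

(** Put a = <A u, u> and n = |a|. At the pair (n u, -conj(a) u) the form of the matrix equals 2 n^2
    (<P u, u> - n). *)
Lemma block_ge0_diag (R : realType) (H : hilbert R) (P A A' : H -> H) :
  bounded_op P -> bounded_op A -> bounded_op A' ->
  (forall u v, inner (A u) v = inner u (A' v)) -> positive_op P ->
  block_ge0 P A A' P -> forall u, normc (inner (A u) u) <= rip (P u) u.
Proof.
move=> bP bA bA' AA' pP hb u; set a := inner (A u) u; set n := normc a.
have [->|n0] := eqVneq n 0; first exact: positive_rip.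
have np : 0 < n by rewrite lt0r n0 normc_ge0.
have hPu : inner (P u) u = ((rip (P u) u)%:C)%C by exact: inner_positive.
have ha' : inner (A' u) u = (a^*)%C by rewrite innerC -AA'.
have := hb ((n%:C)%C *: u) (- (a^*)%C *: u).
rewrite !(bopZ _ _ bP) (bopZ _ _ bA) (bopZ _ _ bA') !innerDl !innerZl !innerZr hPu ha' -/a.
have : (normc a) ^+ 2 = complex.Re a ^+ 2 + complex.Im a ^+ 2.
  by rewrite /normc; case: (a) => x y; rewrite sqr_sqrtr ?addr_ge0 ?sqr_ge0.
rewrite -/n; move: (rip (P u) u) => r; case: (a) => x y /= hn.
rewrite ge0_complexE; simpc => /= /andP[_].
rewrite (_ : _ + _ = 2 * n ^+ 2 * (r - n)); last first.
  have -> : 2 * n ^+ 2 * (r - n) = n * n * r + n ^+ 2 * r - 2 * n * n ^+ 2 by ring.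
  by rewrite hn; ring.
by rewrite pmulr_rge0 ?subr_ge0// mulr_gt0// exprn_gt0.
Qed.

Section DensityWeights.
Context (R : realType) (H : hilbert R) (K : tensor_square H).
Context (I : countType) (e : I -> H) (he : orthonormal_basis e).
Context (X : ptopologicalType).
Local Notation T := (borelType X).
Context (m : {measure set T -> \bar R}) (D D' : T -> H -> H) (N : set T).
Hypotheses (mN : measurable N) (mN0 : m N = 0%E).
Hypotheses (pD' : forall x, positive_op (D' x)) (mD' : wmeas D').
Hypothesis DD' : forall x, ~ N x -> D x = D' x.
Let eK := basis_tens K e.
Let heK := tens_orthonormal K he.
Let r x := opsqrt (D' x).
Implicit Types (F G : T -> H -> H).

Let br x : bounded_op (r x). Proof. exact: opsqrt_bop. Qed.
Let sr x : selfadj (r x). Proof. exact: opsqrt_selfadj. Qed.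
Let mr : wmeas r. Proof. exact: (wmeas_opsqrt he pD' mD'). Qed.

Definition conjugated F x : H -> H := r x \o F x \o r x.

Lemma conjugated_positive F x : nonneg F -> positive_op (conjugated F x).
Proof. by move=> pF; exact: positive_comp. Qed.

Lemma conjugated_wmeas F : (forall x, bounded_op (F x)) -> wmeas F -> wmeas (conjugated F).
Proof.
move=> bF mF; apply: (wmeas_comp he) => // [x|]; first exact: bop_comp.
exact: (wmeas_comp he).
Qed.

(** The scalarization taken with [D']: equal to the one with [D] off N, and for nonnegative weakly
    measurable F it is nonnegative and measurable everywhere. *)
Definition weight F s x : R := complex.Re (tr e (s \o conjugated F x)).

Lemma weight_ge0 F s x : nonneg F -> state e s -> 0 <= weight F s x.
Proof.
move=> pF hs; rewrite -lee_fin /weight.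
rewrite (trace_positive he (state_positive hs) (state_has_trace hs) (conjugated_positive x pF)).
by apply: esum_ge0 => i _; rewrite lee_fin positive_rip//; exact: conjugated_positive.
Qed.

Lemma weight_measurable F s : nonneg F -> wmeas F -> state e s ->
  measurable_fun [set: T] (weight F s).
Proof.
move=> pF mF hs; have bF x := positive_bop (pF x).
have bP x := positive_bop (conjugated_positive x pF).
have [h _] := measurable_trace he bP (conjugated_wmeas bF mF) (positive_bop (state_positive hs)).
exact: h.
Qed.

Lemma weightE F s x : ~ N x -> complex.Re (scalarization e D F s x) = weight F s x.
Proof. by move=> Nx; rewrite /scalarization DD'. Qed.

(** Stated with [D], as in [rnorm], so that bounds extracted from the norm apply verbatim;
    [Lnorm_weight] passes to [D']. *)
Definition power_bound (p : R) F (a : R) : Prop := forall s, state e s ->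
  ((\int[m]_x ((complex.Re (scalarization e D F s x)) `^ p)%:E) `^ p^-1 <= a%:E)%E.

Lemma Lnorm_weight p F a s : 0 < p -> nonneg F -> wmeas F -> power_bound p F a ->
  state e s -> (Lnorm m p%:E (EFin \o weight F s) <= a%:E)%E.
Proof.
move=> p0 pF mF hF hs; apply: le_trans (hF s hs); rewrite unlock.
have w0 x : 0 <= weight F s x by exact: weight_ge0.
have mw := weight_measurable pF mF hs.
under eq_integral do rewrite /= ger0_norm//.
apply: le_poweR2r; first by rewrite invr_ge0 ltW.
  by apply: integral_ge0 => x _; rewrite lee_fin powR_ge0.
apply: (integral_ge_off_null mN mN0) => [x|x||x Nx].
- by rewrite lee_fin powR_ge0.
- by rewrite lee_fin powR_ge0.
- apply/measurable_EFinP.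
  by apply: (@measurableT_comp _ _ _ _ _ _ (@powR R ^~ p)) => //; exact: measurable_powR.
- by rewrite weightE.
Qed.

Lemma weight_hoelder p q F G a b s1 s2 : 0 < p -> 0 < q -> p^-1 + q^-1 = 1 ->
  nonneg F -> wmeas F -> nonneg G -> wmeas G -> power_bound p F a -> power_bound q G b ->
  state e s1 -> state e s2 ->
  (\int[m]_x (weight F s1 x * weight G s2 x)%:E <= (a * b)%:E)%E.
Proof.
move=> p0 q0 pq pF mF pG mG hF hG h1 h2.
have mw1 := weight_measurable pF mF h1; have mw2 := weight_measurable pG mG h2.
have := hoelder m mw1 mw2 p0 q0 pq; rewrite Lnorm1.
under eq_integral do rewrite /= ger0_norm ?mulr_ge0 ?weight_ge0//.
move=> /le_trans; apply; rewrite EFinM.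
by apply: lee_pmul; rewrite ?Lnorm_ge0//; exact: Lnorm_weight.
Qed.

Definition weightK F G (s : K -> K) x : R :=
  complex.Re (tr eK (s \o optens K (conjugated F x) (conjugated G x))).

Section Pair.
Context (p q : R) (p0 : 0 < p) (q0 : 0 < q) (pq : p^-1 + q^-1 = 1).
Context (F G : T -> H -> H) (pF : nonneg F) (mF : wmeas F) (pG : nonneg G) (mG : wmeas G).
Context (a b : R) (hF : power_bound p F a) (hG : power_bound q G b).

Let pFG x : positive_op (optens K (conjugated F x) (conjugated G x)).
Proof. by apply: optens_positive; exact: conjugated_positive. Qed.

Lemma weightK_ge0 s x : state eK s -> 0 <= weightK F G s x.
Proof.
move=> hs; rewrite -lee_fin /weightK.
rewrite (trace_positive heK (state_positive hs) (state_has_trace hs) (pFG x)).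
by apply: esum_ge0 => i _; rewrite lee_fin positive_rip.
Qed.

Lemma weightK_conv c : conv_product_states e c ->
  [/\ state eK c, measurable_fun [set: T] (weightK F G c) &
      (\int[m]_x (weightK F G c x)%:E <= (a * b)%:E)%E].
Proof.
move=> [n [w [s1 [s2 [w0 w1 hs ->]]]]]; have hc := conv_state K w0 w1 hs.
have h1 k : state e (s1 k) by have [] := hs k.
have h2 k : state e (s2 k) by have [] := hs k.
have wE x : weightK F G (fun z => \sum_(k < n) ((w k)%:C)%C *: optens K (s1 k) (s2 k) z) x =
    \sum_(k < n) w k * (weight F (s1 k) x * weight G (s2 k) x).
  rewrite /weightK (trace_conv he w0 w1 hs (pFG x)); apply: eq_bigr => k _.
  by rewrite (trace_optens K he (h1 k) (h2 k))//; exact: conjugated_positive.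
have mwk k : measurable_fun [set: T] (fun x => weight F (s1 k) x * weight G (s2 k) x).
  by apply: measurable_funM; exact: weight_measurable.
split=> //.
  rewrite (_ : weightK _ _ _ = fun x => \sum_(k < n) w k * (weight F (s1 k) x * weight G (s2 k) x)).
    apply: measurable_sum => k; apply: measurable_funM => //; exact: measurable_cst.
  by apply/funext => x; rewrite wE.
under eq_integral do rewrite wE -sumEFin.
rewrite ge0_integral_sum//; last 2 first.
- move=> k; apply/measurable_EFinP; apply: measurable_funM => //; exact: measurable_cst.
- by move=> k x _; rewrite lee_fin !mulr_ge0 ?weight_ge0.
apply: (@le_trans _ _ (\sum_(k < n) (w k)%:E * (a * b)%:E)%E).
  apply: lee_sum => k _; under eq_integral do rewrite EFinM.
  rewrite ge0_integralZl_EFin//; last 2 first.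
  - by move=> x _; rewrite lee_fin mulr_ge0 ?weight_ge0.
  - exact/measurable_EFinP.
  apply: lee_wpmul2l; first by rewrite lee_fin.
  exact: (weight_hoelder p0 q0 pq).
by rewrite -ge0_sume_distrl ?sumEFin ?w1 ?mul1e// => k _; rewrite lee_fin.
Qed.

(* Fatou's lemma passes from convex combinations of product states to their closure. *)
Lemma sep_integral_le s (phi : T -> R) : sep_state K e s -> (forall x, 0 <= phi x) ->
  (forall x, ~ N x -> phi x <= weightK F G s x) ->
  (\int[m]_x (phi x)%:E <= (a * b)%:E)%E.
Proof.
move=> [hs happ] phi0 hphi.
have hn n : exists c, conv_product_states e c /\
    (trace_norm eK (fun z => (s z - c z)%R) < (n.+1%:R^-1)%:E)%E.
  have [|c hc hc'] := happ n.+1%:R^-1; first by rewrite invr_gt0.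
  by exists c.
have [c hc] := choice hn.
have cs n : state eK (c n) by have [/weightK_conv[]] := hc n.
have mw n : measurable_fun [set: T] (fun x => (weightK F G (c n) x)%:E).
  by apply/measurable_EFinP; have [/weightK_conv[]] := hc n.
have w0 n x : (0 <= (weightK F G (c n) x)%:E)%E by rewrite lee_fin weightK_ge0.
apply: (@le_trans _ _ (\int[m]_x limn_einf (fun n => (weightK F G (c n) x)%:E))%E).
  apply: (integral_le_off_null mN mN0) => [x|x||x Nx].
  - by rewrite lee_fin.
  - by apply: limn_einf_ge; exact: nearW.
  - exact: measurable_fun_limn_einf.
  apply: (@le_trans _ _ (weightK F G s x)%:E); first by rewrite lee_fin hphi.
  apply/lee_addgt0Pr => eps eps0.
  rewrite -leeBlDr// -EFinB; apply: limn_einf_ge.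
  have := @trace_lower_semicontinuous _ _ K _ _ he s c _ (weightK F G s x - eps) hs cs (pFG x).
  have -> : (weightK F G s x - eps < complex.Re (tr (basis_tens K e)
      (s \o optens K (conjugated F x) (conjugated G x)))) by rewrite ltrBlDr ltrDl.
  move=> /(_ _ isT) h; apply: filterS (h _) => [n|n]; first by rewrite lee_fin.
  by have [] := hc n.
apply: (le_trans (fatou m measurableT mw (fun n x _ => w0 n x))).
by apply: limn_einf_le => n; have [/weightK_conv[]] := hc n.
Qed.

(** A state is at most the identity, so the weight in s is at most the trace of the tensor product,
    a sum over product basis vectors of weights in rank-one states. Hoelder bounds each integral by
    a b, whence (dim H)^2 a b for every state, separable or not. *)
Lemma finite_integral_le s (phi : T -> R) : finite_set [set: I] -> state eK s ->
  (forall x, 0 <= phi x) -> (forall x, ~ N x -> phi x <= weightK F G s x) ->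
  (\int[m]_x (phi x)%:E <= \sum_(i \in [set: I * I]) (a * b)%:E)%E.
Proof.
move=> finI hs phi0 hphi.
have finII : finite_set [set: I * I].
  rewrite (_ : [set: I * I] = [set: I] `*` [set: I]); last by apply/seteqP; split.
  exact: finite_setX.
have e1 i : hnorm (e i) = 1 by rewrite /hnorm he.1 eqxx sqrtr1.
have st i : state e (rank_one (e i)) by exact: rank_one_state.
have wE i x : weight F (rank_one (e i)) x = rip (conjugated F x (e i)) (e i).
  by rewrite /weight trace_rank_one//; exact: conjugated_positive.
have wE' i x : weight G (rank_one (e i)) x = rip (conjugated G x (e i)) (e i).
  by rewrite /weight trace_rank_one//; exact: conjugated_positive.
pose w (k : I * I) x := (weight F (rank_one (e k.1)) x * weight G (rank_one (e k.2)) x)%:E.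
have mw k : measurable_fun [set: T] (w k).
  by apply/measurable_EFinP; apply: measurable_funM; exact: weight_measurable.
have w0 k x : (0 <= w k x)%E by rewrite lee_fin mulr_ge0 ?weight_ge0.
apply: (@le_trans _ _ (\int[m]_x (\sum_(k \in [set: I * I]) w k x))%E).
  apply: (integral_le_off_null mN mN0) => [x|x||x Nx].
  - by rewrite lee_fin.
  - by apply: fsume_ge0 => k _.
  - by under eq_fun do rewrite fsbig_finite//; apply: emeasurable_sum.
  apply: (@le_trans _ _ (weightK F G s x)%:E); first by rewrite lee_fin hphi.
  rewrite /weightK (trace_positive_sqrt heK hs (pFG x)).
  rewrite -esum_fset//.
  apply: le_esum => k _; rewrite lee_fin (le_trans (state_le1 heK _ hs))//.
  rewrite opsqrt_norm// /basis_tens rip_optens; [|exact: conjugated_positive..].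
  by rewrite wE wE'.
rewrite ge0_integral_fsum//.
apply: lee_fsum => // k _; exact: (weight_hoelder p0 q0 pq).
Qed.

End Pair.
End DensityWeights.

(** * The norms *)

Lemma le_mul_of_lt (R : realType) (x A B : \bar R) : (0 <= A < +oo)%E -> (0 <= B < +oo)%E ->
  (forall a b : R, (A < a%:E)%E -> (B < b%:E)%E -> (x <= (a * b)%:E)%E) -> (x <= A * B)%E.
Proof.
move=> /andP[A0 Ay] /andP[B0 By].
have fA : A \is a fin_num by rewrite ge0_fin_numE.
have fB : B \is a fin_num by rewrite ge0_fin_numE.
move: A0 B0; rewrite -(fineK fA) -(fineK fB) !lee_fin.
move: (fine A) (fine B) => a b a0 b0 h; rewrite -EFinM; apply/lee_addgt0Pr => eps eps0.
(* From d <= 1 one gets d^2 <= d, so (a + d)(b + d) <= a b + d (a + b + 1) <= a b + eps. *)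
pose d := Num.min 1 (eps / (a + b + 1)).
have abp : 0 < a + b + 1 by rewrite ltr_wpDl// addr_ge0.
have d0 : 0 < d by rewrite lt_min ltr01 divr_gt0.
have d1 : d <= 1 by rewrite ge_min lexx.
have d2 : d * (a + b + 1) <= eps by rewrite -ler_pdivlMr// ge_min lexx orbT.
have := h (a + d) (b + d); rewrite !lte_fin !ltrDl => /(_ d0 d0) /le_trans; apply.
rewrite -EFinD lee_fin.
have : d * d <= d by rewrite ler_piMr// ltW.
by rewrite mulrDl !mulrDr; lra.
Qed.

Section Decompositions.
Context (R : realType) (X : ptopologicalType).
Context (H : hilbert R) (I : countType) (e : I -> H) (he : orthonormal_basis e).
Local Notation T := (borelType X).
Context (m : {measure set T -> \bar R}) (D : T -> H -> H).
Implicit Types (f g F S : T -> H -> H).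

Lemma nonneg_add F G : nonneg F -> nonneg G -> nonneg (fun x u => F x u + G x u).
Proof.
move=> pF pG x; split; first by apply: bop_add; exact: positive_bop.
by move=> u; rewrite innerDl addr_ge0//; [case: (pF x)|case: (pG x)].
Qed.

Lemma Pos_block f f' f1 f2 f3 f4 : Pos e f f1 f2 f3 f4 ->
  (forall x u v, inner (f x u) v = inner u (f' x v)) ->
  let F := fun x u => f1 x u + f2 x u + f3 x u + f4 x u in
  [/\ nonneg F, wmeas F & forall x, block_ge0 (F x) (f x) (f' x) (F x)].
Proof.
move=> [[L1 p1] [L2 p2] [L3 p3] [L4 p4] hf] ff' F.
have pF : nonneg F by do 3 apply: nonneg_add => //.
have mF : wmeas F.
  have [_ [_ _ _ w1]] := LspanP he L1; have [_ [_ _ _ w2]] := LspanP he L2.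
  have [_ [_ _ _ w3]] := LspanP he L3; have [_ [_ _ _ w4]] := LspanP he L4.
  exact: (wmeas_add (wmeas_add (wmeas_add w1 w2) w3) w4).
split=> // x u v.
(* The matrix [P, c P; conj(c) P, P] with |c| = 1 has at (u, v) the form of P at u + c v. With the
   phases 1, -1, i, -i for f1, ..., f4, the four matrices add up to the one claimed. *)
have key (P : H -> H) (c c' : R[i]) : positive_op P -> (c^*)%C = c' -> c * c' = 1 ->
    0 <= inner (P u) u + c * inner (P v) u + (c' * inner (P u) v + inner (P v) v).
  move=> pP <- cc; have [bP hP] := pP; have := hP (u + c *: v).
  rewrite (bopD _ _ bP) (bopZ _ _ bP) !innerDl !innerDr !innerZl !innerZr.
  by rewrite mulrA cc mul1r; congr (0 <= _); ring.
have k1 := key _ 1 1 (p1 x) (conjc1 _) (mulr1 _).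
have k2 := key _ (-1) (-1) (p2 x) ltac:(exact: rmorphN1) ltac:(by rewrite mulrNN mulr1).
have iN : (('i%C : R[i])^*)%C = - 'i%C by simpc; rewrite /= ?oppr0.
have k3 := key _ 'i%C (- 'i%C) (p3 x) iN ltac:(by rewrite mulrN -expr2 sqr_i opprK).
have k4 := key _ (- 'i%C) 'i%C (p4 x) ltac:(by rewrite -iN conjcK)
  ltac:(by rewrite mulNr -expr2 sqr_i opprK).
have cj P : positive_op P -> ((inner (P v) u)^*)%C = inner (P u) v.
  by move=> pP; rewrite (positive_selfadj pP u v) [RHS]innerC.
have hf' : inner (f' x u) v =
    inner (f1 x u) v - inner (f2 x u) v - 'i%C * inner (f3 x u) v + 'i%C * inner (f4 x u) v.
  have cD (y z : R[i]) : ((y + z)^*)%C = (y^*)%C + (z^*)%C by exact: rmorphD.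
  have cN (y : R[i]) : ((- y)^*)%C = - (y^*)%C by exact: rmorphN.
  have cM (y z : R[i]) : ((y * z)^*)%C = (y^*)%C * (z^*)%C by exact: rmorphM.
  rewrite innerC -ff' hf !innerDl !innerNl !innerZl !(cD, cN, cM) iN !cj//.
  by ring.
have := addr_ge0 (addr_ge0 k1 k2) (addr_ge0 k3 k4); congr (0 <= _).
by rewrite !innerDl hf' hf !innerDl !innerNl !innerZl; ring.
Qed.

Lemma rnorm_lt p f f' (a : R) : (forall x u v, inner (f x u) v = inner u (f' x v)) ->
  (rnorm e m D p f < a%:E)%E -> exists F,
  [/\ nonneg F, wmeas F, forall x, block_ge0 (F x) (f x) (f' x) (F x) & power_bound e m D p F a].
Proof.
move=> ff' /ereal_inf_lt[_ [f1 [f2 [f3 [f4 [hP ->]]]]] hlt].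
have [pF mF bF] := Pos_block hP ff'.
eexists; split; [exact: pF|exact: mF|exact: bF|move=> s hs].
by apply/ltW/(le_lt_trans _ hlt)/ereal_sup_ubound; exists s.
Qed.

(** The decomposition S = S - 0 + i 0 - i 0 is admissible. *)
Lemma rnorm_le p S (a : R) : nonneg S -> wmeas S -> power_bound e m D p S a ->
  (rnorm e m D p S <= a%:E)%E.
Proof.
move=> pS mS hS.
have p0 : nonneg (fun (x : T) (u : H) => 0 : H).
  by move=> x; split=> [|u]; [exact: bop_zero|rewrite inner0l].
have L0 : Lspan e (fun (x : T) (u : H) => 0 : H).
  by apply: (wmeas_Lspan he) => //; exact: wmeas_cst.
have LS : Lspan e S by exact: wmeas_Lspan.
apply: (@le_trans _ _ (ereal_sup [set ((\int[m]_x
    ((complex.Re (scalarization e D (fun x u => (S x u + 0 + 0 + 0)%R) s x)) `^ p)%:E)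
          `^ p^-1)%E | s in state e])).
  apply: ereal_inf_lbound; exists S, (fun _ _ => 0), (fun _ _ => 0), (fun _ _ => 0).
  by split=> //; split=> // x u; rewrite scaler0 !subr0 addr0.
apply: ge_ereal_sup => _ [s hs <-]; move: (hS s hs).
by rewrite (_ : (fun x u => S x u + 0 + 0 + 0) = S)//; apply/funext => x; apply/funext => u;
  rewrite !addr0.
Qed.

(** The given state keeps the suprema from running over the empty set, where they would be -oo. *)
Lemma rnorm_ge0 p f rho : state e rho -> (0 <= rnorm e m D p f)%E.
Proof.
move=> hrho; apply: le_ereal_inf_tmp => _ [f1 [f2 [f3 [f4 [_ ->]]]]].
apply: (@le_trans _ _ ((\int[m]_x ((complex.Re (scalarization e D
  (fun x u => (f1 x u + f2 x u + f3 x u + f4 x u)%R) rho x)) `^ p)%:E) `^ p^-1)%E).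
  exact: poweR_ge0.
by apply: ereal_sup_ubound; exists rho.
Qed.

Lemma block_aeE S1 S2 f f' : (forall x, bounded_op (f' x)) ->
  (forall x u v, inner (f x u) v = inner u (f' x v)) ->
  block_ae m S1 S2 f = {ae m, forall x, block_ge0 (S1 x) (f x) (f' x) (S2 x)}.
Proof.
move=> bf' ff'; congr (almost_everywhere _ _).
by apply/funext => x /=; rewrite (adjointP (bf' x) (ff' x)).
Qed.

(** Finiteness: the sum F of a decomposition of finite norm gives the admissible pair (F, F). *)
Lemma decnorm_lty p f rho : state e rho -> Lr e m D p f -> (0 <= decnorm e m D p f < +oo)%E.
Proof.
move=> hrho [/(LspanP he)[f' [bf bf' ff' mf]] hlt]; apply/andP; split.
  apply: le_ereal_inf_tmp => _ [S1 [S2 [_ _ _ ->]]].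
  by rewrite le_max (rnorm_ge0 p S1 hrho).
have [a ha] : exists a : R, (rnorm e m D p f < a%:E)%E.
  have : (rnorm e m D p f)%E \is a fin_num by rewrite ge0_fin_numE// (rnorm_ge0 _ _ hrho).
  by move/fineK => <-; exists (fine (rnorm e m D p f) + 1); rewrite lte_fin ltrDl.
have [F [pF mF bF hF]] := rnorm_lt ff' ha.
have LF : Lspan e F by exact: wmeas_Lspan.
apply: (@le_lt_trans _ _ (rnorm e m D p F)); last first.
  by apply: (le_lt_trans (rnorm_le pF mF hF)); rewrite ltry.
apply: ereal_inf_lbound; exists F, F; split=> //; last by rewrite maxxx.
by rewrite (block_aeE _ _ bf' ff'); exact: aeW.
Qed.

End Decompositions.

Section TensorNorms.
Context (R : realType) (H : hilbert R) (K : tensor_square H).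
Context (I : countType) (e : I -> H) (he : orthonormal_basis e).
Context (X : ptopologicalType).
Local Notation T := (borelType X).
Context (m : {measure set T -> \bar R}) (D D' : T -> H -> H) (N : set T).
Hypotheses (mN : measurable N) (mN0 : m N = 0%E).
Hypotheses (pD' : forall x, positive_op (D' x)) (mD' : wmeas D').
Hypothesis DD' : forall x, ~ N x -> D x = D' x.
Context (p q : R) (p0 : 0 < p) (q0 : 0 < q) (pq : p^-1 + q^-1 = 1).
Let eK := basis_tens K e.
Let heK := tens_orthonormal K he.

Lemma conjugated_optens (f g : T -> H -> H) x : bounded_op (f x) -> bounded_op (g x) -> ~ N x ->
  opsqrt (ftens K D D x) \o ftens K f g x \o opsqrt (ftens K D D x) =
  optens K (conjugated D' f x) (conjugated D' g x).
Proof.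
move=> bf bg Nx; have br : bounded_op (opsqrt (D' x)) by exact: opsqrt_bop.
rewrite /ftens DD'// opsqrt_optens//; apply/funext => z /=.
by rewrite (optens_comp bf bg br br) optens_comp//; exact: bop_comp.
Qed.

Section Dominated.
Context (f f' g g' F G : T -> H -> H).
Hypotheses (bf : forall x, bounded_op (f x)) (bf' : forall x, bounded_op (f' x)).
Hypotheses (bg : forall x, bounded_op (g x)) (bg' : forall x, bounded_op (g' x)).
Hypothesis ff' : forall x u v, inner (f x u) v = inner u (f' x v).
Hypothesis gg' : forall x u v, inner (g x u) v = inner u (g' x v).
Hypotheses (pF : nonneg F) (pG : nonneg G).
Hypothesis bF : forall x, block_ge0 (F x) (f x) (f' x) (F x).
Hypothesis bG : forall x, block_ge0 (G x) (g x) (g' x) (G x).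

Lemma scalarization_dominated s x : state eK s -> ~ N x ->
  normc (scalarization eK (ftens K D D) (ftens K f g) s x) <= weightK e D' F G s x.
Proof.
move=> hs Nx; have ps := state_positive hs.
pose r := opsqrt (D' x).
have br : bounded_op r by exact: opsqrt_bop.
have sr : selfadj r by exact: opsqrt_selfadj.
pose Q := optens K r r.
have bQ : bounded_op Q by exact: optens_bop.
have sQ : selfadj Q by exact: optens_selfadj.
have bA := optens_bop K (bf x) (bg x); have bA' := optens_bop K (bf' x) (bg' x).
have pFx := pF x; have pGx := pG x.
have bFx := positive_bop pFx; have bGx := positive_bop pGx.
have pP : positive_op (optens K (F x) (G x)) by exact: optens_positive.
have QE : opsqrt (ftens K D D x) = Q by rewrite /ftens DD'// opsqrt_optens.
rewrite /scalarization QE /weightK.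
rewrite -(conjugated_optens bFx bGx Nx) QE.
apply: (@trace_dominated _ _ _ _ heK s ps (state_has_trace hs) (Q \o ftens K f g x \o Q)
    (Q \o optens K (f' x) (g' x) \o Q)).
- by do 2 apply: bop_comp => //.
- by do 2 apply: bop_comp => //.
- by move=> u v /=; rewrite sQ (optens_adj (bf x) (bg x) (bf' x) (bg' x) (ff' x) (gg' x)) sQ.
- exact: positive_comp.
- move=> u /=; rewrite sQ (selfadj_rip _ _ sQ); move: (Q u) => z.
  apply: (@block_ge0_diag _ _ _ _ (optens K (f' x) (g' x))) => //.
  + exact: positive_bop.
  + exact: optens_adj.
  + exact: block_ge0_optens.
Qed.

End Dominated.

Lemma Re_norm (z : R[i]) : complex.Re `|z| = normc z.
Proof. by rewrite normc_def; case: z. Qed.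

Lemma sepnorm_lt f g (a b : R) : Lspan e f -> Lspan e g ->
  (rnorm e m D p f < a%:E)%E -> (rnorm e m D q g < b%:E)%E ->
  (sepnorm K e m D (ftens K f g) <= (a * b)%:E)%E.
Proof.
move=> /(LspanP he)[f' [bf bf' ff' mf]] /(LspanP he)[g' [bg bg' gg' mg]].
move=> /(rnorm_lt he ff')[F [pF mF bF hF]] /(rnorm_lt he gg')[G [pG mG bG hG]].
apply: ge_ereal_sup => _ [s hs <-].
apply: (sep_integral_le he mN mN0 pD' mD' DD' p0 q0 pq pF mF pG mG hF hG hs) => x.
  by rewrite Re_norm normc_ge0.
move=> Nx; rewrite Re_norm.
by apply: (scalarization_dominated bf bf' bg bg' ff' gg') => //; case: hs.
Qed.

Lemma sepnorm_ftens_le f g rho : state e rho -> Lr e m D p f -> Lr e m D q g ->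
  (sepnorm K e m D (ftens K f g) <= rnorm e m D p f * rnorm e m D q g)%E.
Proof.
move=> hrho [Lf hf] [Lg hg].
by apply: le_mul_of_lt => [||a b]; rewrite ?(rnorm_ge0 _ _ _ _ hrho)//; exact: sepnorm_lt.
Qed.

(** On the product basis the entries of S (x) S' are products of entries, which gives weak
    measurability, and a positive weakly measurable function lies in the span. *)
Lemma ftens_Lspan (S S' : T -> H -> H) : Lspan e S -> nonneg S -> Lspan e S' -> nonneg S' ->
  Lspan eK (ftens K S S') /\ nonneg (ftens K S S').
Proof.
move=> LS pS LS' pS'.
have pSS : nonneg (ftens K S S') by move=> x; exact: optens_positive.
have [_ [_ _ _ mS]] := LspanP he LS; have [_ [_ _ _ mS']] := LspanP he LS'.
split=> //; apply: (wmeas_Lspan heK) => //.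
apply: (wmeas_entry heK) => [x|[i j] [k l]]; first exact: positive_bop.
have entryE x : entry eK (ftens K S S' x) (i, j) (k, l) =
    entry e (S x) i k * entry e (S' x) j l.
  by rewrite /entry /eK /basis_tens /ftens /= optens_tens ?tens_inner//; exact: positive_bop.
have m1 : measurable_fun [set: T] (fun x => complex.Re (entry e (S x) i k)) by exact: mS.
have m2 : measurable_fun [set: T] (fun x => complex.Im (entry e (S x) i k)).
  by under eq_fun do rewrite Im_inner; exact: mS.
have m3 : measurable_fun [set: T] (fun x => complex.Re (entry e (S' x) j l)) by exact: mS'.
have m4 : measurable_fun [set: T] (fun x => complex.Im (entry e (S' x) j l)).
  by under eq_fun do rewrite Im_inner; exact: mS'.
have ReM (c d : R[i]) : complex.Re (c * d) =
    complex.Re c * complex.Re d - complex.Im c * complex.Im d.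
  by case: c d => [c1 c2] [d1 d2].
have ImM (c d : R[i]) : complex.Im (c * d) =
    complex.Re c * complex.Im d + complex.Im c * complex.Re d.
  by case: c d => [c1 c2] [d1 d2].
split; under eq_fun do rewrite entryE ?ReM ?ImM.
  by apply: measurable_funB; apply: measurable_funM.
by apply: measurable_funD; apply: measurable_funM.
Qed.

Lemma ftens_L1sep (S S' : T -> H -> H) (a b : R) :
  Lspan e S -> nonneg S -> Lspan e S' -> nonneg S' ->
  (rnorm e m D p S < a%:E)%E -> (rnorm e m D q S' < b%:E)%E ->
  L1sep K e m D (ftens K S S').
Proof.
move=> LS pS LS' pS' ha hb; split; first by have [] := ftens_Lspan LS pS LS' pS'.
by apply: (le_lt_trans (sepnorm_lt LS LS' ha hb)); rewrite ltry.
Qed.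

Lemma ftens_L1tens (S S' : T -> H -> H) (a b : R) : finite_set [set: I] ->
  Lspan e S -> nonneg S -> Lspan e S' -> nonneg S' ->
  (rnorm e m D p S < a%:E)%E -> (rnorm e m D q S' < b%:E)%E ->
  L1tens K e m D (ftens K S S').
Proof.
move=> finI LS pS LS' pS' ha hb; have [LSS pSS] := ftens_Lspan LS pS LS' pS'.
split=> //.
have [S_ [bS bS_ SS_ mS]] := LspanP he LS; have [S'_ [bS' bS'_ SS'_ mS']] := LspanP he LS'.
(* The bound on the norm of S controls the sum F of some decomposition rather than S directly; S (x)
   S' is then dominated by F (x) G in every state. *)
have [F [pF mF bF hF]] := rnorm_lt he SS_ ha.
have [G [pG mG bG hG]] := rnorm_lt he SS'_ hb.
have [_ [_ _ _ mSS]] := LspanP heK LSS.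
pose c := fine (\sum_(i \in [set: I * I]) (a * b)%:E)%E.
have finII : finite_set [set: I * I].
  rewrite (_ : [set: I * I] = [set: I] `*` [set: I]); last by apply/seteqP; split.
  exact: finite_setX.
have cE : (\sum_(i \in [set: I * I]) (a * b)%:E)%E = c%:E.
  by rewrite /c fsbig_finite//= sumEFin.
apply: (@le_lt_trans _ _ c%:E); last by rewrite ltry.
apply: (rnorm_le heK) => // s hs; rewrite invr1.
rewrite poweRe1; last by apply: integral_ge0 => x _; rewrite lee_fin powR_ge0.
rewrite -cE; apply: (finite_integral_le he mN mN0 pD' mD' DD' p0 q0 pq pF mF pG mG hF hG finI hs).
  by move=> x; rewrite powR_ge0.
move=> x Nx; have := scalarization_dominated bS bS_ bS' bS'_ SS_ SS'_ pF pG bF bG hs Nx.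
set z := scalarization _ _ _ _ _ => hz.
have zE : complex.Re z = weightK e D' S S' s x.
  by rewrite /weightK -(conjugated_optens (bS x) (bS' x) Nx).
have z0 : 0 <= complex.Re z by rewrite zE (weightK_ge0 he).
rewrite powRr1// (le_trans _ hz)// /normc; case: (z) z0 => u v /= u0.
by rewrite -{1}(ger0_norm u0) -sqrtr_sqr ler_wsqrtr// lerDl sqr_ge0.
Qed.

End TensorNorms.

(** * From [povm_at] to a measure that agrees with it on measurable sets *)

Section MeasureSwap.
Context (R : realType) (X : ptopologicalType).
Local Notation T := (borelType X).
Context (mu : set T -> \bar R) (m : {measure set T -> \bar R}).
Hypothesis mum : forall A, measurable A -> mu A = m A.

Lemma eq_measurable_ae (P : T -> Prop) : {ae mu, forall x, P x} = {ae m, forall x, P x}.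
Proof.
by apply/propext; split=> -[A [mA A0 hA]]; exists A; split=> //;
  [rewrite -mum|rewrite mum].
Qed.

Lemma eq_measurable_integrable A f : mu.-integrable A f = m.-integrable A f.
Proof. by rewrite unlock (eq_measurable_integral mum). Qed.

Context (H : hilbert R) (I : countType) (e : I -> H).

Lemma eq_rnorm D r f : rnorm e mu D r f = rnorm e m D r f.
Proof. by rewrite /rnorm (eq_measurable_integral mum). Qed.

Lemma eq_Lr D r : Lr e mu D r = Lr e m D r.
Proof. by apply/funext => f; rewrite /Lr /= eq_rnorm. Qed.

Lemma eq_decnorm D r f : decnorm e mu D r f = decnorm e m D r f.
Proof.
rewrite /decnorm; congr ereal_inf; apply/seteqP; split=> _ [S1 [S2 [h1 h2 h3 ->]]];
  exists S1, S2; split=> //; rewrite ?eq_rnorm//; move: h3;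
  by rewrite /block_ae eq_measurable_ae.
Qed.

Context (K : tensor_square H).

Lemma eq_sepnorm D F : sepnorm K e mu D F = sepnorm K e m D F.
Proof. by rewrite /sepnorm (eq_measurable_integral mum). Qed.

Lemma eq_sepdecnorm L D F : sepdecnorm K e L mu D F = sepdecnorm K e L m D F.
Proof.
rewrite /sepdecnorm; congr ereal_inf; apply/seteqP; split=> _ [S1 [S2 [h1 h2 h3 ->]]];
  exists S1, S2; split=> //; rewrite ?eq_sepnorm//; move: h3;
  by rewrite /block_ae eq_measurable_ae.
Qed.

Lemma eq_L1sep D : L1sep K e mu D = L1sep K e m D.
Proof. by apply/funext => F; rewrite /L1sep /= eq_sepnorm. Qed.

End MeasureSwap.

Section DecomposableNorm.
Context (R : realType) (H : hilbert R) (K : tensor_square H).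
Context (I : countType) (e : I -> H) (he : orthonormal_basis e).
Context (X : ptopologicalType).
Local Notation T := (borelType X).
Context (m : {measure set T -> \bar R}) (D D' : T -> H -> H) (N : set T).
Hypotheses (mN : measurable N) (mN0 : m N = 0%E).
Hypotheses (pD' : forall x, positive_op (D' x)) (mD' : wmeas D').
Hypothesis DD' : forall x, ~ N x -> D x = D' x.
Context (p q : R) (p0 : 0 < p) (q0 : 0 < q) (pq : p^-1 + q^-1 = 1).

(** The space L is only asked, in [hL], to contain the tensor products of positive elements with
    finite norms, so one argument serves [L1sep] and [L1tens]. The strict bounds a and b supply
    actual admissible pairs for f and g. *)
Lemma sepdecnorm_le (L : set (T -> K -> K)) (f g : T -> H -> H) rho :
  (forall (S S' : T -> H -> H) (a b : R), Lspan e S -> nonneg S -> Lspan e S' -> nonneg S' ->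
    (rnorm e m D p S < a%:E)%E -> (rnorm e m D q S' < b%:E)%E -> L (ftens K S S')) ->
  state e rho -> Lr e m D p f -> Lr e m D q g ->
  (sepdecnorm K e L m D (ftens K f g) <= decnorm e m D p f * decnorm e m D q g)%E.
Proof.
move=> hL hrho hf hg.
apply: le_mul_of_lt; [exact: (decnorm_lty he hrho hf)|exact: (decnorm_lty he hrho hg)|].
have [/(LspanP he)[f' [bf bf' ff' _]] _] := hf.
have [/(LspanP he)[g' [bg bg' gg' _]] _] := hg.
move=> a b /ereal_inf_lt[_ [S1 [S2 [[L1 n1] [L2 n2] hb ->]]]]; rewrite gt_max => /andP[a1 a2].
move=> /ereal_inf_lt[_ [S1' [S2' [[L1' n1'] [L2' n2'] hb' ->]]]]; rewrite gt_max => /andP[b1 b2].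
apply: (@le_trans _ _ (maxe (sepnorm K e m D (ftens K S1 S1'))
                            (sepnorm K e m D (ftens K S2 S2')))%E); last first.
  rewrite ge_max; apply/andP; split.
    exact: (sepnorm_lt K he mN mN0 pD' mD' DD' p0 q0 pq L1 L1' a1 b1).
  exact: (sepnorm_lt K he mN mN0 pD' mD' DD' p0 q0 pq L2 L2' a2 b2).
apply: ereal_inf_lbound; exists (ftens K S1 S1'), (ftens K S2 S2'); split=> //.
- by split; [exact: hL _ _ _ _ L1 n1 L1' n1' a1 b1|have [] := ftens_Lspan K he L1 n1 L1' n1'].
- by split; [exact: hL _ _ _ _ L2 n2 L2' n2' a2 b2|have [] := ftens_Lspan K he L2 n2 L2' n2'].
rewrite (@block_aeE _ _ _ m _ _ _ (fun x => optens K (f' x) (g' x))).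
- move: hb hb'; rewrite (block_aeE m _ _ bf' ff') (block_aeE m _ _ bg' gg').
  apply: filterS2 => x h h'.
  by apply: block_ge0_optens => //; exact: positive_bop.
- by move=> x; exact: optens_bop.
- by move=> x; exact: optens_adj.
Qed.

End DecomposableNorm.

Theorem theorem4p5 (R : realType)
    (H : hilbert R) (I : countType) (e : I -> H) (he : orthonormal_basis e)
    (K : tensor_square H)
    (X : ptopologicalType)
    (X_lc : locally_compact [set: X]) (X_hausdorff : hausdorff_space X)
    (nu : set (borelType X) -> H -> H) (nu_povm : povm e nu)
    (rho : H -> H) (rho_state : state e rho) (rho_full : full_rank rho)
    (D : borelType X -> H -> H)
    (D_derivative :
       entrywise_derivative e nu (povm_at e rho nu) (fun x => entry e (D x)))
    (D_bounded : {ae (povm_at e rho nu), forall x, bounded_op (D x)})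
    (nu2 : set (borelType X) -> K -> K) (nu2_povm : povm (basis_tens K e) nu2)
    (nu2_derivative :
       entrywise_derivative (basis_tens K e) nu2 (povm_at e rho nu)
         (fun x ij kl => entry e (D x) ij.1 kl.1 * entry e (D x) ij.2 kl.2))
    (p q : R) (p_gt1 : 1 < p) (q_gt1 : 1 < q) (pq : p^-1 + q^-1 = 1)
    (f g : borelType X -> H -> H)
    (hf : Lr e (povm_at e rho nu) D p f) (hg : Lr e (povm_at e rho nu) D q g) :
  let mu := povm_at e rho nu in
  [/\ (sepnorm K e mu D (ftens K f g) <= rnorm e mu D p f * rnorm e mu D q g)%E,
      (sepdecnorm K e (L1sep K e mu D) mu D (ftens K f g)
         <= decnorm e mu D p f * decnorm e mu D q g)%E &
      finite_set [set: I] ->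
      (sepdecnorm K e (L1tens K e mu D) mu D (ftens K f g)
         <= decnorm e mu D p f * decnorm e mu D q g)%E].
Proof.
move=> mu.
(* Norms, spaces and almost-everywhere statements see only measurable sets, so hypotheses and goals
   carry over to the measure [m]. *)
have [m mum] := povm_measure he nu_povm rho_state.
have hD : entrywise_derivative e nu m (fun x => entry e (D x)).
  move=> i j; have [h1 h2 h3] := D_derivative i j; move: h1 h2 h3.
  by rewrite !(eq_measurable_integrable mum) (eq_measurable_integral mum).
have bD : {ae m, forall x, bounded_op (D x)} by rewrite -(eq_measurable_ae mum).
have [N [D' [mN mN0 pD' mD' DD']]] := good_density he nu_povm.1 hD bD.
have p0 : 0 < p by exact: lt_trans p_gt1.
have q0 : 0 < q by exact: lt_trans q_gt1.
move: hf hg; rewrite !(eq_Lr mum) => hf hg; rewrite {}/mu.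
rewrite (eq_sepnorm mum) !(eq_rnorm mum) !(eq_sepdecnorm mum) !(eq_decnorm mum).
rewrite (eq_L1sep mum) /L1tens (eq_Lr mum); split.
- exact: (sepnorm_ftens_le _ he mN mN0 pD' mD' DD' p0 q0 pq rho_state).
- apply: (sepdecnorm_le he mN mN0 pD' mD' DD' p0 q0 pq _ rho_state hf hg) => S S' a b.
  exact: (ftens_L1sep _ he mN mN0 pD' mD' DD' p0 q0 pq).
- move=> finI.
  apply: (sepdecnorm_le he mN mN0 pD' mD' DD' p0 q0 pq _ rho_state hf hg) => S S' a b.
  exact: (ftens_L1tens _ he mN mN0 pD' mD' DD' p0 q0 pq finI).
Qed.
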